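(* Let $f:\mathbb R^2\to\mathbb C$ be a source function with compact support $\Omega$ such that $(f,\Omega)$ satisfies the source assumption stated in the context. Assume further that $\Omega$ is composed of $M$ annuluses and some simply connected polygons with $N$ corners $P_1,\dots,P_N$ in total (each connected component of $\Omega$ being either a simply connected polygon or an annulus). Let $\Theta_L=\{\hat x_1,\dots,\hat x_L\}\subset\mathbb S^1$ be a set of $L$ directions no two of which are collinear, and let $0<k_{\min}<k_{\max}$. If $$L>\max\{8M-4,\ 4M+2N-1\},$$ then all the annuluses and the corners $P_1,P_2,\dots,P_N$ can be uniquely determined by the far field patterns $\{u^\infty(\pm\hat x,k):\hat x\in\Theta_L,\ k\in(k_{\min},k_{\max})\}$.
   Context: Notation. $\mathbb S^1=\{x\in\mathbb R^2:|x|=1\}$; for $\hat x\in\mathbb S^1$, $\hat x^\perp$ is $\hat x$ rotated anticlockwise by $\pi/2$; $l_{\hat x,s}:=\{y\in\mathbb R^2:\hat x\cdot y=s\}$. An annulus is a set $\{y\in\mathbb R^2:r\le|y-y_0|\le R\}$ with $y_0\in\mathbb R^2$, $0\le r<R$ (so closed discs, $r=0$, are included). A point $y\in\partial\Omega$ is a corner if the unit normal to $\partial\Omega$ is not continuous at $y$. Source assumption on $(f,\Omega)$, where $\Omega=\operatorname{supp} f$ is compact: (i) $\Omega$ is a finite union $\bigcup_m\Omega_m$ where the $\Omega_m$ are compact and pairwise disjoint; each boundary $\partial\Omega_m$ is piecewise $C^1$ with finitely many corners, and the interior of each $\Omega_m$ is a connected domain. (Here each $\Omega_m$ is an annulus or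 a simply connected polygon.) (ii) For any $\hat x\in\mathbb S^1$ and any $s\in\mathbb R$ there exist $J(s)<\infty$ and numbers $\alpha_j(s),\beta_j(s)$ with $\beta_j(s)\le\alpha_j(s)$ for $j=1,\dots,J(s)$, $\alpha_j(s)\le\beta_{j+1}(s)$ for $j=1,\dots,J(s)-1$, and $l_{\hat x,s}\cap\Omega=\bigcup_{j=1}^{J(s)}\{s\hat x+\tau\hat x^\perp:\beta_j(s)\le\tau\le\alpha_j(s)\}$. (iii) $f|_{\Omega_m}\in C^1(\Omega_m)$ for every $m$, and $f(y)\ne0$ for all $y\in\partial\Omega$. Far field pattern: $u^\infty(\hat x,k)=\int_{\mathbb R^2}e^{-ik\hat x\cdot y}f(y)\,dy$ for $\hat x\in\mathbb S^1$, $k>0$ (the far field pattern of the radiating solution of $\Delta u+k^2u=-f$ in $\mathbb R^2$). ''Uniquely determined'' means: if two sources both satisfy all the hypotheses of the theorem (for the same $\Theta_L,k_{\min},k_{\max}$) and have the same far field patterns $u^\infty(\pm\hat x,k)$ for all $\hat x\in\Theta_L$, $k\in(k_{\min},k_{\max})$, then their collections of annuluses coincide and their sets of corners coincide. *)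

(* Defs.v *)
From HB Require Import structures.
From mathcomp Require Import all_boot all_order all_algebra.
From mathcomp Require Import complex.
From mathcomp Require Import all_classical all_reals all_analysis.

Set Implicit Arguments.
Unset Strict Implicit.
Unset Printing Implicit Defensive.

Import Order.TTheory GRing.Theory Num.Theory.
Import numFieldNormedType.Exports.

Local Open Scope classical_set_scope.
Local Open Scope ring_scope.
Local Open Scope complex_scope.
Local Open Scope card_scope.


Section Plane.
Context {R : realType}.
Implicit Types (x y z v : R * R) (A : set (R * R)).

Definition dotp x y : R := x.1 * y.1 + x.2 * y.2.

(* The norm `|x| of the library on R * R is the sup norm. *)
Definition enorm x : R := Num.sqrt (dotp x x).

Definition rot90 x : R * R := (- x.2, x.1).

Definition unit_circle : set (R * R) := [set x | enorm x = 1].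

Definition line x (s : R) : set (R * R) := [set y | dotp x y = s].

Definition segment x y : set (R * R) :=
  [set (1 - t) *: x + t *: y | t in `[0, 1]].

Definition collinear x y : Prop := x.1 * y.2 = x.2 * y.1.

Definition frontier A : set (R * R) := closure A `\` A°.

Definition outer_normal A z v : Prop :=
  [/\ enorm v = 1,
      forall eps : R, 0 < eps ->
        \forall w \near z,
          frontier A w -> `|dotp (w - z) v| <= eps * enorm (w - z) &
      \forall t \near 0^'+, ~ A (z + t *: v) /\ A (z - t *: v)].

(* y is not a corner when a unit normal exists at every frontier point near y,
   y included, and is continuous at y along the frontier. *)
Definition normal_continuous_at A y : Prop :=
  exists nu : R * R -> R * R,
    (\forall z \near y, frontier A z -> outer_normal A z (nu z)) /\
    nu z @[z --> within (frontier A) (nbhs y)] --> nu y.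

Definition corners A : set (R * R) :=
  [set y | frontier A y /\ ~ normal_continuous_at A y].

Definition is_annulus A : Prop :=
  exists (y0 : R * R) (r r' : R), [/\ 0 <= r, r < r' &
    A = [set y | r <= enorm (y - y0) <= r']].

(* The edges of the closed chain v_0, ..., v_(n-1), v_0 (ordS is the cyclic
   successor on 'I_n). *)
Definition edge n (v : 'I_n -> R * R) (i : 'I_n) : set (R * R) :=
  segment (v i) (v (ordS i)).

(* Two distinct edges share at most a common endpoint, and consecutive edges
   are not aligned, so that every v i is a genuine vertex. *)
Definition simple_closed_chain n (v : 'I_n -> R * R) : Prop :=
  [/\ (3 <= n)%N, injective v,
      forall i j : 'I_n, i != j -> edge v i `&` edge v j `<=`
        [set v i; v (ordS i)] `&` [set v j; v (ordS j)] &
      forall i, ~ collinear (v (ordS i) - v i)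
                            (v (ordS (ordS i)) - v (ordS i))].

(* A compact region that is the closure of its interior and whose frontier is
   a simple closed polygonal chain.  By the Jordan curve theorem it is the chain
   together with its inside, a closed topological disc: this is what makes the
   polygon simply connected. *)
Definition is_simply_connected_polygon A : Prop :=
  [/\ compact A, A = closure A° &
      exists n (v : 'I_n -> R * R),
        simple_closed_chain v /\ frontier A = \bigcup_(i in setT) edge v i].

Definition regular_C1_arc (g : R -> R * R) : Prop :=
  exists g' : R -> R * R,
  [/\ {within `[0, 1], continuous g}, {within `[0, 1], continuous g'},
      forall t : R, 0 < t < 1 -> is_derive t (1 : R) g (g' t) &
      forall t : R, 0 <= t <= 1 -> g' t != 0].

Definition piecewise_C1 (G : set (R * R)) : Prop :=
  exists n (g : 'I_n -> R -> R * R),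
    (forall i, regular_C1_arc (g i)) /\ G = \bigcup_(i in setT) (g i @` `[0, 1]).

(* C^1 up to the boundary: continuous on A, with partial derivatives in the
   interior of A that extend continuously to A. *)
Definition C1_on_real A (g : R * R -> R) : Prop :=
  {within A, continuous g} /\
  exists g1 g2 : R * R -> R,
  [/\ {within A, continuous g1}, {within A, continuous g2} &
      forall y, A° y ->
        is_derive y ((1, 0) : R * R) g (g1 y) /\
        is_derive y ((0, 1) : R * R) g (g2 y)].

Definition C1_on A (f : R * R -> R[i]) : Prop :=
  C1_on_real A (fun y => complex.Re (f y)) /\
  C1_on_real A (fun y => complex.Im (f y)).

Definition supp (f : R * R -> R[i]) : set (R * R) :=
  closure [set y | f y != 0].

Definition expi (t : R) : R[i] := cos t +i* sin t.

Definition Cintegral (h : R * R -> R[i]) : R[i] :=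
  (\int[(lebesgue_measure \x lebesgue_measure)%E]_(y in setT)
     complex.Re (h y)) +i*
  (\int[(lebesgue_measure \x lebesgue_measure)%E]_(y in setT)
     complex.Im (h y)).

Definition far_field (f : R * R -> R[i]) (x : R * R) (k : R) : R[i] :=
  Cintegral (fun y => expi (- (k * dotp x y)) * f y).

Record source_assumption (f : R * R -> R[i]) n (Om : 'I_n -> set (R * R)) :
    Prop := SourceAssumption {
  source_compact : compact (supp f) ;
  source_union : supp f = \bigcup_(m in setT) Om m ;
  source_compact_piece : forall m, compact (Om m) ;
  source_disjoint : forall m m' : 'I_n, m != m' -> Om m `&` Om m' = set0 ;
  source_boundary : forall m,
    piecewise_C1 (frontier (Om m)) /\ finite_set (corners (Om m)) ;
  source_interior : forall m, (Om m)° !=set0 /\ connected (Om m)° ;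
  source_lines : forall x s, unit_circle x ->
    exists (J : nat) (alpha beta : nat -> R),
    [/\ forall j, (j < J)%N -> beta j <= alpha j,
        forall j, (j.+1 < J)%N -> alpha j <= beta j.+1 &
        line x s `&` supp f =
        \bigcup_(j in `I_J)
          [set s *: x + tau *: rot90 x | tau in `[beta j, alpha j]]] ;
  source_C1 : forall m, C1_on (Om m) f ;
  source_neq0 : forall y, frontier (supp f) y -> f y != 0
}.

Definition annuli n (Om : 'I_n -> set (R * R)) : set (set (R * R)) :=
  [set A | is_annulus A /\ exists m, A = Om m].

Definition annuli_and_polygons n (Om : 'I_n -> set (R * R)) : Prop :=
  forall m, is_annulus (Om m) \/ is_simply_connected_polygon (Om m).

(* The bound is stated in int: truncated subtraction would change it for
   M = 0. *)
Definition enough_directions (L M N : nat) : Prop :=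
  Num.max (8 * M%:Z - 4) (4 * M%:Z + 2 * N%:Z - 1) < L%:Z.

Record admissible_source (L : nat) (f : R * R -> R[i])
    n (Om : 'I_n -> set (R * R)) (M N : nat) : Prop := AdmissibleSource {
  admissible_assumption : source_assumption f Om ;
  admissible_shape : annuli_and_polygons Om ;
  admissible_annuli : annuli Om #= `I_M ;
  admissible_corners : corners (supp f) #= `I_N ;
  admissible_directions : enough_directions L M N
}.

End Plane.

(* Main.v *)
Require Import Defs.
From HB Require Import structures.
From mathcomp Require Import all_boot all_order all_algebra.
From mathcomp Require Import complex.
From mathcomp Require Import all_classical all_reals all_analysis.
From mathcomp Require Import measurable_realfun.
From mathcomp Require Import ring lra zify.

Set Implicit Arguments.
Unset Strict Implicit.
Unset Printing Implicit Defensive.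

Import Order.TTheory GRing.Theory Num.Theory.
Import numFieldNormedType.Exports.

Local Open Scope classical_set_scope.
Local Open Scope ring_scope.

(* The far field patterns at x and -x give, by uniqueness of the Fourier transform
   on an interval, the integrals of the source over the lines orthogonal to x, as a
   function h of the offset of the line (its Radon transform in direction x).  This
   function is smooth up to o(eps) except at lines that are tangent to a circle, where
   it has a square root singularity, or that meet a corner, where its second
   difference h (s + eps) + h (s - eps) - 2 h s is asymptotic to kappa eps with
   kappa != 0.  If a circle c belongs to the first source only, then each other circle
   shares a tangent line with c on the same side for at most four of the 2L vectors
   +-x, and for none if it is concentric with c; so L > 8M - 4 leaves a direction
   where the singularity of c is not compensated.  Equal circles force equal
   annuluses.  Likewise, a corner P of the first source only lies on the line through
   another corner for at most one direction, and on a line tangent to a given circle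
   for at most two, so that L > 4M + 2N - 1 leaves a direction where the kink of P is
   not compensated. *)

(** Two constraints shape the proof. The Radon transforms of the two sources are known to agree only
    at offsets where they are continuous, which may fail on a tangent line s0. That line is
    therefore probed from one side, by [h (s0 + eps) - h (s0 + eps / 4)]: this exceeds every
    multiple of eps for the source that owns the circle and is O(eps) for the other one. Next, C^1
    regularity is given through partial derivatives, so the offset is changed by moving along a
    coordinate axis e, and the points of the plane are written s e + t d with d orthogonal to the
    direction; a shear then replaces rotations. The source is complex: its real and imaginary parts
    are treated apart, and a part that does not vanish at the contact point is selected once the
    direction is chosen. Origin of the bounds: at most 2 (M1 - 1) + 2 M2 circles are not concentric
    with c by construction, each excluding four of 2L vectors; for P, the N1 - 1 + N2 other corners
    exclude one direction each, and the at most 2 M1 circles, by then common to both sources, two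
    each, out of L. *)

Local Notation ind b := ((b%R : bool)%:R).

(** * Bounded functions with compact support *)

Section Integration.
Context {R : realType}.
Local Notation mu := (@lebesgue_measure R).
Local Notation mu2 := (@lebesgue_measure R \x @lebesgue_measure R)%E.
Implicit Types (v w h : R -> R) (u : R * R -> R).

(** The single bound by [B * ind (...)] encodes both boundedness and vanishing outside a ball; every
    function in this class is integrable, whatever the operations it was built with. *)
Definition bcs v := measurable_fun setT v /\
  exists B T : R, [/\ 0 <= B, 0 <= T & forall t, `|v t| <= B * ind (`|t| <= T)].

Definition bcs2 u := measurable_fun setT u /\
  exists B T : R, [/\ 0 <= B, 0 <= T & forall y, `|u y| <= B * ind (`|y| <= T)].

Lemma indic_itv (p q t : R) : \1_`[p, q] t = ind (p <= t <= q) :> R.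
Proof. by rewrite indicE mem_setE in_itv. Qed.

Lemma integrable_itv (c p q : R) :
  mu.-integrable setT (EFin \o (fun t => c * ind (p <= t <= q))).
Proof.
rewrite (_ : _ \o _ = (fun t => (c%:E * (EFin \o \1_`[p, q]) t)%E)); last first.
  by apply/funext => t /=; rewrite EFinM indic_itv.
by apply: integrableZl => //; exact: integrable_indic_itv.
Qed.

Lemma Rintegral_itv (c p q : R) : p <= q ->
  \int[mu]_(t in setT) (c * ind (p <= t <= q)) = c * (q - p).
Proof.
move=> pq; rewrite RintegralZl//; last first.
  by have := integrable_itv 1 p q; under eq_fun do rewrite mul1r.
congr *%R; rewrite /Rintegral.
under eq_integral do rewrite -indic_itv.
rewrite integral_indic// setIT/=; have := lebesgue_measure_itv `[p, q] => /= ->.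
rewrite lte_fin; case: ltP => //= qp.
by apply/esym/eqP; rewrite subr_eq0 eq_le pq qp.
Qed.

Lemma bcs_integrable v : bcs v -> mu.-integrable setT (EFin \o v).
Proof.
move=> [mv [B [T [B0 T0 vB]]]].
apply: le_integrable (integrable_itv B (- T) T) => //.
  exact/measurable_EFinP.
move=> t _ /=; rewrite lee_fin -ler_norml (le_trans (vB t))//.
by rewrite ler_norm.
Qed.

Lemma bcs_measurable v : bcs v -> measurable_fun setT v.
Proof. by case. Qed.

Lemma bcsM v w : bcs v -> measurable_fun setT w ->
  (forall T, exists B, forall t, `|t| <= T -> `|w t| <= B) ->
  bcs (fun t => v t * w t).
Proof.
move=> [mv [B [T [B0 T0 vB]]]] mw /(_ T)[C wC]; split.
  exact: measurable_funM.
exists (B * Num.max C 0), T; split => //; first by rewrite mulr_ge0// le_max lexx orbT.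
move=> t; rewrite normrM; have := vB t; have [tT|_] := boolP (`|t| <= T); last first.
  rewrite !mulr0 => vt; have -> : `|v t| = 0 by apply/eqP; rewrite eq_le vt/=.
  by rewrite mul0r.
by rewrite !mulr1 => vt; rewrite ler_pM// le_max wC.
Qed.

Lemma bcsD v w : bcs v -> bcs w -> bcs (fun t => v t + w t).
Proof.
move=> [mv [B [T [B0 T0 vB]]]] [mw [C [S [C0 S0 wC]]]]; split.
  exact: measurable_funD.
exists (B + C), (Num.max T S); split; rewrite ?addr_ge0 ?le_max ?T0//.
move=> t; rewrite (le_trans (ler_normD _ _))// mulrDl lerD//.
- rewrite (le_trans (vB t))// ler_wpM2l// ler_nat le_max.
  by case: (`|t| <= T).
- rewrite (le_trans (wC t))// ler_wpM2l// ler_nat le_max.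
  by case: (`|t| <= S); rewrite ?orbT.
Qed.

Lemma bcsZ c v : bcs v -> bcs (fun t => c * v t).
Proof.
move=> bv; under eq_fun do rewrite mulrC.
apply: (@bcsM v (fun=> c)) => //.
by move=> T; exists `|c|.
Qed.

Lemma bcsB v w : bcs v -> bcs w -> bcs (fun t => v t - w t).
Proof.
move=> bv bw; under eq_fun do rewrite -mulN1r.
by apply: bcsD => //; exact: bcsZ.
Qed.

Lemma intD v w : bcs v -> bcs w ->
  \int[mu]_(t in setT) (v t + w t) =
  \int[mu]_(t in setT) v t + \int[mu]_(t in setT) w t.
Proof. by move=> bv bw; rewrite RintegralD//; exact: bcs_integrable. Qed.

Lemma intB v w : bcs v -> bcs w ->
  \int[mu]_(t in setT) (v t - w t) =
  \int[mu]_(t in setT) v t - \int[mu]_(t in setT) w t.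
Proof. by move=> bv bw; rewrite RintegralB//; exact: bcs_integrable. Qed.

Lemma intZ c v : bcs v ->
  \int[mu]_(t in setT) (c * v t) = c * \int[mu]_(t in setT) v t.
Proof. by move=> bv; rewrite RintegralZl//; exact: bcs_integrable. Qed.

(* A step function is given by its list of values and closed intervals. *)
Definition stepf (l : seq (R * (R * R))) (t : R) : R :=
  \sum_(i <- l) i.1 * ind (i.2.1 <= t <= i.2.2).

Definition stepi (l : seq (R * (R * R))) : R :=
  \sum_(i <- l) i.1 * (i.2.2 - i.2.1).

Definition step_ok (l : seq (R * (R * R))) := all (fun i => i.2.1 <= i.2.2) l.

Lemma stepf_int l : step_ok l -> mu.-integrable setT (EFin \o stepf l) /\
  \int[mu]_(t in setT) stepf l t = stepi l.
Proof.
elim: l => [_|[c [p q]] l IH /= /andP[/= pq /IH[il il']]].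
  rewrite /stepi big_nil; split.
    rewrite (_ : _ \o _ = cst 0%E); first exact: integrable0.
    by apply/funext => t /=; rewrite /stepf big_nil.
  rewrite (_ : stepf [::] = cst 0) ?Rintegral_cst ?mul0r//.
  by apply/funext => t; rewrite /stepf big_nil.
have E : stepf ((c, (p, q)) :: l) = (fun t => c * ind (p <= t <= q) + stepf l t).
  by apply/funext => t; rewrite /stepf big_cons.
rewrite E; split.
  exact: (integrableD measurableT (integrable_itv c p q) il).
rewrite RintegralD//; last exact: integrable_itv.
by rewrite Rintegral_itv// il' /stepi big_cons.
Qed.

Lemma int_le_step v l : bcs v -> step_ok l -> (forall t, v t <= stepf l t) ->
  \int[mu]_(t in setT) v t <= stepi l.
Proof.
move=> bv ok vl; have [il <-] := stepf_int ok.
by apply: le_Rintegral => //; exact: bcs_integrable.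
Qed.

Lemma int_ge_step v l : bcs v -> step_ok l -> (forall t, stepf l t <= v t) ->
  stepi l <= \int[mu]_(t in setT) v t.
Proof.
move=> bv ok vl; have [il <-] := stepf_int ok.
by apply: le_Rintegral => //; exact: bcs_integrable.
Qed.

Lemma norm_int_le v (c T : R) : bcs v -> 0 <= T ->
  (forall t, `|v t| <= c * ind (`|t| <= T)) ->
  `|\int[mu]_(t in setT) v t| <= c * (2 * T).
Proof.
move=> bv T0 vc; pose l := [:: (c, (- T, T))].
have lT : step_ok l by rewrite /= andbT ge0_cp.
have <- : stepi l = c * (2 * T).
  by rewrite /stepi big_cons big_nil/=; ring.
have E t : stepf l t = c * ind (`|t| <= T).
  by rewrite /stepf big_cons big_nil/= addr0 ler_norml.
rewrite ler_norml; apply/andP; split; last first.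
  by apply: int_le_step => // t; rewrite E (le_trans (ler_norm _)).
rewrite lerNl -mulN1r -intZ//; apply: int_le_step => //; first exact: bcsZ.
by move=> t; rewrite E mulN1r (le_trans (ler_norm _))// normrN.
Qed.

Lemma stepf_cat l1 l2 t : stepf (l1 ++ l2) t = stepf l1 t + stepf l2 t.
Proof. by rewrite /stepf big_cat. Qed.

Lemma stepi_cat l1 l2 : stepi (l1 ++ l2) = stepi l1 + stepi l2.
Proof. by rewrite /stepi big_cat. Qed.

Lemma stepf_ge0 l t : all (fun i => 0 <= i.1) l -> 0 <= stepf l t.
Proof.
move=> /allP l0; rewrite /stepf big_seq_cond sumr_ge0// => i.
by rewrite andbT => /l0 i0; rewrite mulr_ge0.
Qed.

(** Windows of radius r and height b around a list of exceptional abscissae. They dominate an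
    integrand where only its boundedness is known, at a cost proportional to r. *)
Definition windows (b r : R) (ts : seq R) : seq (R * (R * R)) :=
  [seq (b, (t - r, t + r)) | t <- ts].

Lemma stepi_windows b r ts : stepi (windows b r ts) = (size ts)%:R * (b * (2 * r)).
Proof.
rewrite /stepi big_map (eq_bigr (fun=> b * (2 * r))).
  by rewrite big_const_seq count_predT iter_addr_0 [RHS]mulr_natl.
by move=> t _ /=; congr *%R; ring.
Qed.

Lemma windows_ok b r ts : 0 <= r -> step_ok (windows b r ts).
Proof.
move=> r0; apply/allP => i /mapP[t _ ->] /=.
by rewrite lerD2l ge0_cp.
Qed.

Lemma stepf_windows b r ts t t0 : 0 <= b -> t0 \in ts -> `|t - t0| <= r ->
  b <= stepf (windows b r ts) t.
Proof.
move=> b0; elim: ts => // t1 ts IH; rewrite inE => /orP[/eqP ->|tt] tr.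
  rewrite /stepf big_cons/= -ler_distl tr mulr1 lerDl.
  apply: stepf_ge0; apply/allP => i /mapP[? _ ->]//.
rewrite /stepf big_cons/= (le_trans (IH tt tr))// lerDr.
by rewrite mulr_ge0.
Qed.

Lemma stepf_windows_ge0 b r ts t : 0 <= b -> 0 <= stepf (windows b r ts) t.
Proof. by move=> b0; apply: stepf_ge0; apply/allP => i /mapP[? _ ->]. Qed.

End Integration.

(** * Fourier uniqueness on an interval *)

Section Fourier.
Context {R : realType}.
Local Notation mu := (@lebesgue_measure R).
Implicit Types (g h v w : R -> R).

Lemma MVT_from0 (F dF : R -> R) (b : R) : (forall x, is_derive x (1 : R) F (dF x)) ->
  exists2 c, `|c| <= `|b| & F b - F 0 = dF c * b.
Proof.
move=> FdF.
have C a1 b1 : {within `[a1, b1], continuous F}.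
  apply: continuous_subspaceT => x.
  by apply/differentiable_continuous/derivable1_diffP.
have [b0|b0] := leP 0 b.
  have [c cb E] := MVT_segment b0 (fun x _ => FdF x) (C _ _).
  exists c; last by rewrite E subr0.
  by move: cb; rewrite in_itv/= => /andP[c0 cb]; rewrite !ger0_norm.
have [c cb E] := MVT_segment (ltW b0) (fun x _ => FdF x) (C _ _).
exists c; last by rewrite -opprB E sub0r mulrN opprK.
move: cb; rewrite in_itv/= => /andP[cb c0].
by rewrite !ler0_norm ?(ltW b0)// lerN2.
Qed.

Lemma norm_sin1 (b : R) : `|sin b| <= 1.
Proof. by rewrite ler_norml sin_geN1 sin_le1. Qed.

Lemma norm_cos1 (b : R) : `|cos b| <= 1.
Proof. by rewrite ler_norml cos_geN1 cos_le1. Qed.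

Lemma norm_sin (b : R) : `|sin b| <= `|b|.
Proof.
have [c _] := MVT_from0 b (fun x => is_derive_sin x).
rewrite sin0 subr0 => ->; rewrite normrM -[leRHS]mul1r ler_wpM2r//.
exact: norm_cos1.
Qed.

Lemma norm_cosB1 (b : R) : `|cos b - 1| <= `|b|.
Proof.
have [c _] := MVT_from0 b (fun x => is_derive_cos x).
rewrite cos0 => ->; rewrite normrM normrN -[leRHS]mul1r ler_wpM2r//.
exact: norm_sin1.
Qed.

Lemma norm_sinB (b : R) : `|sin b - b| <= b ^+ 2.
Proof.
have [c cb] := @MVT_from0 (fun x => sin x - x) (fun x => cos x - 1) b.
rewrite sin0 !subr0 => ->; rewrite normrM -real_normK ?num_real// expr2.
by rewrite ler_wpM2r// (le_trans (norm_cosB1 c)).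
Qed.

Lemma norm_cosB1_sqr (b : R) : `|cos b - 1| <= b ^+ 2.
Proof.
have [c cb] := MVT_from0 b (fun x => is_derive_cos x).
rewrite cos0 => ->; rewrite normrM normrN -real_normK ?num_real// expr2.
by rewrite ler_wpM2r// (le_trans (norm_sin c)).
Qed.

(** A Taylor remainder of second order. The constant is not sharp; the quadratic order is what
    allows differentiation of Fourier integrals in the frequency. *)
Lemma cosD_bound (a b : R) : `|cos (a + b) - cos a + b * sin a| <= 2 * b ^+ 2.
Proof.
rewrite cosD (_ : cos a * cos b - sin a * sin b - cos a + b * sin a = cos a * (cos b - 1) - sin a * (sin b - b)); last ring.
rewrite (le_trans (ler_normB _ _))// mulr_natl mulr2n lerD//.
  rewrite normrM -[leRHS]mul1r ler_pM// ?norm_cos1//; exact: norm_cosB1_sqr.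
by rewrite normrM -[leRHS]mul1r ler_pM// ?norm_sin1//; exact: norm_sinB.
Qed.

Lemma sinD_bound (a b : R) : `|sin (a + b) - sin a - b * cos a| <= 2 * b ^+ 2.
Proof.
rewrite sinD (_ : sin a * cos b + cos a * sin b - sin a - b * cos a = sin a * (cos b - 1) + cos a * (sin b - b)); last ring.
rewrite (le_trans (ler_normD _ _))// mulr_natl mulr2n lerD//.
  rewrite normrM -[leRHS]mul1r ler_pM// ?norm_sin1//; exact: norm_cosB1_sqr.
by rewrite normrM -[leRHS]mul1r ler_pM// ?norm_cos1//; exact: norm_sinB.
Qed.

End Fourier.

Section FourierUniqueness.
Context {R : realType}.
Local Notation mu := (@lebesgue_measure R).
Implicit Types (g h v w : R -> R).

Lemma continuous_mulid (k : R) : continuous (fun s : R => k * s).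
Proof. by move=> s; apply: mulrl_continuous. Qed.

Lemma bcs_cos v (k : R) : bcs v -> bcs (fun s => v s * cos (k * s)).
Proof.
move=> bv; apply: bcsM => //.
  apply: continuous_measurable_fun => s; apply: continuous_comp.
    exact: continuous_mulid.
  exact: continuous_cos.
by move=> T; exists 1 => t _; exact: norm_cos1.
Qed.

Lemma bcs_sin v (k : R) : bcs v -> bcs (fun s => v s * sin (k * s)).
Proof.
move=> bv; apply: bcsM => //.
  apply: continuous_measurable_fun => s; apply: continuous_comp.
    exact: continuous_mulid.
  exact: continuous_sin.
by move=> T; exists 1 => t _; exact: norm_sin1.
Qed.

Lemma bcs_mulid v : bcs v -> bcs (fun s => v s * s).
Proof.
move=> bv; apply: (@bcsM _ v id) => //.
by move=> T; exists T.
Qed.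

Definition fourier_null (k1 k2 : R) g := bcs g /\ forall k, k1 < k < k2 ->
  \int[mu]_(s in setT) (g s * cos (k * s)) = 0 /\
  \int[mu]_(s in setT) (g s * sin (k * s)) = 0.

Lemma le_small_eq0 (a C : R) (e0 : R) : 0 < e0 ->
  (forall e, 0 < e < e0 -> `|a| <= e * C) -> a = 0.
Proof.
move=> e0gt aC; apply/eqP; rewrite -normr_le0 leNgt; apply/negP => a0.
pose e := Num.min (e0 / 2) (`|a| / 2 / (`|C| + 1)).
have Cp : 0 < `|C| + 1 by rewrite ltr_wpDl.
have egt0 : 0 < e by rewrite lt_min !divr_gt0.
have eC : e * C <= `|a| / 2.
  rewrite (le_trans (y := e * (`|C| + 1)))//.
    by rewrite ler_pM2l// (le_trans (ler_norm _))// lerDl.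
  by rewrite -ler_pdivlMr// ge_min lexx orbT.
have := aC e; rewrite egt0 gt_min [e0 / 2 < e0]gtr_pMr// invf_lt1// ltr1n/=.
move=> /(_ isT) /le_trans/(_ eC); lra.
Qed.

(** The transforms of g vanish on an open interval of frequencies, hence so do their derivatives,
    which are up to sign the transforms of [g s * s]. The difference quotient between k and k + e
    has a remainder of order e, by the Taylor bounds. *)
Lemma fourier_null_mulid k1 k2 g : fourier_null k1 k2 g ->
  fourier_null k1 k2 (fun s => g s * s).
Proof.
move=> [bg gk]; split; first exact: bcs_mulid.
move=> k k12; have [_ [B [T [B0 T0 gB]]]] := bg.
have k2k : 0 < k2 - k by rewrite subr_gt0; case/andP: k12.
have est e (F G : R -> R) : 0 < e ->
    bcs (fun s => g s * (F s - e * s * G s)) ->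
    (forall s, `|F s - e * s * G s| <= 2 * (e * s) ^+ 2) ->
    `|\int[mu]_(s in setT) (g s * (F s - e * s * G s))| <=
       e * (e * (B * (2 * T ^+ 2) * (2 * T))).
  move=> e0 bF Fs.
  rewrite [leRHS](_ : _ = (B * (2 * (e * T) ^+ 2)) * (2 * T)); last by ring.
  apply: norm_int_le => // t; rewrite normrM.
  have := gB t; have [tT|_] := boolP (`|t| <= T); last first.
    rewrite !mulr0 => vt; have -> : `|g t| = 0 by apply/eqP; rewrite eq_le vt/=.
    by rewrite mul0r.
  rewrite !mulr1 => gt; rewrite ler_pM// (le_trans (Fs t))// ler_wpM2l//.
  by rewrite !exprMn ler_wpM2l ?sqr_ge0// -real_normK ?num_real// lerXn2r// nnegrE.
split.
  apply: (@le_small_eq0 _ (B * (2 * T ^+ 2) * (2 * T)) (k2 - k)) => // e /andP[e0 ek].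
  have ke : k1 < k + e < k2.
    by case/andP: k12 => ? ?; apply/andP; split; lra.
  have bF : bcs (fun s => g s * sin ((k + e) * s) - g s * sin (k * s)).
    by apply: bcsB; exact: bcs_sin.
  have bG : bcs (fun s => e * (g s * s * cos (k * s))).
    by apply: bcsZ; apply: bcs_cos; exact: bcs_mulid.
  have E : (fun s => g s * (sin ((k + e) * s) - sin (k * s) - e * s * cos (k * s))) =
      (fun s => (g s * sin ((k + e) * s) - g s * sin (k * s)) - e * (g s * s * cos (k * s))).
    by apply/funext => s; ring.
  have := est e (fun s => sin ((k + e) * s) - sin (k * s)) (fun s => cos (k * s)) e0; cbv beta.
  rewrite E.
  move=> /(_ (bcsB bF bG)) H.
  rewrite -(ler_pM2l e0); have := H _.
  rewrite intB// intZ; last by apply: bcs_cos; exact: bcs_mulid.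
  rewrite intB; [|exact: bcs_sin..].
  rewrite (gk _ ke).2 (gk _ k12).2 subrr sub0r normrN normrM (gtr0_norm e0); apply.
  by move=> s; rewrite mulrDl; exact: sinD_bound.
apply: (@le_small_eq0 _ (B * (2 * T ^+ 2) * (2 * T)) (k2 - k)) => // e /andP[e0 ek].
have ke : k1 < k + e < k2.
  by case/andP: k12 => ? ?; apply/andP; split; lra.
have bF : bcs (fun s => g s * cos ((k + e) * s) - g s * cos (k * s)).
  by apply: bcsB; exact: bcs_cos.
have bG : bcs (fun s => e * (g s * s * sin (k * s))).
  by apply: bcsZ; apply: bcs_sin; exact: bcs_mulid.
have E : (fun s => g s * (cos ((k + e) * s) - cos (k * s) - e * s * - sin (k * s))) =
    (fun s => (g s * cos ((k + e) * s) - g s * cos (k * s)) + e * (g s * s * sin (k * s))).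
  by apply/funext => s; ring.
have := est e (fun s => cos ((k + e) * s) - cos (k * s)) (fun s => - sin (k * s)) e0; cbv beta.
rewrite E.
move=> /(_ (bcsD bF bG)) H.
rewrite -(ler_pM2l e0); have := H _.
rewrite intD// intZ; last by apply: bcs_sin; exact: bcs_mulid.
rewrite intB; [|exact: bcs_cos..].
rewrite (gk _ ke).1 (gk _ k12).1 subrr add0r normrM (gtr0_norm e0); apply.
by move=> s; rewrite mulrDl mulrN opprK; exact: cosD_bound.
Qed.

Lemma fourier_nullD k1 k2 g h : fourier_null k1 k2 g -> fourier_null k1 k2 h ->
  fourier_null k1 k2 (fun s => g s + h s).
Proof.
move=> [bg gk] [bh hk]; split; first exact: bcsD.
move=> k kk; split.
  under eq_Rintegral do rewrite mulrDl.
  by rewrite intD ?(gk _ kk).1 ?(hk _ kk).1 ?addr0//; exact: bcs_cos.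
under eq_Rintegral do rewrite mulrDl.
by rewrite intD ?(gk _ kk).2 ?(hk _ kk).2 ?addr0//; exact: bcs_sin.
Qed.

Lemma fourier_nullZ k1 k2 c g : fourier_null k1 k2 g ->
  fourier_null k1 k2 (fun s => c * g s).
Proof.
move=> [bg gk]; split; first exact: bcsZ.
move=> k kk; split.
  under eq_Rintegral do rewrite -mulrA.
  by rewrite intZ ?(gk _ kk).1 ?mulr0//; exact: bcs_cos.
under eq_Rintegral do rewrite -mulrA.
by rewrite intZ ?(gk _ kk).2 ?mulr0//; exact: bcs_sin.
Qed.

(** A polynomial in s, so that repeated use of [fourier_null_mulid] makes its powers admissible
    factors. It has its maximum 1 at s0, and for large S it is nonnegative on a given bounded
    set. *)
Definition landau (s0 S s : R) : R := 1 - ((s - s0) / S) ^+ 2.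

Lemma fourier_null_landau k1 k2 s0 S n g : fourier_null k1 k2 g ->
  fourier_null k1 k2 (fun s => g s * landau s0 S s ^+ n).
Proof.
move=> Zg; elim: n => [|n IH]; first by under eq_fun do rewrite expr0 mulr1.
have Z1 := fourier_null_mulid IH; have Z2 := fourier_null_mulid Z1.
have := fourier_nullD (fourier_nullD (fourier_nullZ (1 - (s0 / S) ^+ 2) IH)
  (fourier_nullZ (2 * s0 / S ^+ 2) Z1)) (fourier_nullZ (- (S^-1 ^+ 2)) Z2).
congr (fourier_null _ _ _); apply/funext => s.
rewrite (exprSr _ n) -exprVn; move: (_ ^+ n) => L; rewrite /landau; ring.
Qed.

Lemma landauX_continuous s0 S n : continuous (fun s => landau s0 S s ^+ n).
Proof.
move=> x; apply: (@continuous_comp _ _ _ (landau s0 S) (fun y => y ^+ n)); last exact: exprn_continuous.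
apply: (@continuousB _ R^o R^o); first exact: cst_continuous.
apply: (@continuous_comp _ _ _ (fun s => (s - s0) / S) (fun y => y ^+ 2)); last exact: exprn_continuous.
apply: (@continuousM _ R^o); last exact: cst_continuous.
by apply: (@continuousB _ R^o R^o) => //; exact: cst_continuous.
Qed.

Lemma landauX_bounded s0 S n U : exists B, forall t, `|t| <= U ->
  `|landau s0 S t ^+ n| <= B.
Proof.
exists ((1 + ((U + `|s0|) * `|S^-1|) ^+ 2) ^+ n) => t tU.
rewrite normrX lerXn2r// ?nnegrE ?addr_ge0 ?sqr_ge0//.
rewrite (le_trans (ler_normB _ _))// normr1 lerD2l normrX.
rewrite lerXn2r// ?nnegrE ?mulr_ge0 ?addr_ge0//.
  exact: le_trans tU.
by rewrite normrM ler_wpM2r// (le_trans (ler_normB _ _))// lerD2r.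
Qed.

(* Integrating against powers of the Landau kernel concentrates the mass at s0. *)
Lemma landau_pos G (s0 : R) : bcs G -> {for s0, continuous G} ->
  (forall n S, \int[mu]_(s in setT) (G s * landau s0 S s ^+ n) = 0) -> G s0 <= 0.
Proof.
move=> bG cG G0; rewrite leNgt; apply/negP => Gs0.
have [_ [B [T [B0 T0 GB]]]] := bG.
pose c := G s0 / 2; have c0 : 0 < c by rewrite divr_gt0.
have [d0 d0p dG] : exists2 d, 0 < d & forall s, `|s - s0| <= d -> c <= G s.
  have /cvgrPdist_lt/(_ _ c0)/nbhs_ballP[d /= dp H] := cG.
  exists (d / 2); first by rewrite divr_gt0.
  move=> s sd; have := H s; rewrite /ball/= distrC => /(_ _).
  have sd' : `|s - s0| < d by rewrite (le_lt_trans sd)// gtr_pMr// invf_lt1// ltr1n.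
  by move=> /(_ sd'); rewrite ltr_distlC => /andP[+ _]; rewrite /c; lra.
pose d := Num.min d0 1; have dp : 0 < d by rewrite lt_min d0p ltr01.
have {}dG s : `|s - s0| <= d -> c <= G s.
  by move=> sd; apply: dG; rewrite (le_trans sd)// ge_min lexx.
(* S exceeds [|s - s0|] on the whole support, which keeps [landau] nonnegative there, and S >= 2 >=
   2 d makes d / S at most one half. *)
pose S := T + `|s0| + 2.
have S2 : 2 <= S by rewrite lerDr addr_ge0.
have Sp : 0 < S by apply: lt_le_trans S2.
(* [landau] is at most r1 farther than d from s0, and at least r2 > r1 within d / 2 of s0. *)
pose r1 : R := 1 - (d / S) ^+ 2; pose r2 : R := 1 - (d / 2 / S) ^+ 2.
have d1 : d <= 1 by rewrite ge_min lexx orbT.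
have dS : d / S <= 2^-1.
  by rewrite ler_pdivrMr//; lra.
have dS0 : 0 < d / S by rewrite divr_gt0.
have r1p : 0 < r1 by rewrite subr_gt0 expr_lt1// ?ltW//; lra.
have r12 : r1 < r2.
  by rewrite ltrD2l ltrN2 mulrAC exprMn gtr_pMr ?exprn_gt0// expr2; lra.
(* The central interval of length d carries at least c r2^n d, the part of the support beyond
   distance d at most B r1^n 2 T in absolute value, and the zone between has the good sign. Since r1
   < r2, this fails for large n. *)
have key n : c * (r2 ^+ n * d) <= B * (r1 ^+ n * (2 * T)).
  pose l : seq (R * (R * R)) := [:: (c * r2 ^+ n, (s0 - d / 2, s0 + d / 2));
    (- B * r1 ^+ n, (- T, T))].
  have : stepi l <= 0.
    rewrite -(G0 n S); apply: int_ge_step.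
    - apply: bcsM => //; last exact: landauX_bounded.
      apply: continuous_measurable_fun. exact: landauX_continuous.
    - by rewrite /= !andbT; apply/andP; split; lra.
    move=> s; rewrite /stepf !big_cons big_nil/= addr0.
    have -> : (s0 - d / 2 <= s <= s0 + d / 2) = (`|s - s0| <= d / 2).
      by rewrite ler_distl.
    rewrite -ler_norml.
    have := GB s; have [sT|sT] := boolP (`|s| <= T); last first.
      rewrite mulr0 normr_le0 => /eqP Gs; rewrite Gs mul0r mulr0 addr0.
      have [sd|] := boolP (`|s - s0| <= d / 2); last by rewrite mulr0.
      have := dG s; rewrite Gs; have sd' : `|s - s0| <= d by lra.
      by move=> /(_ sd'); lra.
    rewrite !mulr1 => Gs.
    have S0 : `|s - s0| <= S.
      by rewrite (le_trans (ler_normB _ _))// /S; lra.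
    have q0 : 0 <= landau s0 S s.
      rewrite subr_ge0 -real_normK ?num_real// normrM (gtr0_norm (x := S^-1)) ?invr_gt0//.
      by rewrite expr_le1// ?divr_ge0 ?(ltW Sp)// ler_pdivrMr// mul1r.
    have qmon a : 0 <= a -> a <= `|s - s0| -> landau s0 S s <= 1 - (a / S) ^+ 2.
      move=> a0 aS; rewrite lerD2l lerN2 -[leRHS]real_normK ?num_real//.
      rewrite normrM (gtr0_norm (x := S^-1)) ?invr_gt0//.
      rewrite lerXn2r// ?nnegrE ?divr_ge0 ?(ltW Sp)//.
      by rewrite ler_pM2r ?invr_gt0.
    have qmon' a : `|s - s0| <= a -> 1 - (a / S) ^+ 2 <= landau s0 S s.
      move=> aS; have a0 := le_trans (normr_ge0 _) aS.
      rewrite lerD2l lerN2 -[leLHS]real_normK ?num_real//.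
      rewrite normrM (gtr0_norm (x := S^-1)) ?invr_gt0//.
      rewrite lerXn2r// ?nnegrE ?divr_ge0 ?(ltW Sp)//.
      by rewrite ler_pM2r ?invr_gt0.
    have Br : 0 <= B * r1 ^+ n by rewrite mulr_ge0 ?exprn_ge0 ?(ltW r1p).
    have [sd2|sd2] := boolP (`|s - s0| <= d / 2).
      rewrite mulr1 mulNr (@le_trans _ _ (c * r2 ^+ n)) ?gerBl//.
      rewrite ler_pM ?(ltW c0) ?exprn_ge0 ?(ltW (lt_trans r1p r12))//.
        by apply: dG; lra.
      by rewrite lerXn2r// ?nnegrE ?(ltW (lt_trans r1p r12))// qmon'.
    rewrite mulr0 add0r; have [sd|sd] := lerP (`|s - s0|) d.
      rewrite (@le_trans _ _ 0)//; first by rewrite mulNr oppr_le0.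
      by rewrite mulr_ge0 ?exprn_ge0// (le_trans (ltW c0))// dG.
    rewrite mulNr lerNl -mulNr (@le_trans _ _ (`|G s| * landau s0 S s ^+ n))//.
      by rewrite ler_wpM2r ?exprn_ge0// -normrN ler_norm.
    by rewrite ler_pM ?exprn_ge0// lerXn2r// ?nnegrE ?(ltW r1p)// qmon// ltW.
  rewrite /stepi !big_cons big_nil/=.
  rewrite (_ : s0 + d / 2 - (s0 - d / 2) = d); last by field.
  by rewrite opprK; lra.
have r2p := lt_trans r1p r12.
have r1r2 : r1 / r2 < 1 by rewrite ltr_pdivrMr// mul1r.
have r1r20 : 0 < r1 / r2 by rewrite divr_gt0.
have cd : 0 < c * d by rewrite mulr_gt0.
have Bp : 0 < B * (2 * T) + 1 by rewrite ltr_wpDl// !mulr_ge0.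
have : (fun n => (r1 / r2) ^+ n) @ \oo --> (0 : R).
  by apply: cvg_expr; rewrite gtr0_norm.
move=> /cvgrPdist_lt/(_ _ (divr_gt0 cd Bp))[N _ /(_ N (leqnn N))] /=.
rewrite sub0r normrN ger0_norm ?exprn_ge0 ?(ltW r1r20)//.
rewrite expr_div_n ltr_pdivrMr ?exprn_gt0// mulrAC ltr_pdivlMr//.
have := key N; have : 0 < r1 ^+ N by rewrite exprn_gt0.
lra.
Qed.

Lemma landau_eq0 G (s0 : R) : bcs G -> {for s0, continuous G} ->
  (forall n S, \int[mu]_(s in setT) (G s * landau s0 S s ^+ n) = 0) -> G s0 = 0.
Proof.
move=> bG cG G0; apply/eqP; rewrite eq_le landau_pos//= -oppr_le0.
apply: (@landau_pos (fun s => - G s)).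
- by under eq_fun do rewrite -mulN1r; exact: bcsZ.
- exact: continuousN.
move=> n S; under eq_Rintegral do rewrite mulNr -mulN1r.
rewrite intZ ?G0 ?mulr0//; apply: bcsM => //.
  apply: continuous_measurable_fun => x; exact: landauX_continuous.
exact: landauX_bounded.
Qed.

(** One frequency k of the interval suffices: all integrals of [h s * cos (k * s)] and
    [h s * sin (k * s)] against Landau powers vanish, so both products vanish at s0, and cosine and
    sine have no common zero. *)
Lemma fourier_null_eq0 k1 k2 h s0 : k1 < k2 -> fourier_null k1 k2 h ->
  {for s0, continuous h} -> h s0 = 0.
Proof.
move=> k12 Zh ch; pose k := (k1 + k2) / 2.
have kk : k1 < k < k2 by rewrite /k; apply/andP; split; lra.
have bh := Zh.1.
have ck : {for s0, continuous (fun s : R => k * s)} by exact: continuous_mulid.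
have Hc : h s0 * cos (k * s0) = 0.
  apply: (landau_eq0 (bcs_cos k bh)).
    apply: (@continuousM _ R^o) => //.
    by apply: continuous_comp => //; exact: continuous_cos.
  move=> n S; have [_ /(_ _ kk)[H _]] := fourier_null_landau s0 S n Zh.
  by rewrite -[RHS]H; apply: eq_Rintegral => s _; rewrite mulrAC.
have Hs : h s0 * sin (k * s0) = 0.
  apply: (landau_eq0 (bcs_sin k bh)).
    apply: (@continuousM _ R^o) => //.
    by apply: continuous_comp => //; exact: continuous_sin.
  move=> n S; have [_ /(_ _ kk)[_ H]] := fourier_null_landau s0 S n Zh.
  by rewrite -[RHS]H; apply: eq_Rintegral => s _; rewrite mulrAC.
rewrite -[LHS]mulr1 -(cos2Dsin2 (k * s0)) mulrDr !expr2 !mulrA Hc Hs.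
by rewrite !mul0r addr0.
Qed.

End FourierUniqueness.

(** * The Radon transform *)

Section PlaneIntegration.
Context {R : realType}.
Local Notation mu := (@lebesgue_measure R).
Local Notation mu2 := (@lebesgue_measure R \x @lebesgue_measure R)%E.
Local Notation R2 := (measurableTypeR R * measurableTypeR R)%type.
Implicit Types (v w : R -> R) (u U : R * R -> R).

Lemma norm2_le (x : R * R) (r : R) : (`|x| <= r) = (`|x.1| <= r) && (`|x.2| <= r).
Proof. by rewrite prod_normE ge_max. Qed.

(** An open set is the countable union of the boxes with rational corners that it contains, which
    links the topology of the plane to the product sigma-algebra. *)
Lemma open2_measurable (A : set (R * R)) : open A -> measurable (A : set R2).
Proof.
move=> oA.
pose box (i : (rat * rat) * (rat * rat)) : set (R * R) :=
  [set` `]ratr i.1.1, ratr i.1.2[%R] `*` [set` `]ratr i.2.1, ratr i.2.2[%R].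
have -> : A = \bigcup_i (if `[< box i `<=` A >] then box i else set0).
  apply/seteqP; split=> [y Ay|y [i _]]; last by case: asboolP => // + yi; apply.
  have /nbhs_ballP[r /= r0 rA] : nbhs y A by exact: open_nbhs_nbhs.
  have H (z : R) : exists p q, [/\ z - r < ratr p, ratr p < z, z < ratr q & ratr q < z + r].
    have [p] := @rat_in_itvoo R (z - r) z ltac:(by rewrite gtrBl).
    rewrite in_itv/= => /andP[p1 p2].
    have [q] := @rat_in_itvoo R z (z + r) ltac:(by rewrite ltrDl).
    by rewrite in_itv/= => /andP[q1 q2]; exists p, q.
  have [p1 [q1 [a1 a2 a3 a4]]] := H y.1; have [p2 [q2 [b1 b2 b3 b4]]] := H y.2.
  exists ((p1, q1), (p2, q2)) => //; case: asboolP => [_|].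
    by split=> /=; rewrite in_itv/=; apply/andP.
  case=> z [/=]; rewrite !in_itv/= => /andP[c1 c2] /andP[d1 d2].
  apply: rA; split; rewrite /ball/= ltr_distlC; apply/andP; split; lra.
apply: countable_bigcupT_measurable => [|i]; first exact: countableP.
case: asboolP => _; last exact: measurable0.
by apply: measurableX; exact: measurable_itv.
Qed.

Lemma closed2_measurable (A : set (R * R)) : closed A -> measurable (A : set R2).
Proof.
move=> cA; rewrite -(setCK A); apply: measurableC; apply: open2_measurable.
exact: closed_openC.
Qed.

(** The image of Lebesgue measure by a translation gives the same values to half-open intervals,
    hence is Lebesgue measure. *)
Lemma int_translate v (c : R) : bcs v ->
  \int[mu]_(t in setT) v (t + c) = \int[mu]_(t in setT) v t.
Proof.
move=> bv; pose phi : R -> measurableTypeR R := fun t => t + c.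
have mphi : measurable_fun setT phi by exact: measurable_funD.
have bphi : bcs (v \o phi).
  split; first by apply: measurableT_comp => //; exact: bcs_measurable.
  have [_ [B [T [B0 T0 vB]]]] := bv.
  exists B, (T + `|c|); split; rewrite ?addr_ge0// => t.
  rewrite (le_trans (vB _))// ler_wpM2l// ler_nat.
  have [tc|//] := boolP (`|phi t| <= T).
  by rewrite -(addrK c t) (le_trans (ler_normB _ _)) ?lerD2r.
rewrite /Rintegral; congr fine.
transitivity (\int[pushforward mu phi]_t (v t)%:E)%E.
  rewrite integral_pushforward//=.
  - by apply/measurable_EFinP; exact: bcs_measurable.
  - exact: (bcs_integrable bphi).
apply: eq_measure_integral => //= A mA _; apply/esym.
apply: lebesgue_measure_unique => //= _ [[a b]] _ <-.
rewrite /pushforward (_ : phi @^-1` _ = `]a - c, b - c]%classic); last first.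
  by apply/seteqP; split => t /=; rewrite !in_itv/= ltrBlDr lerBrDr.
by rewrite !lebesgue_measure_itv/= !lte_fin ltrD2r -!EFinB opprB addrA subrK.
Qed.

Lemma bcs2_integrable u : bcs2 u -> mu2.-integrable setT (EFin \o (u : R2 -> R)).
Proof.
move=> [mv [B [T [B0 T0 vB]]]].
pose I : set (measurableTypeR R) := `[- T, T]%classic.
pose A : set R2 := I `*` I.
have mA : measurable A by apply: measurableX; exact: measurable_itv.
have uA y : ~ A y -> u y = 0.
  move=> Ay; have := vB y; have [yT|_] := boolP (`|y| <= T); last first.
    by rewrite mulr0 normr_le0 => /eqP.
  by case: Ay; move: yT; rewrite norm2_le => /andP[y1 y2]; split; rewrite /I/= in_itv/= -ler_norml.
have -> : EFin \o u = (EFin \o u) \_ A.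
  by apply/funext => y; rewrite patchE; case: ifPn => // /negP; rewrite inE => /uA /= ->.
have A_lty : (mu2 A < +oo)%E.
  rewrite (_ : mu2 A = mu I * mu I)%E; last first.
    by apply: product_measure1E; exact: measurable_itv.
  rewrite /I; have := lebesgue_measure_itv `[-T, T] => /= ->.
  by case: ifPn => _; rewrite ?mule0 ?ltry// -EFinB -EFinM ltry.
apply/(integrable_mkcond _ mA)/(measurable_bounded_integrable mA A_lty).
  exact: measurable_funTS.
exists B; split; first exact: num_real.
move=> x Bx y _; rewrite /= (le_trans (vB y))//.
by rewrite (le_trans _ (ltW Bx))// ler_piMr// lern1; case: (_ <= _).
Qed.

Lemma bcs2_slice U s : bcs2 U -> bcs (fun t => U (s, t)).
Proof.
move=> [mU [B [T [B0 T0 UB]]]]; split; first exact: measurable_fun_pair2.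
exists B, T; split => // t; rewrite (le_trans (UB _))// ler_wpM2l// ler_nat.
by rewrite norm2_le/=; case: (`|t| <= T); rewrite ?andbF// andbT; case: (_ <= _).
Qed.

Lemma bcs2_swap U : bcs2 U -> bcs2 (fun p => U (p.2, p.1)).
Proof.
move=> [mU [B [T [B0 T0 UB]]]]; split.
  apply: (measurableT_comp mU); apply: measurable_fun_pair.
    exact: measurable_snd.
  exact: measurable_fst.
by exists B, T; split => // t; rewrite (le_trans (UB _))// norm2_le/= andbC -norm2_le.
Qed.

Lemma fubini12 U : bcs2 U -> \int[mu2]_(y in setT) U y =
  \int[mu]_(s in setT) \int[mu]_(t in setT) U (s, t).
Proof.
move=> bU; rewrite /Rintegral; congr fine.
rewrite -(integral12_prod_meas1 (bcs2_integrable bU)).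
apply: eq_integral => s _; rewrite fineK//; apply: integrable_fin_num => //.
exact/bcs_integrable/bcs2_slice.
Qed.

Lemma fubini21 U : bcs2 U -> \int[mu2]_(y in setT) U y =
  \int[mu]_(t in setT) \int[mu]_(s in setT) U (s, t).
Proof.
move=> bU; rewrite /Rintegral; congr fine.
rewrite -(integral21_prod_meas1 (bcs2_integrable bU)).
apply: eq_integral => s _; rewrite fineK//; apply: integrable_fin_num => //.
exact/bcs_integrable/(bcs2_slice _ (bcs2_swap bU)).
Qed.

Lemma bcs2_marginal U : bcs2 U -> bcs (fun s => \int[mu]_(t in setT) U (s, t)).
Proof.
move=> bU; split.
  have mF := measurable_fubini_F (bcs2_integrable bU).
  exact: (measurableT_comp (fine_measurable measurableT) mF).
have [mU [B [T [B0 T0 UB]]]] := bU.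
exists (B * (2 * T)), T; split; rewrite ?mulr_ge0// => s.
rewrite mulrAC; apply: norm_int_le => //; first exact: bcs2_slice.
move=> t; rewrite (le_trans (UB _))// -mulrA ler_wpM2l// norm2_le/=.
by case: (`|s| <= T); case: (`|t| <= T); rewrite ?mulr1 ?mulr0 ?mul1r.
Qed.

End PlaneIntegration.

Section Radon.
Context {R : realType}.
Local Notation mu := (@lebesgue_measure R).
Local Notation mu2 := (@lebesgue_measure R \x @lebesgue_measure R)%E.
Local Notation R2 := (measurableTypeR R * measurableTypeR R)%type.
Implicit Types (v w : R -> R) (u U : R * R -> R) (e d x y : R * R).

Definition pt e d (s t : R) : R * R := (s * e.1 + t * d.1, s * e.2 + t * d.2).

(** The integral over the line of offset s, up to the constant factor given by the length of d. *)
Definition radon u e d (s : R) : R := \int[mu]_(t in setT) u (pt e d s t).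

(** The condition under which s is the offset of [pt e d s t] in direction x. It lets e be a
    coordinate axis that is not parallel to x, at the price of rescaling x. *)
Definition adapted x e d := dotp x e = 1 /\ dotp x d = 0.

Lemma dotp_pt x e d s t : adapted x e d -> dotp x (pt e d s t) = s.
Proof.
rewrite /adapted /dotp /pt /= => -[xe xd].
transitivity (s * (x.1 * e.1 + x.2 * e.2) + t * (x.1 * d.1 + x.2 * d.2)); first by ring.
by rewrite xe xd mulr1 mulr0 addr0.
Qed.

Lemma dotp_bound x y : `|dotp x y| <= 2 * `|x| * `|y|.
Proof.
rewrite /dotp (le_trans (ler_normD _ _))// -mulrA mulr_natl mulr2n !normrM.
by rewrite lerD// ler_pM// prod_normE le_max lexx ?orbT.
Qed.

Lemma pt_coord_bound x e d s t : adapted x e d -> d != 0 ->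
  `|(s, t)| <= (2 * `|x| + (1 + 2 * `|x| * `|e|) / `|d|) * `|pt e d s t|.
Proof.
move=> ad d0; set Y := pt e d s t.
have dp : 0 < `|d| by rewrite normr_gt0.
have sb : `|s| <= 2 * `|x| * `|Y| by rewrite -{1}(dotp_pt s t ad) dotp_bound.
have tb : `|t| * `|d| <= (1 + 2 * `|x| * `|e|) * `|Y|.
  have -> : `|t| * `|d| = `|Y - s *: e|.
    rewrite -normrZ; congr Num.norm.
    by apply: injective_projections; rewrite /= /GRing.scale/=; ring.
  rewrite mulrDl mul1r (le_trans (ler_normB _ _))// lerD2l normrZ.
  by rewrite mulrAC ler_wpM2r.
rewrite norm2_le/=; apply/andP; split.
  by rewrite (le_trans sb)// ler_wpM2r// lerDl divr_ge0// addr_ge0// !mulr_ge0.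
rewrite -ler_pdivlMr// in tb; rewrite (le_trans tb)// mulrAC ler_wpM2r//.
by rewrite lerDr mulr_ge0.
Qed.

Lemma bcs2_pt u x e d : bcs2 u -> adapted x e d -> d != 0 ->
  bcs2 (fun p => u (pt e d p.1 p.2)).
Proof.
move=> [mu_ [B [T [B0 T0 uB]]]] ad d0; split.
  apply: (measurableT_comp mu_); apply: measurable_fun_pair.
    by apply: measurable_funD; apply: measurable_funM.
  by apply: measurable_funD; apply: measurable_funM.
pose C := 2 * `|x| + (1 + 2 * `|x| * `|e|) / `|d|.
have C0 : 0 <= C.
  by rewrite addr_ge0// ?mulr_ge0// divr_ge0// addr_ge0// !mulr_ge0.
exists B, (C * T); split; rewrite ?mulr_ge0// => -[s t].
rewrite (le_trans (uB _))// ler_wpM2l// ler_nat.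
case: (lerP `|pt e d s t| T) => // pT.
suff -> : `|(s, t)| <= C * T by [].
by rewrite (le_trans (pt_coord_bound s t ad d0))// ler_wpM2l.
Qed.

Lemma radon_bcs u x e d : bcs2 u -> adapted x e d -> d != 0 -> bcs (radon u e d).
Proof.
move=> bu ad d0; exact: (bcs2_marginal (bcs2_pt bu ad d0)).
Qed.

Lemma bcs_slice u x e d s : bcs2 u -> adapted x e d -> d != 0 ->
  bcs (fun t => u (pt e d s t)).
Proof. by move=> bu ad d0; exact: (bcs2_slice s (bcs2_pt bu ad d0)). Qed.

Lemma bcs2M u (phi : R * R -> R) : bcs2 u -> measurable_fun setT (phi : R2 -> R) ->
  (forall y, `|phi y| <= 1) -> bcs2 (fun y => u y * phi y).
Proof.
move=> [mu_ [B [T [B0 T0 uB]]]] mp p1; split; first exact: measurable_funM.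
exists B, T; split => // y; rewrite normrM (le_trans _ (uB y))//.
by rewrite ler_piMr.
Qed.

(** A shear instead of a rotation: after Fubini, the inner integral over the first coordinate is
    translated by c t, so that y.1 + c y.2 becomes the variable s; the order of integration is then
    exchanged. *)
Lemma radon_formula1 u (c : R) (phi : R -> R) : bcs2 u ->
  measurable_fun setT phi -> (forall s, `|phi s| <= 1) ->
  \int[mu2]_(y in setT) (u y * phi (y.1 + c * y.2)) =
  \int[mu]_(s in setT) (radon u (1, 0) (- c, 1) s * phi s).
Proof.
move=> bu mp p1; set e : R * R := (1, 0); set d : R * R := (- c, 1).
have ad : adapted (1, c) e d.
  by split; rewrite /dotp /e /d /=; ring.
have d0 : d != 0 by apply/eqP => -[_ /eqP]; rewrite oner_eq0.
have bU := bcs2_pt bu ad d0.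
pose V p := u (pt e d p.1 p.2) * phi p.1.
have bV : bcs2 V.
  by apply: (@bcs2M _ (fun p => phi p.1)) => //; apply: measurableT_comp.
rewrite fubini21; last first.
  apply: (@bcs2M _ (fun y => phi (y.1 + c * y.2))) => //.
  apply: (measurableT_comp mp); apply: measurable_funD => //.
  by apply: measurable_funM.
transitivity (\int[mu2]_(p in setT) V p).
  rewrite [RHS]fubini21//; apply: eq_Rintegral => t _.
  rewrite -(@int_translate _ (fun s => V (s, t)) (c * t)); last first.
    exact: (bcs2_slice _ (bcs2_swap bV)).
  apply: eq_Rintegral => s _; rewrite /V /pt /e /d /=.
  congr (u _ * _); congr pair; ring.
rewrite fubini12//; apply: eq_Rintegral => s _.
rewrite mulrC -intZ; last exact: bcs_slice ad d0.
by apply: eq_Rintegral => t _; rewrite mulrC.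
Qed.

(** The previous formula with the two coordinates exchanged; it serves the directions whose first
    coordinate is zero. *)
Lemma radon_formula2 u (c : R) (phi : R -> R) : bcs2 u ->
  measurable_fun setT phi -> (forall s, `|phi s| <= 1) ->
  \int[mu2]_(y in setT) (u y * phi (c * y.1 + y.2)) =
  \int[mu]_(s in setT) (radon u (0, 1) (1, - c) s * phi s).
Proof.
move=> bu mp p1.
transitivity (\int[mu2]_(y in setT) (u (y.2, y.1) * phi (y.1 + c * y.2))).
  rewrite fubini12; last first.
    apply: (@bcs2M _ (fun y => phi (c * y.1 + y.2))) => //.
    apply: (measurableT_comp mp); apply: measurable_funD => //.
    by apply: measurable_funM.
  rewrite fubini21; last first.
    apply: (@bcs2M _ (fun y => phi (y.1 + c * y.2))) => //; first exact: bcs2_swap.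
    apply: (measurableT_comp mp); apply: measurable_funD => //.
    by apply: measurable_funM.
  by apply: eq_Rintegral => s _; apply: eq_Rintegral => t _; rewrite /= addrC.
by rewrite radon_formula1//; exact: bcs2_swap.
Qed.

End Radon.

Section RadonNull.
Context {R : realType}.
Local Notation mu := (@lebesgue_measure R).
Local Notation mu2 := (@lebesgue_measure R \x @lebesgue_measure R)%E.
Implicit Types (u : R * R -> R) (e d x y : R * R).

Definition axis e := [\/ e = (1, 0), e = (-1, 0), e = (0, 1) | e = (0, -1)].

Lemma fourier_null_scale (h : R -> R) (a k1 k2 : R) : a != 0 -> k1 < k2 -> bcs h ->
  (forall k, k1 < k < k2 ->
    \int[mu]_(s in setT) (h s * cos (k * a * s)) = 0 /\
    \int[mu]_(s in setT) (h s * sin (k * a * s)) = 0) ->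
  forall s, {for s, continuous h} -> h s = 0.
Proof.
move=> a0 k12 bh H s ch; have [ap|an|a00] := ltrgt0P a; last by rewrite a00 eqxx in a0.
  apply: (@fourier_null_eq0 _ (k1 * a) (k2 * a)) => //; first by rewrite ltr_pM2r.
  split=> // k /andP[kl kr]; have := H (k / a); rewrite divfK//; apply.
  by rewrite ltr_pdivlMr// ltr_pdivrMr// kl.
apply: (@fourier_null_eq0 _ (k2 * a) (k1 * a)) => //; first by rewrite ltr_nM2r.
split=> // k /andP[kl kr]; have := H (k / a); rewrite divfK//; apply.
by rewrite ltr_ndivlMr// ltr_ndivrMr// kl kr.
Qed.

Lemma radonN u e d s : radon u (- e) d s = radon u e d (- s).
Proof.
by apply: eq_Rintegral => t _; rewrite /pt /= !mulNr !mulrN.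
Qed.

Lemma measurable_cosM (k : R) : measurable_fun setT (fun s : R => cos (k * s)).
Proof.
apply: continuous_measurable_fun => s; apply: continuous_comp.
  exact: continuous_mulid.
exact: continuous_cos.
Qed.

Lemma measurable_sinM (k : R) : measurable_fun setT (fun s : R => sin (k * s)).
Proof.
apply: continuous_measurable_fun => s; apply: continuous_comp.
  exact: continuous_mulid.
exact: continuous_sin.
Qed.

(** Dividing x by a nonzero coordinate turns [dotp x y] into one of the two linear forms of the
    radon formulas, and the factor goes into the frequency. If it is negative, e is replaced by - e:
    with r > 0 the smallest tangent lines for x and for [r *: x] are the same. *)
Lemma radon_null u x (k1 k2 : R) : bcs2 u -> x != 0 -> k1 < k2 ->
  (forall k, k1 < k < k2 ->
    \int[mu2]_(y in setT) (u y * cos (k * dotp x y)) = 0 /\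
    \int[mu2]_(y in setT) (u y * sin (k * dotp x y)) = 0) ->
  exists e d r, [/\ 0 < r, axis e, adapted (r *: x) e d, d != 0 &
    forall s, {for s, continuous (radon u e d)} -> radon u e d s = 0].
Proof.
move=> bu x0 k12 H.
have [e [d [r [[r0 ae aN ad d0] Z]]]] : exists e d (r : R),
    [/\ r != 0, axis e, axis (- e), adapted (r *: x) e d & d != 0] /\
    forall s, {for s, continuous (radon u e d)} -> radon u e d s = 0; last first.
  have [rp|rn|r00] := ltrgt0P r; last by rewrite r00 eqxx in r0.
    by exists e, d, r.
  exists (- e), d, (- r); split => //; first by rewrite oppr_gt0.
    move: ad; rewrite /adapted /dotp /= /GRing.scale/= => -[<- E]; split; first by ring.
    by rewrite !mulNr -opprD E oppr0.
  move=> s cs; rewrite radonN; apply: Z.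
  rewrite (_ : radon u e d = radon u (- e) d \o -%R); last first.
    by apply/funext => z /=; rewrite radonN opprK.
  apply: continuous_comp; first exact: oppr_continuous.
  by rewrite opprK.
have [a0|a0] := eqVneq x.1 0; last first.
  pose c := x.2 / x.1.
  have ad : adapted (x.1^-1 *: x) (1, 0) (- c, 1).
    by split; rewrite /dotp /= /GRing.scale/= /c; field.
  have d0 : (- c, 1) != 0 :> R * R by apply/eqP => -[_ /eqP]; rewrite oner_eq0.
  exists (1, 0), (- c, 1), x.1^-1; split.
    split => //; first by rewrite invr_neq0.
      by constructor 1.
    by constructor 2; congr pair; rewrite oppr0.
  apply: (fourier_null_scale a0 k12); first exact: radon_bcs ad d0.
  move=> k kk; have [Hc Hs] := H k kk; split.
    rewrite -(radon_formula1 _ bu (measurable_cosM _)); last by move=> s; exact: norm_cos1.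
    rewrite -[RHS]Hc; apply: eq_Rintegral => y _; congr (_ * cos _).
    by rewrite /dotp /c; field.
  rewrite -(radon_formula1 _ bu (measurable_sinM _)); last by move=> s; exact: norm_sin1.
  rewrite -[RHS]Hs; apply: eq_Rintegral => y _; congr (_ * sin _).
  by rewrite /dotp /c; field.
have b0 : x.2 != 0.
  by apply: contra x0 => /eqP b0; apply/eqP/injective_projections.
pose c := x.1 / x.2.
have ad : adapted (x.2^-1 *: x) (0, 1) (1, - c).
  by split; rewrite /dotp /= /GRing.scale/= /c; field.
have d0 : (1, - c) != 0 :> R * R by apply/eqP => -[/eqP]; rewrite oner_eq0.
exists (0, 1), (1, - c), x.2^-1; split.
  split => //; first by rewrite invr_neq0.
    by constructor 3.
  by constructor 4; congr pair; rewrite oppr0.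
apply: (fourier_null_scale b0 k12); first exact: radon_bcs ad d0.
move=> k kk; have [Hc Hs] := H k kk; split.
  rewrite -(radon_formula2 _ bu (measurable_cosM _)); last by move=> s; exact: norm_cos1.
  rewrite -[RHS]Hc; apply: eq_Rintegral => y _; congr (_ * cos _).
  by rewrite /dotp /c; field.
rewrite -(radon_formula2 _ bu (measurable_sinM _)); last by move=> s; exact: norm_sin1.
rewrite -[RHS]Hs; apply: eq_Rintegral => y _; congr (_ * sin _).
by rewrite /dotp /c; field.
Qed.

End RadonNull.

(** * Regularity of the source along the axes *)

Section Topology.
Context {R : realType}.
Implicit Types (u g : R * R -> R) (e d x y p q : R * R) (A : set (R * R)).

Lemma near_ball p (P : R * R -> Prop) : (\forall y \near p, P y) <->
  exists2 r : R, 0 < r & forall y, `|y - p| < r -> P y.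
Proof.
split=> [/nbhs_ballP[r /= r0 H]|[r r0 H]].
  exists r => // y yr; apply: H; rewrite -ball_normE/= distrC//.
apply/nbhs_ballP; exists r => //= y; rewrite -ball_normE/= distrC; exact: H.
Qed.

Lemma within_cont_ball A g p : {within A, continuous g} -> A p ->
  forall w : R, 0 < w -> exists2 r : R, 0 < r &
    forall y, A y -> `|y - p| < r -> `|g y - g p| < w.
Proof.
move=> cg Ap w w0; have := (subspace_continuousP A g).1 cg p Ap.
move=> /cvgrPdist_lt/(_ w w0); rewrite near_withinE => /near_ball[r r0 H].
by exists r => // y Ay yp; rewrite distrC; exact: H.
Qed.

Lemma interior_ball A p : A° p <-> exists2 r : R, 0 < r & forall y, `|y - p| < r -> A y.
Proof. exact: near_ball. Qed.

Lemma closure_ball A p : closure A p <->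
  forall r : R, 0 < r -> exists2 y, A y & `|y - p| < r.
Proof.
split=> [cA r r0|H].
  have /cA[y [Ay yr]] : nbhs p (ball p r) by exact: nbhsx_ballx.
  by exists y => //; move: yr; rewrite -ball_normE/= distrC.
move=> B /near_ball[r r0 rB]; have [y Ay yr] := H r r0.
by exists y; split => //; exact: rB.
Qed.

Lemma closed_frontier A p : closed A -> A p -> ~ frontier A p -> A° p.
Proof.
by move=> cA Ap F; apply: contrapT => nI; apply: F; split => //; exact: subset_closure.
Qed.

Lemma closed_frontier_sub A p : closed A -> frontier A p -> A p.
Proof. by move=> cA [+ _]; move/closure_id : cA => <-. Qed.

(** Along a path that avoids the frontier, the preimages of A and of its interior coincide. This set
    of parameters is both closed and open in an interval, which is connected. *)
Lemma path_side (gam : R -> R * R) (a b : R) A : continuous gam -> closed A ->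
  (forall s, a <= s <= b -> ~ frontier A (gam s)) ->
  forall s s', a <= s <= b -> a <= s' <= b -> A (gam s) -> A° (gam s').
Proof.
move=> cgam cA F s s' sab s'ab As.
have HE : `[a, b]%classic `&` gam @^-1` A° = `[a, b]%classic.
  apply: (@segment_connected R a b).
  - exists s; split; first by rewrite /= in_itv.
    by apply: closed_frontier => //; exact: F.
  - exists (gam @^-1` A°) => //; apply: open_comp => [x _|]; first exact: cgam.
    exact: open_interior.
  - exists (gam @^-1` A); first exact: ((continuous_closedP gam).1 cgam).
    apply/seteqP; split=> z [zab Az]; split => //; first by apply: (@interior_subset _ A).
    by apply: closed_frontier => //; apply: F; move: zab; rewrite /= in_itv.
have : `[a, b]%classic s' by rewrite /= in_itv.
by rewrite -HE => -[].
Qed.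

Lemma compact_unif_cont A g : compact A -> {within A, continuous g} ->
  forall w : R, 0 < w -> exists2 r : R, 0 < r &
    forall y z, A y -> A z -> `|y - z| < r -> `|g y - g z| < w.
Proof.
move=> cA cg w w0.
have w20 : 0 < w / 2 by rewrite divr_gt0.
have /(_ _)[|r /= r0 H] := (compact_near_coveringP A).1 cA R (0^'+)
    (fun r y => A y -> forall z, A z -> `|z - y| < r -> `|g z - g y| < w) _.
  move=> x Ax; have [r r0 H] := within_cont_ball cg Ax w20.
  have r20 : 0 < r / 2 by rewrite divr_gt0.
  exists (ball x (r / 2), [set r' | r' < r / 2]) => /=.
    by split; [exact: nbhsx_ballx|exact: nbhs_right_lt].
  move=> [y r'] /= []; rewrite -ball_normE/= distrC => yx r'r Ay z Az zy.
  rewrite -(subrK (g x) (g z)) -addrA (le_lt_trans (ler_normD _ _))//.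
  rewrite (splitr w) ltrD//.
    apply: H => //; rewrite -(subrK y z) -addrA (le_lt_trans (ler_normD _ _))//.
    by rewrite (splitr r) ltrD// (lt_trans zy).
  by rewrite distrC; apply: H => //; rewrite (lt_trans yx)// gtr_pMr// invf_lt1// ltr1n.
exists (r / 2); first by rewrite divr_gt0.
move=> y z Ay Az yz; apply: (H (r / 2)) => //.
- by rewrite /ball/= sub0r normrN gtr0_norm ?divr_gt0// gtr_pMr// invf_lt1// ltr1n.
- by rewrite divr_gt0.
Qed.

Lemma compact_norm_bound A g : compact A -> {within A, continuous g} ->
  exists2 B : R, 0 <= B & forall y, A y -> `|g y| <= B.
Proof.
move=> cA cg; have := continuous_compact cg cA.
move=> /compact_bounded[M [_ H]]; exists (`|M| + 1); first by rewrite addr_ge0.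
move=> y Ay; apply: H; last by exists y.
by rewrite (le_lt_trans (ler_norm M))// ltrDl.
Qed.

Lemma is_derive_along u y e (s g : R) : is_derive (y + s *: e) e u g ->
  is_derive s (1 : R) (fun s => u (y + s *: e)) g.
Proof.
move=> [du eu].
have E : (fun h : R => h^-1 *: (((fun s => u (y + s *: e)) \o shift s) (h *: (1:R)) -
      u (y + s *: e))) =
    (fun h : R => h^-1 *: ((u \o shift (y + s *: e)) (h *: e) - u (y + s *: e))).
  apply/funext => h /=; congr (_ *: (u _ - _)).
  have -> : h *: (1 : R) = h by exact: mulr1.
  by rewrite scalerDl addrCA.
by split; [rewrite /derivable E|rewrite /derive E].
Qed.

End Topology.

(** * Properties of all sufficiently small positive reals *)

Section Small.
Context {R : realType}.

(** Eventually at 0 from the right, with an explicit radius; [near_right_small] below states the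
    equivalence with the filter. *)
Definition small (P : R -> Prop) := exists2 r : R, 0 < r & forall t, 0 < t < r -> P t.

Lemma smallW (P : R -> Prop) : (forall t, 0 < t -> P t) -> small P.
Proof. by move=> H; exists 1 => // t /andP[t0 _]; exact: H. Qed.

Lemma small_lt (r : R) : 0 < r -> small (fun t => t < r).
Proof. by move=> r0; exists r => // t /andP[]. Qed.

Lemma smallI (P Q : R -> Prop) : small P -> small Q -> small (fun t => P t /\ Q t).
Proof.
move=> [r r0 rP] [s s0 sQ]; exists (Num.min r s); first by rewrite lt_min r0.
move=> t /andP[t0]; rewrite lt_min => /andP[tr ts].
by split; [apply: rP|apply: sQ]; rewrite t0.
Qed.

Lemma small_imp (P Q : R -> Prop) : (forall t, 0 < t -> P t -> Q t) -> small P -> small Q.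
Proof.
move=> H [r r0 rP]; exists r => // t /andP[t0 tr]; apply: H => //.
by apply: rP; rewrite t0.
Qed.

Lemma small_all (T : eqType) (l : seq T) (P : T -> R -> Prop) :
  (forall i, i \in l -> small (P i)) -> small (fun t => forall i, i \in l -> P i t).
Proof.
elim: l => [|i l IH] H; first exact: smallW.
have Hi : small (P i) by apply: H; rewrite inE eqxx.
have Hl : small (fun t => forall j, j \in l -> P j t).
  by apply: IH => j jl; apply: H; rewrite inE jl orbT.
apply: small_imp (smallI Hi Hl) => t _ [Pi Pl] j.
by rewrite inE => /orP[/eqP ->//|]; exact: Pl.
Qed.

Lemma small_fin (I : finType) (P : I -> R -> Prop) :
  (forall i, small (P i)) -> small (fun t => forall i, P i t).
Proof.
move=> H; have := @small_all I (enum I) P (fun i _ => H i).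
by apply: small_imp => t _ HP i; apply: HP; rewrite mem_enum.
Qed.

Lemma small_ex (P : R -> Prop) : small P -> exists2 t, 0 < t & P t.
Proof.
move=> [r r0 H]; exists (r / 2); first by rewrite divr_gt0.
by apply: H; rewrite divr_gt0//= gtr_pMr// invf_lt1// ltr1n.
Qed.

Lemma small_scale (c : R) (P : R -> Prop) : 0 < c -> small P -> small (fun t => P (c * t)).
Proof.
move=> c0 [r r0 H]; exists (r / c); first by rewrite divr_gt0.
move=> t /andP[t0 tr]; apply: H; rewrite mulr_gt0//=.
by rewrite mulrC -ltr_pdivlMr.
Qed.

Lemma fin_bound (I : finType) (P : I -> R -> Prop) :
  (forall i a b, a <= b -> P i a -> P i b) -> (forall i, exists a, P i a) ->
  exists2 a, 0 <= a & forall i, P i a.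
Proof.
move=> mon H; have [a Ha] := choice H.
exists (\sum_i `|a i|); first by rewrite sumr_ge0.
move=> i; apply: (mon i (a i)) => //; rewrite (bigD1 i)//=.
by rewrite (le_trans (ler_norm _))// lerDl sumr_ge0.
Qed.

End Small.

Lemma is_derive_continuous (R : realType) (F : R -> R) (s df : R) :
  is_derive s (1 : R) F df -> {for s, continuous F}.
Proof.
by move=> D; apply/differentiable_continuous/derivable1_diffP; exact: ex_derive.
Qed.

(** * Increments of one real part of the source along an axis *)

Section Source.
Context {R : realType} (n : nat) (Om : 'I_n -> set (R * R)) (u : R * R -> R).
Local Notation R2 := (measurableTypeR R * measurableTypeR R)%type.
Implicit Types (g : R * R -> R) (e d x y p q : R * R) (A : set (R * R)).

Record rsource := RSource {
  rs_compact : forall m, compact (Om m) ;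
  rs_disj : forall m m' y, Om m y -> Om m' y -> m = m' ;
  rs_out : forall y, (forall m, ~ Om m y) -> u y = 0 ;
  rs_C1 : forall m, C1_on_real (Om m) u }.

Definition region : set (R * R) := [set y | exists m, Om m y].

(** A segment without hits lies either in the interior of one piece, where mean value arguments
    apply, or outside all the pieces, where u is zero. *)
Definition hits p e (a b : R) :=
  exists m s, a <= s <= b /\ frontier (Om m) (p + s *: e).

Hypothesis rs : rsource.

Lemma rs_closed m : closed (Om m).
Proof. by apply: compact_closed; [exact: norm_hausdorff|exact: rs_compact]. Qed.

Lemma rs_near p : small (fun r => forall m y, `|y - p| < r -> Om m y -> Om m p).
Proof.
apply: small_fin => m; have [pm|pm] := pselect (Om m p); first exact: smallW.
have /near_ball[r r0 H] : \forall y \near p, (~` Om m) y.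
  by apply: open_nbhs_nbhs; split => //; exact/closed_openC/rs_closed.
exists r => // t /andP[_ tr] y yt my; case: (H y _ my).
exact: lt_trans yt tr.
Qed.

(** The shape of u near a frontier point: close to [u p] on the region and zero off it. The pieces
    are closed and disjoint, so that only the piece containing p matters near p. *)
Lemma rs_cont p (w : R) : 0 < w ->
  small (fun r => forall y, `|y - p| < r -> `|u y - u p * ind `[< region y >]| < w).
Proof.
move=> w0; have [[m pm]|pm] := pselect (region p); last first.
  apply: small_imp (rs_near p) => r _ H y yr.
  have yO : ~ region y by move=> [m my]; apply: pm; exists m; exact: H my.
  rewrite (rs_out rs) ?asboolF ?mulr0 ?subr0 ?normr0// => m my.
  by apply: yO; exists m.
have [c _] := rs_C1 rs m; have [r0 r0p H0] := within_cont_ball c pm w0.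
apply: small_imp (smallI (small_lt r0p) (rs_near p)) => r _ [rr0 H] y yr.
have [[m' ym]|yO] := pselect (region y).
  have pm' := H m' y yr ym; have mm := rs_disj rs pm pm'; subst m'.
  rewrite asboolT; last by exists m.
  by rewrite mulr1; apply: H0 => //; exact: lt_trans yr rr0.
rewrite (rs_out rs) ?asboolF ?mulr0 ?subr0 ?normr0// => m' my.
by apply: yO; exists m'.
Qed.

Lemma rs_bound : exists2 B : R, 0 <= B & forall y, `|u y| <= B.
Proof.
have [m a b ab H y ym|m|B B0 H] := @fin_bound R _ (fun m B => forall y, Om m y -> `|u y| <= B).
- exact: le_trans (H y ym) ab.
- have [c _] := rs_C1 rs m; have [B _ H] := compact_norm_bound (@rs_compact rs m) c.
  by exists B.
exists B => // y; have [[m ym]|yO] := pselect (region y); first exact: H ym.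
by rewrite (rs_out rs) ?normr0// => m ym; apply: yO; exists m.
Qed.

Lemma rs_supp : exists2 T : R, 0 <= T & forall m y, Om m y -> `|y| <= T.
Proof.
have [m a b ab H y ym|m|B B0 H] := @fin_bound R _ (fun m B => forall y, Om m y -> `|y| <= B).
- exact: le_trans (H y ym) ab.
- have [M [_ H]] := compact_bounded (@rs_compact rs m); exists (`|M| + 1) => y ym.
  by apply: H => //; rewrite (le_lt_trans (ler_norm M))// ltrDl.
by exists B.
Qed.

Lemma rs_bcs2 : bcs2 u.
Proof.
split; last first.
  have [B B0 uB] := rs_bound; have [T T0 uT] := rs_supp.
  exists B, T; split => // y; have [yT|yT] := boolP (`|y| <= T).
    by rewrite mulr1.
  rewrite mulr0 (rs_out rs) ?normr0// => m ym.
  by move: yT; rewrite (uT m y ym).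
have -> : u = (fun y => \sum_(m < n) (u \_ (Om m)) y).
  apply/funext => y; have [[m ym]|yO] := pselect (region y).
    rewrite (bigD1 m)//= patchE mem_set//= big1 ?addr0// => m' mm'.
    rewrite patchE memNset// => ym'; case/eqP: mm'.
    exact: (rs_disj rs ym' ym).
  rewrite big1 ?(rs_out rs)// => m.
    by move=> ym; apply: yO; exists m.
  by move=> _; rewrite patchE memNset// => ym; apply: yO; exists m.
apply: measurable_sum => m.
have mO : measurable (Om m : set R2) by exact: (closed2_measurable (@rs_closed m)).
apply/(measurable_restrictT _ mO).
have [c _] := rs_C1 rs m.
apply: (measurability _ (RGenOpens.measurableE R)) => // _ [_ [a [b ->] <-]].
have oI : open `]a, b[%classic by exact: interval_open.
have /open_subspaceP[V oV VO] := (continuousP (from_subspace (Om m) u)).1 c _ oI.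
rewrite setIC -VO; apply: measurableI => //; exact: open2_measurable.
Qed.

Lemma line_continuous p e : continuous (fun s : R => p + s *: e).
Proof.
move=> s; apply: cvgD; first exact: cvg_cst.
exact: (@scalel_continuous R (R * R)%type e s).
Qed.

Lemma no_hits_side p e (a b : R) : ~ hits p e a b ->
  forall s s' m, a <= s <= b -> a <= s' <= b -> Om m (p + s *: e) ->
  (Om m)° (p + s' *: e).
Proof.
move=> nh s s' m sab s'ab.
have F z : a <= z <= b -> ~ frontier (Om m) (p + z *: e).
  by move=> zab F; apply: nh; exists m, z.
exact: (path_side (@line_continuous p e) (@rs_closed m) F sab s'ab).
Qed.

Lemma no_hits_out p e (a b : R) : ~ hits p e a b ->
  forall s, a <= s <= b -> ~ region (p + s *: e) ->
  forall s', a <= s' <= b -> u (p + s' *: e) = 0.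
Proof.
move=> nh s sab O s' s'ab; apply: (rs_out rs) => m mO; apply: O; exists m.
apply: interior_subset; exact: (no_hits_side nh s'ab sab mO).
Qed.

Definition axis_derivative m e g : Prop := {within Om m, continuous g} /\ forall y, (Om m)° y -> is_derive y e u (g y).

Lemma rs_axis_derivative m e : e = (1, 0) \/ e = (0, 1) -> exists g, axis_derivative m e g.
Proof.
have [_ [g1 [g2 [c1 c2 D]]]] := rs_C1 rs m.
by move=> [->|->]; [exists g1|exists g2]; split => // y /D[].
Qed.

Lemma along_MVT m e g p (a b : R) : axis_derivative m e g -> a <= b -> ~ hits p e a b ->
  Om m (p + a *: e) -> exists2 c, a <= c <= b &
  u (p + b *: e) - u (p + a *: e) = g (p + c *: e) * (b - a) /\ Om m (p + c *: e).
Proof.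
move=> [cg dg] ab nh aO.
have aab : a <= a <= b by rewrite lexx.
have H s : a <= s <= b -> (Om m)° (p + s *: e).
  by move=> sab; exact: no_hits_side nh _ _ _ aab sab aO.
have D s : a <= s <= b -> is_derive s (1 : R) (fun s => u (p + s *: e)) (g (p + s *: e)).
  by move=> sab; apply: is_derive_along; apply: dg; exact: H.
have [||c cab E] := @MVT_segment R (fun s => u (p + s *: e)) (fun s => g (p + s *: e)) a b ab.
- by move=> s; rewrite in_itv/= => /andP[sa sb]; apply: D; rewrite !ltW.
- apply/subspace_continuousP => s; rewrite /= in_itv/= => /D/is_derive_continuous cs.
  apply: cvg_within_filter; exact: cs.
exists c; move: cab; rewrite in_itv//= => cab.
by split => //; apply: interior_subset; exact: H.
Qed.

Lemma rs_lip0 e : e = (1, 0) \/ e = (0, 1) -> exists2 K : R, 0 <= K &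
  forall p (a b : R), a <= b -> ~ hits p e a b ->
  `|u (p + b *: e) - u (p + a *: e)| <= K * (b - a).
Proof.
move=> he.
have [m a b ab H y ym|m|K K0 H] := @fin_bound R _ (fun m K => forall p (a b : R), a <= b ->
    ~ hits p e a b -> Om m (p + a *: e) ->
    `|u (p + b *: e) - u (p + a *: e)| <= K * (b - a)).
- by move=> z yz nh aO; rewrite (le_trans (H _ _ _ yz nh aO))// ler_wpM2r ?subr_ge0.
- have [g dg] := rs_axis_derivative m he.
  have [K K0 gK] := compact_norm_bound (@rs_compact rs m) dg.1.
  exists K => p a b ab nh aO; have [c cab [-> cO]] := along_MVT dg ab nh aO.
  by rewrite normrM (ger0_norm (x := b - a)) ?subr_ge0// ler_wpM2r ?subr_ge0// gK.
exists K => // p a b ab nh.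
have aab : a <= a <= b by rewrite lexx.
have [[m mO]|O] := pselect (region (p + a *: e)); first exact: H mO.
rewrite !(no_hits_out nh aab O) ?lexx ?ab// subrr normr0 mulr_ge0// subr_ge0//.
Qed.

(** The second difference is h times the difference of two values of the derivative, at points at
    most 2 h apart. Uniform continuity on the compact piece makes it o(h), uniformly in p; C^1
    regularity gives no better rate. *)
Lemma rs_sd0 e : e = (1, 0) \/ e = (0, 1) -> forall w : R, 0 < w ->
  small (fun h => forall p, ~ hits p e (- h) h ->
  `|u (p + h *: e) + u (p - h *: e) - 2 * u p| <= w * h).
Proof.
move=> he w w0.
have : small (fun h => forall m p, ~ hits p e (- h) h -> Om m p ->
    `|u (p + h *: e) + u (p - h *: e) - 2 * u p| <= w * h).
  apply: small_fin => m; have [g dg] := rs_axis_derivative m he.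
  have [r r0 H] := compact_unif_cont (@rs_compact rs m) dg.1 w0.
  exists (r / 4); first by rewrite divr_gt0.
  move=> h /andP[h0 hr] p nh pO.
  have hh : - h <= h by lra.
  have nh1 : ~ hits p e 0 h.
    by move=> [m' [s [/andP[s0 sh] F]]]; apply: nh; exists m', s; split => //; apply/andP; split; lra.
  have nh2 : ~ hits p e (- h) 0.
    by move=> [m' [s [/andP[s0 sh] F]]]; apply: nh; exists m', s; split => //; apply/andP; split; lra.
  have pO' : Om m (p + 0 *: e) by rewrite scale0r addr0.
  have pO2 : Om m (p + (- h) *: e).
    have z1 : - h <= 0 <= (0 : R) by apply/andP; split; lra.
    have z2 : - h <= - h <= 0 by apply/andP; split; lra.
    by apply: interior_subset; exact: (no_hits_side nh2 z1 z2 pO').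
  have [c /andP[c0 ch]] := along_MVT dg (ltW h0) nh1 pO'.
  rewrite scale0r addr0 subr0 => -[E1 cO].
  have h0' : - h <= 0 by lra.
  have [c' /andP[c'0 c'h]] := along_MVT dg h0' nh2 pO2.
  rewrite scale0r addr0 sub0r opprK scaleNr => -[E2 c'O].
  have -> : u (p + h *: e) + u (p - h *: e) - 2 * u p =
    (g (p + c *: e) - g (p + c' *: e)) * h by rewrite mulrBl -E1 -E2; ring.
  rewrite normrM (gtr0_norm h0) ler_pM2r// ltW// H//.
  rewrite opprD addrACA subrr add0r -scalerBl normrZ.
  have e1 : `|e| <= 1 by rewrite norm2_le; case: he => -> /=; rewrite !normr0 !normr1 ler01 lexx.
  have cc : `|c - c'| <= 2 * h by rewrite ler_norml; apply/andP; split; lra.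
  apply: (@le_lt_trans _ _ (2 * h * 1)); first by rewrite ler_pM.
  by lra.
apply: small_imp => h h0 H p nh; have [[m mO]|O] := pselect (region p); first exact: H mO.
have z : - h <= 0 <= h by apply/andP; split; lra.
have O' : ~ region (p + 0 *: e) by rewrite scale0r addr0.
have -> : u p = 0 by rewrite -[p]addr0 -(scale0r e) (no_hits_out nh z O').
have -> : p - h *: e = p + (- h) *: e by rewrite scaleNr.
rewrite !(no_hits_out nh z O'); [|apply/andP; split; lra..].
by rewrite mulr0 addr0 subrr normr0 mulr_ge0 ?ltW.
Qed.

Lemma axis_cases e : axis e -> exists e0 (sg : bool), (e0 = (1, 0) \/ e0 = (0, 1)) /\
  e = (-1) ^+ sg *: e0.
Proof.
case=> ->; [exists (1, 0), false|exists (1, 0), true|exists (0, 1), false|exists (0, 1), true];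
  (split; first by [left|right]); rewrite ?expr0 ?expr1 ?scale1r ?scaleN1r//;
  by congr pair; rewrite oppr0.
Qed.

Lemma rs_lip e : axis e -> exists2 K : R, 0 <= K &
  forall p (a b : R), a <= b -> ~ hits p e a b ->
  `|u (p + b *: e) - u (p + a *: e)| <= K * (b - a).
Proof.
move=> /axis_cases[e0 [[] [he ->]]]; have [K K0 H] := rs_lip0 he; exists K => // p a b ab.
  rewrite expr1 scaleN1r => nh; rewrite !scalerN -!scaleNr distrC.
  have -> : b - a = - a - - b by ring.
  apply: H; first by rewrite lerN2.
  move=> [m [s [/andP[sa sb] F]]]; apply: nh; exists m, (- s).
  by rewrite scalerN scaleNr opprK lerNr sb lerNl sa.
by rewrite expr0 scale1r => nh; exact: H.
Qed.

Lemma rs_sd e : axis e -> forall w : R, 0 < w ->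
  small (fun h => forall p, ~ hits p e (- h) h ->
  `|u (p + h *: e) + u (p - h *: e) - 2 * u p| <= w * h).
Proof.
move=> /axis_cases[e0 [sg [he ->]]] w w0; apply: small_imp (rs_sd0 he w0) => h h0 H p.
case: sg; last by rewrite expr0 scale1r; exact: H.
rewrite expr1 scaleN1r => nh; rewrite !scalerN opprK [u _ + u _]addrC; apply: H.
move=> [m [s [/andP[sa sb] F]]]; apply: nh; exists m, (- s).
by rewrite scalerN scaleNr opprK lerN2 sb lerNl sa.
Qed.

End Source.

(** * Line integrals as functions of the offset *)

Section Slices.
Context {R : realType} (n : nat) (Om : 'I_n -> set (R * R)) (u : R * R -> R).
Context (x e d : R * R).
Hypotheses (rs : rsource Om u) (ae : axis e) (ad : adapted x e d) (d0 : d != 0).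
Local Notation mu := (@lebesgue_measure R).
Local Notation Y := (pt e d).
Local Notation h := (radon u e d).

Lemma ptD s v t : Y (s + v) t = Y s t + v *: e.
Proof. by apply: injective_projections; rewrite /= /GRing.scale/=; ring. Qed.

Lemma pt_sub s s' t t' : Y s t - Y s' t' = (s - s') *: e + (t - t') *: d.
Proof. by apply: injective_projections; rewrite /= /GRing.scale/=; ring. Qed.

Lemma axis_norm : `|e| <= 1.
Proof.
by rewrite norm2_le; case: ae => -> /=; rewrite ?normrN ?normr0 ?normr1 ler01 lexx.
Qed.

Lemma pt_dist s s' t t' : `|Y s t - Y s' t'| <= `|s - s'| + `|t - t'| * `|d|.
Proof.
rewrite pt_sub (le_trans (ler_normD _ _))// !normrZ lerD//.
by rewrite ler_piMr// axis_norm.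
Qed.

Lemma slice_supp : exists2 T : R, 0 <= T & forall s t, T < `|t| -> u (Y s t) = 0.
Proof.
have [T0 T00 HT] := rs_supp rs.
pose C := 2 * `|x| + (1 + 2 * `|x| * `|e|) / `|d|.
have C0 : 0 <= C.
  by rewrite addr_ge0// ?mulr_ge0// divr_ge0// addr_ge0// !mulr_ge0.
exists (C * T0); first by rewrite mulr_ge0.
move=> s t tT; apply: (rs_out rs) => m mO.
have := pt_coord_bound s t ad d0; rewrite -/C norm2_le => /andP[_ /= tC].
have := HT m _ mO; have := ler_wpM2l C0 (HT m _ mO); lra.
Qed.

Lemma slice_bcs s : bcs (fun t => u (Y s t)).
Proof. exact: bcs_slice (rs_bcs2 rs) ad d0. Qed.

Lemma step_ok_cat (l1 l2 : seq (R * (R * R))) :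
  step_ok l1 -> step_ok l2 -> step_ok (l1 ++ l2).
Proof. by move=> o1 o2; rewrite /step_ok all_cat; apply/andP. Qed.

Lemma int_approx_step (v : R -> R) l l' : bcs v -> step_ok l -> step_ok l' ->
  (forall t, `|v t - stepf l t| <= stepf l' t) ->
  `|\int[mu]_(t in setT) v t - stepi l| <= stepi l'.
Proof.
move=> bv okl okl' H.
rewrite ler_norml; apply/andP; split.
  pose l2 := [seq (- i.1, i.2) | i <- l'].
  have E2 : stepi l2 = - stepi l'.
    by rewrite /stepi big_map -sumrN; apply: eq_bigr => i _ /=; rewrite mulNr.
  have F2 t : stepf l2 t = - stepf l' t.
    by rewrite /stepf big_map -sumrN; apply: eq_bigr => i _ /=; rewrite mulNr.
  have ok2 : step_ok l2 by rewrite /step_ok all_map.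
  rewrite lerBrDr -E2 -stepi_cat; apply: int_ge_step => //; first exact: step_ok_cat.
  by move=> t; rewrite stepf_cat F2 -lerBrDr; have := H t; rewrite ler_norml => /andP[].
rewrite lerBlDr -stepi_cat; apply: int_le_step => //; first exact: step_ok_cat.
by move=> t; rewrite stepf_cat -lerBlDr; have := H t; rewrite ler_norml => /andP[].
Qed.

Definition misses s s' t := ~ hits Om (Y s t) e 0 (s' - s).

Lemma slice_lip : exists2 K : R, 0 <= K & forall s s' t, s <= s' -> misses s s' t ->
  `|u (Y s' t) - u (Y s t)| <= K * (s' - s).
Proof.
have [K K0 H] := rs_lip rs ae; exists K => // s s' t ss' ms.
have := H (Y s t) 0 (s' - s); rewrite subr_ge0 => /(_ ss' ms).
by rewrite scale0r addr0 subr0 -ptD subrKC.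
Qed.

(** Off the windows, the segment between the two lines misses the frontier and u varies at a bounded
    rate; inside them the integrand is only bounded, and each window contributes a multiple of its
    radius. *)
Lemma radon_lip : exists2 C : R, 0 <= C & forall s s' (r : R) (ts : seq R),
  s <= s' -> 0 <= r ->
  (forall t m z, s <= z <= s' -> frontier (Om m) (Y z t) ->
     exists2 t0, t0 \in ts & `|t - t0| <= r) ->
  `|h s' - h s| <= C * (s' - s) + (size ts)%:R * (C * r).
Proof.
have [K K0 HK] := slice_lip; have [T T0 HT] := slice_supp.
have [B B0 HB] := rs_bound rs.
exists (2 * T * K + 4 * B); first by rewrite addr_ge0// !mulr_ge0.
move=> s s' r ts ss' r0 H.
have sp : 0 <= s' - s by rewrite subr_ge0.
pose l := (K * (s' - s), (- T, T)) :: windows (2 * B) r ts.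
have := @int_approx_step (fun t => u (Y s' t) - u (Y s t)) [::] l.
rewrite intB; [|exact: slice_bcs..]; rewrite /stepi [X in _ - X]big_nil subr0 => HI.
have {HI} : `|h s' - h s| <= stepi l.
  apply: HI => //.
  - by apply: bcsB; exact: slice_bcs.
  - by rewrite /l /= windows_ok// andbT ge0_cp.
  move=> t; rewrite /stepf [X in _ - X]big_nil subr0 -/(stepf _ _).
  rewrite /l /stepf big_cons/= -/(stepf _ _) -ler_norml.
  have w0 : 0 <= stepf (windows (2 * B) r ts) t by apply: stepf_windows_ge0; rewrite mulr_ge0.
  have [ms|/contrapT nms] := pselect (misses s s' t).
    have [tT|tT] := lerP (`|t|) T.
      by rewrite mulr1 (le_trans (HK _ _ _ ss' ms))// lerDl.
    by rewrite !HT// subrr normr0 mulr0 add0r.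
  have [m [z [/andP[z0 zs] F]]] := nms.
  rewrite -ptD in F.
  have zz : s <= s + z <= s' by apply/andP; split; lra.
  have [t0 t0s tt0] := H t m _ zz F.
  have := stepf_windows (b := 2 * B) _ t0s tt0; rewrite mulr_ge0// => /(_ isT) bs.
  rewrite (le_trans (ler_normB _ _))//.
  have := HB (Y s' t); have := HB (Y s t).
  have : 0 <= K * (s' - s) * ind (`|t| <= T) by rewrite !mulr_ge0.
  lra.
rewrite /l /stepi big_cons/= -/(stepi _) stepi_windows => HI.
apply: (le_trans HI); have : 0 <= (size ts)%:R :> R by [].
move: (size ts)%:R => N N0.
have := mulr_ge0 (mulr_ge0 (mulr_ge0 T0 K0) N0) r0.
have := mulr_ge0 B0 sp.
nra.
Qed.

End Slices.

(** * Singularities of the Radon transform at tangent lines *)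

Section Crossing.
Context {R : realType} (n : nat) (Om : 'I_n -> set (R * R)) (u : R * R -> R).
Context (x e d : R * R).
Hypotheses (rs : rsource Om u) (ae : axis e) (ad : adapted x e d) (d0 : d != 0).
Local Notation mu := (@lebesgue_measure R).
Local Notation Y := (pt e d).
Local Notation h := (radon u e d).

Definition near_list (ts : seq R) (r t : R) := exists2 t0, t0 \in ts & `|t - t0| <= r.

(** A quantitative transversality: between the offsets s0 - eps and s0 + eps, the frontier stays
    within O(eps) of finitely many points of the line. *)
Definition cross_full (s0 : R) ts (K : R) := small (fun eps => forall m z t,
  `|z - s0| <= eps -> frontier (Om m) (Y z t) -> near_list ts (K * eps) t).

(** Only offsets strictly above s0 occur, which tolerates edges contained in the line s0 itself. *)
Definition cross_right (s0 : R) ts (K : R) := small (fun eps => forall m z t,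
  s0 < z <= s0 + eps -> frontier (Om m) (Y z t) -> near_list ts (K * eps) t).

Lemma small_linear (C w : R) : 0 < w -> small (fun eps => C * eps < w).
Proof.
move=> w0; pose C' := `|C| + 1; have C'0 : 0 < C' by rewrite ltr_wpDl.
exists (w / C'); first by rewrite divr_gt0.
move=> t /andP[t0]; rewrite ltr_pdivlMr// mulrC => H; apply: le_lt_trans H.
rewrite ler_wpM2r ?(ltW t0)// /C'.
by apply: (le_trans (ler_norm C)); rewrite lerDl.
Qed.

Lemma cross_full_continuous s0 ts K : 0 <= K -> cross_full s0 ts K ->
  {for s0, continuous h}.
Proof.
move=> K0 [r r0 H]; have [C C0 HC] := radon_lip rs ae ad d0.
have est s : `|s - s0| < r -> `|h s - h s0| <= (C + (size ts)%:R * (C * K)) * `|s - s0|.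
  move=> sr; have [->|ss0] := eqVneq s s0.
    by rewrite !subrr !normr0 mulr0.
  have sp : 0 < `|s - s0| by rewrite normr_gt0 subr_eq0.
  have Hz m z t : `|z - s0| <= `|s - s0| -> frontier (Om m) (Y z t) ->
      near_list ts (K * `|s - s0|) t.
    by move=> zs F; apply: (H `|s - s0| _ m z t zs F); rewrite sp.
  have K0' : 0 <= K * `|s - s0| by rewrite mulr_ge0.
  have [sl|sl] := lerP s0 s.
    have E : `|s - s0| = s - s0 by rewrite ger0_norm// subr_ge0.
    rewrite E in Hz K0' *; have HI := HC s0 s _ ts sl K0'.
    rewrite (le_trans (HI _))//; last by rewrite le_eqVlt; apply/orP; left; apply/eqP; ring.
    move=> t m z /andP[z1 z2]; apply: Hz.
    by rewrite ger0_norm ?subr_ge0//; lra.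
  have E : `|s - s0| = s0 - s by rewrite distrC gtr0_norm// subr_gt0.
  rewrite E in Hz K0' *; have HI := HC s s0 _ ts (ltW sl) K0'.
  rewrite distrC (le_trans (HI _))//; last by rewrite le_eqVlt; apply/orP; left; apply/eqP; ring.
  move=> t m z /andP[z1 z2]; apply: Hz.
  by rewrite ler0_norm ?subr_le0//; lra.
apply/cvgrPdist_lt => w w0; set C' := C + _ in est.
have [r' r'0 H'] := small_linear C' w0.
apply/nbhs_ballP; exists (Num.min r r'); first by rewrite /= lt_min r0.
move=> s; rewrite /ball/= lt_min => /andP[sr sr'].
rewrite distrC in sr; rewrite distrC in sr'; rewrite /= distrC.
apply: (le_lt_trans (est s sr)).
have [->|ss0] := eqVneq s s0; first by rewrite subrr normr0 mulr0.
by apply: H'; rewrite sr' normr_gt0 subr_eq0 ss0.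
Qed.

(** Both offsets stay strictly above s0, because h may jump at s0 when an edge lies in that line. *)
Lemma cross_right_lip s0 ts K : 0 <= K -> cross_right s0 ts K -> exists C : R,
  small (fun eps => forall s s', s0 < s -> s <= s' -> s' <= s0 + eps ->
    `|h s' - h s| <= C * eps).
Proof.
move=> K0 H; have [C C0 HC] := radon_lip rs ae ad d0.
exists (C + (size ts)%:R * (C * K)); apply: small_imp H => eps e0 H s s' s0s ss' s'e.
have K0' : 0 <= K * eps by rewrite mulr_ge0// ltW.
have := HC s s' _ ts ss' K0'.
have -> : (C + (size ts)%:R * (C * K)) * eps = C * eps + (size ts)%:R * (C * (K * eps)) by ring.
move=> HI; apply: (le_trans (HI _)); last by rewrite lerD2r ler_wpM2l//; lra.
by move=> t m z /andP[z1 z2]; apply: H; apply/andP; split; lra.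
Qed.

(* The part of a circle near the tangency point Y s0 ts0, in the coordinates (s, t):
   the chord at s0 + v is centred at ts0 + b v, with half-width sqrt(v(2V - v))/Q. *)
Section Tangency.
Variables (s0 ts0 b V Q K : R) (ts : seq R) (G : R * R -> R) (outer : bool).
Let hw v := Num.sqrt (v * (2 * V - v)) / Q.
Let P := Y s0 ts0.
Hypotheses (V0 : 0 < V) (Q0 : 0 < Q) (K0 : 0 <= K) (uP : u P != 0).
Hypothesis HG : forall v t, 0 <= v <= V ->
  (G (Y (s0 + v) t) <= 0) = (`|t - (ts0 + b * v)| <= hw v) /\
  (0 <= G (Y (s0 + v) t)) = (hw v <= `|t - (ts0 + b * v)|).
Hypothesis Gregion : small (fun r => forall y, `|y - P| < r ->
  (region Om y <-> (if outer then G y <= 0 else 0 <= G y))).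
Hypothesis crossG : small (fun eps => forall m z t,
  s0 < z <= s0 + eps -> frontier (Om m) (Y z t) ->
  G (Y z t) = 0 \/ near_list ts (K * eps) t).

Let hw_ge0 v : 0 <= hw v.
Proof. by rewrite divr_ge0 ?sqrtr_ge0// ltW. Qed.

Let hw_le v v' : 0 <= v -> v <= v' -> v' <= V -> hw v <= hw v'.
Proof.
move=> v0 vv v'V; rewrite ler_pM2r ?invr_gt0//; apply: ler_wsqrtr.
nra.
Qed.

(** The ratio tends to 1/2 as v tends to 0; 2/3 leaves room for the variation of the factor 2 V - v
    when v <= V / 2. *)
Let hw_quarter v : 0 < v -> v <= V / 2 -> hw (v / 4) <= (2 / 3) * hw v.
Proof.
move=> v0 vV; rewrite mulrA ler_pM2r ?invr_gt0//.
have -> : 2 / 3 = Num.sqrt ((2 / 3) ^+ 2) :> R by rewrite sqrtr_sqr ger0_norm.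
by rewrite -sqrtrM ?sqr_ge0//; apply: ler_wsqrtr; nra.
Qed.

Let hw_small (r : R) : 0 < r -> small (fun v => hw v < r).
Proof.
move=> r0; have rQ : 0 < (r * Q) ^+ 2 by rewrite exprn_gt0// mulr_gt0.
apply: small_imp (smallI (small_linear (2 * V) rQ) (small_lt V0)) => v v0 [H vV].
rewrite ltr_pdivrMr// -(gtr0_norm (mulr_gt0 r0 Q0)) -sqrtr_sqr ltr_sqrt//.
by apply: le_lt_trans H; nra.
Qed.

Let hw_big (C : R) : small (fun v => C * v < hw v).
Proof.
pose C' := `|C| * Q; have C'0 : 0 <= C' by rewrite mulr_ge0// ltW.
apply: small_imp (smallI (small_linear (C' ^+ 2) V0) (small_lt V0)) => v v0 [H vV].
rewrite ltr_pdivlMr//; apply: (@le_lt_trans _ _ (C' * v)).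
  by rewrite /C' (mulrAC C v Q) (ler_pM2r v0) (ler_pM2r Q0) ler_norm.
rewrite -(ger0_norm (mulr_ge0 C'0 (ltW v0))) -sqrtr_sqr ltr_sqrt; last by nra.
by rewrite exprMn expr2 mulrA; nra.
Qed.

Ltac clear_local := clear - rs ae ad d0 V0 Q0 K0 uP HG Gregion crossG hw_ge0 hw_le hw_quarter hw_small hw_big.

(** From s0 + eps / 4 to s0 + eps the half chord grows by at least a third of [hw eps], which is of
    order sqrt eps; near P the function u is within w of [u P] times the indicator of the region.
    The main term is thus at least (2/3) |u P| hw eps. With w = |u P| / 12 the approximation error
    is (1/3) |u P| hw eps up to O(eps), and a third is left to beat every multiple of eps. *)
Lemma tangency_singular (C : R) :
  small (fun eps => C * eps < `|h (s0 + eps) - h (s0 + eps / 4)|).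
Proof.
have [KL KL0 HKL] := slice_lip d rs ae; have [T T0 HT] := slice_supp rs ad d0.
have [B B0 HB] := rs_bound rs.
have up0 : 0 < `|u P| by rewrite normr_gt0.
pose w := `|u P| / 12; have w0 : 0 < w by rewrite divr_gt0.
(* On the slice, the indicator of the region is that of the chord when the region lies inside the
   circle, and one minus it when the region lies outside. *)
pose sg : R := if outer then 1 else -1.
have [r r0 Hr] := small_ex (smallI Gregion (rs_cont rs P w0)).
have {Hr}[HrG Hrc] := Hr.
have dp : 0 < `|d| by rewrite normr_gt0.
have rd : 0 < r / (2 * `|d|) by rewrite divr_gt0// mulr_gt0.
(* The sum of the coefficients of all error terms that are linear in eps. *)
pose C2 := 4 * w * `|b| + 2 * KL * T + (size ts)%:R * (4 * B * K).
apply: small_imp (smallI (smallI crossG (small_lt (divr_gt0 V0 (ltr0Sn R 1))))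
  (smallI (hw_big ((C + C2) / (`|u P| / 3)))
    (smallI (hw_small rd) (small_linear (1 + `|b| * `|d|) (divr_gt0 r0 (ltr0Sn R 1)))))).
move=> eps e0 [[Hc eV] [Hbig [Hsm Hlin]]].
pose R0 := hw eps + `|b| * eps.
pose v1 := eps; pose v2 := eps / 4.
have v20 : 0 < v2 by rewrite divr_gt0.
have v21 : v2 <= v1 by rewrite /v2 /v1; lra.
have v1V : v1 <= V by rewrite /v1; lra.
pose ic v t : R := ind (`|t - (ts0 + b * v)| <= hw v).
pose ends v := [:: ts0 + b * v - hw v; ts0 + b * v + hw v].
have chord_in v t : 0 < v -> v <= eps -> `|t - (ts0 + b * v)| <= hw v -> `|t - ts0| <= R0.
  move=> vp ve tv; have -> : t - ts0 = t - (ts0 + b * v) + b * v by ring.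
  rewrite (le_trans (ler_normD _ _))// lerD//.
    by rewrite (le_trans tv)// hw_le// ltW.
  by rewrite normrM ler_wpM2l// gtr0_norm.
have approx v t : 0 < v -> v <= eps -> `|t - ts0| <= R0 -> `|t - (ts0 + b * v)| != hw v ->
    `|u (Y (s0 + v) t) - u P * ((if outer then 0 else 1) + sg * ic v t)| <= w.
  move=> vp ve tR tn.
  have yP : `|Y (s0 + v) t - P| < r.
    rewrite (le_lt_trans (pt_dist d ae _ _ _ _))// addrAC subrr add0r (gtr0_norm vp).
    have : `|t - ts0| * `|d| <= R0 * `|d| by rewrite ler_pM2r.
    move: Hsm; rewrite ltr_pdivlMr ?mulr_gt0// /R0 => Hsm; lra.
  have {yP} := (HrG _ yP, Hrc _ yP) => -[reg /ltW cont].
  suff <- : ind `[< region Om (Y (s0 + v) t) >] = (if outer then 0 else 1) + sg * ic v t by [].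
  have vv : 0 <= v <= V by rewrite ltW//=; lra.
  have [G1 G2] := HG t vv.
  rewrite /sg /ic; case: (lerP `|t - (ts0 + b * v)| (hw v)) => tv.
    rewrite mulr1; move: reg; case: (outer); rewrite ?G1 ?G2 => reg.
      by rewrite asboolT ?add0r//; apply/reg.
    rewrite asboolF ?subrr// => /reg; rewrite leNgt lt_neqAle tn tv//.
  rewrite mulr0 addr0; move: reg; case: (outer); rewrite ?G1 ?G2 => reg.
    by rewrite asboolF// => /reg; rewrite leNgt tv.
  by rewrite asboolT//; apply/reg; exact: ltW.
pose l := [:: (sg * u P, (ts0 + b * v1 - hw v1, ts0 + b * v1 + hw v1));
  (- (sg * u P), (ts0 + b * v2 - hw v2, ts0 + b * v2 + hw v2))].
pose W1 := windows (2 * B) (K * eps) ts.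
(* Windows of radius 0 at the four chord ends: they add nothing to the integral, and cover the
   points where the closed chord and the closed region may disagree with the model. *)
pose W2 := windows (2 * B + 2 * `|u P|) 0 (ends v1 ++ ends v2).
pose l' := [:: (2 * w, (ts0 - R0, ts0 + R0)), (KL * eps, (- T, T)) & W1 ++ W2].
have lE t : stepf l t = sg * u P * (ic v1 t - ic v2 t).
  by rewrite /stepf /l !big_cons big_nil/= addr0 /ic !ler_distl mulNr -mulrBr.
have ic01 v t0 : 0 <= ic v t0 <= 1 by rewrite /ic ler0n lern1 leq_b1.
have sg1 : `|sg| = 1 by rewrite /sg; case: outer; rewrite ?normrN normr1.
have lb t : `|stepf l t| <= `|u P|.
  rewrite lE !normrM sg1 mul1r ler_piMr//.
  by rewrite ler_norml; move: (ic01 v1 t) (ic01 v2 t); clear_local; lra.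
have R00 : 0 <= R0 by rewrite addr_ge0// mulr_ge0// ltW.
have := @int_approx_step _ (fun t => u (Y (s0 + v1) t) - u (Y (s0 + v2) t)) l l'.
rewrite intB; [|exact: (slice_bcs rs ad d0 _)..].
have bv : bcs (fun t => u (Y (s0 + v1) t) - u (Y (s0 + v2) t)).
  by apply: bcsB; exact: (slice_bcs rs ad d0 _).
have okl : step_ok l.
  by rewrite /l /= andbT; apply/andP; split; rewrite lerD2l ge0_cp.
have okl' : step_ok l'.
  apply: (@step_ok_cat _ [:: _; _]); first by rewrite /= lerD2l !ge0_cp.
  apply: step_ok_cat; last exact: windows_ok.
  by apply: windows_ok; rewrite mulr_ge0// ltW.
move=> /(_ bv okl okl') HI.
have {HI} : `|h (s0 + v1) - h (s0 + v2) - stepi l| <= stepi l'.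
  apply: HI => t; rewrite {2}/stepf /l' !big_cons/= -/(stepf _ _) stepf_cat.
  rewrite -ler_distl -ler_norml.
  have w1 : 0 <= stepf W1 t.
    by apply: stepf_windows_ge0; rewrite mulr_ge0.
  have w2 : 0 <= stepf W2 t.
    by apply: stepf_windows_ge0; rewrite addr_ge0// mulr_ge0.
  have p1 : 0 <= 2 * w * ind (`|t - ts0| <= R0) by rewrite !mulr_ge0// ltW.
  have p2 : 0 <= KL * eps * ind (`|t| <= T) by rewrite !mulr_ge0// ltW.
  have trivial_bound : `|u (Y (s0 + v1) t) - u (Y (s0 + v2) t) - stepf l t| <=
      2 * B + `|u P|.
    rewrite (le_trans (ler_normB _ _))// lerD//.
    rewrite (le_trans (ler_normB _ _))//.
    by move: (HB (Y (s0 + v1) t)) (HB (Y (s0 + v2) t)); clear_local; lra.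
  have end_case v : (v = v1 \/ v = v2) -> `|t - (ts0 + b * v)| = hw v ->
      2 * B + 2 * `|u P| <= stepf W2 t.
    move=> vv tv; have te : t \in ends v.
      rewrite /ends !inE; move: tv; have [tp|tn] := lerP 0 (t - (ts0 + b * v)).
        by rewrite (ger0_norm tp) => E; apply/orP; right; apply/eqP; move: E; clear_local; lra.
      by rewrite (ltr0_norm tn) => E; apply/orP; left; apply/eqP; move: E; clear_local; lra.
    apply: (@stepf_windows _ _ _ _ _ t); rewrite ?subrr ?normr0//.
      by rewrite addr_ge0// mulr_ge0.
    by rewrite mem_cat; case: vv => <-; rewrite te ?orbT.
  have [e1|n1] := eqVneq `|t - (ts0 + b * v1)| (hw v1).
    move: (end_case v1 (or_introl erefl) e1) trivial_bound w1 p1 p2 up0; clear_local; lra.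
  have [e2|n2] := eqVneq `|t - (ts0 + b * v2)| (hw v2).
    move: (end_case v2 (or_intror erefl) e2) trivial_bound w1 p1 p2 up0; clear_local; lra.
  have [tR|tR] := boolP (`|t - ts0| <= R0).
    have A1 := approx v1 t e0 (lexx _) tR n1.
    have A2 := approx v2 t v20 v21 tR n2.
    rewrite mulr1 lE.
    have -> : u (Y (s0 + v1) t) - u (Y (s0 + v2) t) - sg * u P * (ic v1 t - ic v2 t) =
      (u (Y (s0 + v1) t) - u P * ((if outer then 0 else 1) + sg * ic v1 t)) -
      (u (Y (s0 + v2) t) - u P * ((if outer then 0 else 1) + sg * ic v2 t)) by ring.
    apply: le_trans (ler_normB _ _) _; move: A1 A2 p2 w1 w2; clear_local; lra.
  rewrite mulr0 add0r lE.
  have ic0 v : 0 < v -> v <= eps -> ic v t = 0.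
    move=> vp ve; rewrite /ic; case: lerP => // tv.
    by case/negP: tR; exact: chord_in vp ve tv.
  rewrite !ic0// subrr mulr0 subr0.
  have ss : s0 + v2 <= s0 + v1 by rewrite lerD2l.
  have [ms|/contrapT nms] := pselect (misses Om e d (s0 + v2) (s0 + v1) t).
    have [tT|tT] := lerP (`|t|) T.
      have KLe : KL * (s0 + v1 - (s0 + v2)) <= KL * eps.
        by rewrite ler_wpM2l// /v1; move: v20; clear_local; lra.
      by rewrite mulr1; move: (HKL _ _ _ ss ms) KLe w1 w2; clear_local; lra.
    by rewrite !HT// subrr normr0 mulr0 add0r addr_ge0.
  (* The segment between the two lines meets the frontier. A point of the circle would put t inside
     a chord, hence within R0 of ts0, which is excluded here; so t lies in a window of W1. *)
  have [m [z [/andP[z0 zs] F]]] := nms.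
  rewrite -ptD in F.
  have zz : s0 < s0 + v2 + z <= s0 + eps by move: z0 zs v20; clear_local; rewrite /v1; lra.
  case: (Hc m _ t zz F) => [G0|[t0 t0s tt0]].
    have vv : 0 <= v2 + z <= V by move: z0 zs v20 v1V; clear_local; lra.
    have [G1 _] := HG t vv; rewrite addrA G0 lexx in G1.
    case/negP: tR; apply: (@chord_in (v2 + z)); rewrite -?G1//; first by move: v20 z0; clear_local; lra.
    by move: zs; clear_local; rewrite /v1; lra.
  have := stepf_windows (b := 2 * B) _ t0s tt0; rewrite mulr_ge0// => /(_ isT) bs.
  have : `|u (Y (s0 + v1) t) - u (Y (s0 + v2) t)| <= 2 * B.
    rewrite (le_trans (ler_normB _ _))//.
    by move: (HB (Y (s0 + v1) t)) (HB (Y (s0 + v2) t)); clear_local; lra.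
  by move: bs p2 w2; clear_local; lra.
have El : stepi l = sg * u P * (2 * (hw v1 - hw v2)).
  by rewrite /stepi /l !big_cons big_nil/=; ring.
have El' : stepi l' = 4 * w * R0 + 2 * KL * T * eps + (size ts)%:R * (4 * B * K) * eps.
  rewrite (stepi_cat [:: _; _]) stepi_cat !stepi_windows !mulr0 addr0.
  by rewrite {1}/stepi !big_cons big_nil/=; ring.
move=> HI; rewrite El El' in HI.
have q := hw_quarter e0 (ltW eV); rewrite -/v2 in q.
have S : `|sg * u P * (2 * (hw v1 - hw v2))| <= `|h (s0 + v1) - h (s0 + v2)| +
    (4 * w * R0 + 2 * KL * T * eps + (size ts)%:R * (4 * B * K) * eps).
  set L := sg * _ * _ in HI *; set H := h _ - h _ in HI *.
  by move: HI (lerB_dist L H) (distrC L H); clear_local; lra.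
have hh : 0 <= hw v1 - hw v2 by rewrite subr_ge0 hw_le// ltW.
rewrite !normrM sg1 mul1r (ger0_norm hh) (ger0_norm (x := 2)) // in S.
move: Hbig; rewrite -/v1 mulrAC ltr_pdivrMr ?divr_gt0// => Hbig.
have hv1 := hw_ge0 v1.
have q2 : `|u P| * (2 * (hw v1 / 3)) <= `|u P| * (2 * (hw v1 - hw v2)).
  by rewrite ler_pM2l//; move: q; clear_local; rewrite /v1; lra.
rewrite -/v1 -/v2; move: S Hbig q2 hv1; rewrite /R0 /C2 /w -/v1; clear_local; lra.
Qed.

End Tangency.
End Crossing.

(** * Second differences of the Radon transform at corners *)

Section SecondDifference.
Context {R : realType} (n : nat) (Om : 'I_n -> set (R * R)) (u : R * R -> R).
Context (x e d : R * R).
Hypotheses (rs : rsource Om u) (ae : axis e) (ad : adapted x e d) (d0 : d != 0).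
Local Notation mu := (@lebesgue_measure R).
Local Notation Y := (pt e d).
Local Notation h := (radon u e d).
Variable s0 : R.

Definition sdiff (eps t : R) : R :=
  u (Y (s0 + eps) t) + u (Y (s0 - eps) t) - 2 * u (Y s0 t).

(** Used with r proportional to eps, at the points where the line s0 meets the frontier: this
    localises the second difference and lets the contributions of distinct points be added. *)
Definition window (a r t : R) : R := ind (`|t - a| <= r).

Definition local_kink (K tj kappa : R) := forall w, 0 < w -> small (fun eps =>
  `|\int[mu]_(t in setT) (sdiff eps t * window tj (K * eps) t) - kappa * eps| <= w * eps).

Lemma sdiff_bcs eps : bcs (sdiff eps).
Proof.
apply: bcsB; last by apply: bcsZ; exact: (slice_bcs rs ad d0).
by apply: bcsD; exact: (slice_bcs rs ad d0).
Qed.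

Lemma int_sdiff eps : \int[mu]_(t in setT) sdiff eps t = h (s0 + eps) + h (s0 - eps) - 2 * h s0.
Proof.
rewrite /sdiff intB ?intD ?intZ//; first [exact: (slice_bcs rs ad d0)|
  by apply: bcsD; exact: (slice_bcs rs ad d0)|
  by apply: bcsZ; exact: (slice_bcs rs ad d0)].
Qed.

Lemma bcs_window v a r : bcs v -> bcs (fun t => v t * window a r t).
Proof.
move=> bv; apply: (@bcsM _ v (window a r)) => //; last first.
  by move=> T; exists 1 => t _; rewrite /window ger0_norm// lern1 leq_b1.
rewrite (_ : window a r = \1_`[a - r, a + r]%classic); first exact: measurable_indic.
by apply/funext => t; rewrite /window indic_itv ler_distl.
Qed.

Lemma int_windows v r (ts : seq R) : bcs v ->
  bcs (fun t => \sum_(a <- ts) v t * window a r t) /\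
  \int[mu]_(t in setT) (\sum_(a <- ts) v t * window a r t) =
  \sum_(a <- ts) \int[mu]_(t in setT) (v t * window a r t).
Proof.
move=> bv; elim: ts => [|a ts [IH1 IH2]].
  have E : (fun t => \sum_(a <- [::]) v t * window a r t) = (fun t => 0 * v t).
    by apply/funext => t; rewrite big_nil mul0r.
  by rewrite E; split; [exact: bcsZ|rewrite intZ// mul0r big_nil].
have E : (fun t => \sum_(b <- a :: ts) v t * window b r t) =
    (fun t => v t * window a r t + \sum_(b <- ts) v t * window b r t).
  by apply/funext => t; rewrite big_cons.
rewrite E; split; first by apply: bcsD => //; exact: bcs_window.
by rewrite intD ?IH2 ?big_cons//; exact: bcs_window.
Qed.

Lemma sum_windows_notin (c r t : R) (ts : seq R) :
  (forall a, a \in ts -> r < `|t - a|) -> \sum_(a <- ts) c * window a r t = 0.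
Proof.
move=> H; rewrite big_seq big1// => a /H; rewrite /window ltNge => /negbTE ->.
by rewrite mulr0.
Qed.

(** For small eps the windows of distinct points are disjoint, so each localised integral is counted
    once. Outside them the frontier is not met within eps, and the integrand is o(eps) uniformly on
    a fixed bounded interval. *)
Lemma kink_sum ts K (kappa : R -> R) : uniq ts -> 0 <= K -> cross_full Om e d s0 ts K ->
  (forall tj, tj \in ts -> local_kink K tj (kappa tj)) ->
  forall w, 0 < w -> small (fun eps =>
    `|h (s0 + eps) + h (s0 - eps) - 2 * h s0 - (\sum_(tj <- ts) kappa tj) * eps| <= w * eps).
Proof.
move=> ut K0 cr lk w w0; have [T T0 HT] := slice_supp rs ad d0.
pose N : R := (size ts)%:R.
have N0 : 0 <= N by [].
(* The tolerance is shared between the rest, integrated over an interval of length 2 T, and the N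
   windows. *)
pose w1 := w / (2 * T + 1 + N).
have D0 : 0 < 2 * T + 1 + N by rewrite ltr_pwDl// ltr_pwDr// mulr_ge0.
have w10 : 0 < w1 by rewrite divr_gt0.
have sep : small (fun eps => forall a, a \in ts -> forall b, b \in ts -> a != b ->
    (2 * K) * eps < `|a - b|).
  apply: small_all => a _; apply: small_all => b _.
  have [->|ab] := eqVneq a b; first exact: smallW.
  have ab0 : 0 < `|a - b| by rewrite normr_gt0 subr_eq0.
  by apply: small_imp (small_linear (2 * K) ab0).
have Hk : small (fun eps => forall tj, tj \in ts ->
  `|\int[mu]_(t in setT) (sdiff eps t * window tj (K * eps) t) - kappa tj * eps| <= w1 * eps).
  by apply: small_all => tj /lk; apply.
apply: small_imp (smallI (smallI sep Hk) (smallI cr (rs_sd rs ae w10))).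
move=> eps e0 [[{}sep {}Hk] [{}cr sd]].
have [b1 E1] := int_windows (K * eps) ts (sdiff_bcs eps).
rewrite -int_sdiff.
pose rest t := sdiff eps t - \sum_(a <- ts) sdiff eps t * window a (K * eps) t.
have brest : bcs rest by apply: bcsB => //; exact: sdiff_bcs.
have Erest : \int[mu]_(t in setT) rest t = \int[mu]_(t in setT) sdiff eps t -
    \sum_(a <- ts) \int[mu]_(t in setT) (sdiff eps t * window a (K * eps) t).
  by rewrite /rest intB ?E1//; exact: sdiff_bcs.
have Hrest : `|\int[mu]_(t in setT) rest t| <= w1 * eps * (2 * T).
  apply: norm_int_le => // t; rewrite /rest.
  have we0 : 0 <= w1 * eps * ind (`|t| <= T) by rewrite mulr_ge0// mulr_ge0 ?ltW.
  have [[a at_ ta]|nt] := pselect (near_list ts (K * eps) t).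
    rewrite (bigD1_seq a)//= big_seq_cond big1 ?addr0.
      by rewrite /window ta mulr1 subrr normr0.
    move=> b /andP[bt ba]; rewrite /window; case: lerP => [tb|]; last by rewrite mulr0.
    have := sep b bt a at_ ba; rewrite ltNge => /negP; case.
    have -> : b - a = (t - a) - (t - b) by ring.
    by rewrite (le_trans (ler_normB _ _))//; lra.
  rewrite sum_windows_notin ?subr0; last first.
    by move=> a at_; rewrite ltNge; apply/negP => ta; apply: nt; exists a.
  have [tT|tT] := lerP (`|t|) T; last first.
    by rewrite /sdiff !HT// mulr0 addr0 subr0 normr0 mulr0.
  rewrite mulr1; have := sd (Y s0 t); rewrite -ptD -scaleNr -ptD; apply.
  move=> [m [z [/andP[z1 z2] F]]]; apply: nt; apply: (cr m (s0 + z)).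
    by rewrite addrAC subrr add0r ler_norml z1.
  by rewrite ptD.
have -> : \int[mu]_(t in setT) sdiff eps t - (\sum_(tj <- ts) kappa tj) * eps =
    \int[mu]_(t in setT) rest t +
    \sum_(a <- ts) (\int[mu]_(t in setT) (sdiff eps t * window a (K * eps) t) - kappa a * eps).
  by rewrite Erest big_split/= sumrN mulr_suml; ring.
have Hsum : `|\sum_(a <- ts) (\int[mu]_(t in setT) (sdiff eps t * window a (K * eps) t) -
    kappa a * eps)| <= N * (w1 * eps).
  rewrite (le_trans (ler_norm_sum _ _ _))// /N mulr_natl.
  have -> : w1 * eps *+ size ts = \sum_(a <- ts) (w1 * eps).
    by rewrite big_const_seq count_predT iter_addr_0.
  by rewrite big_seq [leRHS]big_seq; apply: ler_sum => a at_; exact: Hk.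
rewrite (le_trans (ler_normD _ _))// (le_trans (lerD Hrest Hsum))//.
have -> : w = w1 * (2 * T + 1 + N) by rewrite /w1 divfK// gt_eqF.
by have := mulr_gt0 w10 e0; nra.
Qed.

(** At first order the region at p is the cone where a1 and a2 are positive, or its complement. Thin
    cones around the lines a1 = 0 and a2 = 0 are left out, so that curved frontiers fit. Taking a1 =
    a2 describes a smooth frontier point, and cp = cm a point off the frontier. *)
Definition cone_at p a1 a2 (cp cm : bool) := forall w : R, 0 < w -> small (fun r =>
  forall y, `|y - p| < r -> w * `|y - p| < `|dotp a1 (y - p)| ->
    w * `|y - p| < `|dotp a2 (y - p)| ->
  `[< region Om y >] = if (0 < dotp a1 (y - p)) && (0 < dotp a2 (y - p)) then cp else cm).

(** In the coordinates (rho, tau) scaled by eps around the point, the line where a vanishes is tau =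
    rho * slope. *)
Definition slope a : R := - dotp a e / dotp a d.

Lemma scale_steps (l : seq (R * (R * R))) (a eps : R) : 0 < eps -> step_ok l ->
  let l' := [seq (i.1, (a + eps * i.2.1, a + eps * i.2.2)) | i <- l] in
  [/\ step_ok l', stepi l' = eps * stepi l &
    forall t, stepf l' t = stepf l ((t - a) / eps)].
Proof.
move=> e0 ok l'; split.
- rewrite /step_ok all_map; apply: sub_all ok => i /= ii.
  by rewrite lerD2l ler_pM2l.
- rewrite /stepi big_map mulr_sumr; apply: eq_bigr => i _ /=; ring.
move=> t; rewrite /stepf big_map; apply: eq_bigr => i _ /=; congr (_ * ind _).
by rewrite ler_pdivlMr// ler_pdivrMr// lerBrDl lerBlDl !(mulrC _ eps).
Qed.

Lemma stepf_bound (l : seq (R * (R * R))) t : `|stepf l t| <= \sum_(i <- l) `|i.1|.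
Proof.
rewrite (le_trans (ler_norm_sum _ _ _))//; apply: ler_sum => i _.
by rewrite normrM ler_piMr// ger0_norm// lern1 leq_b1.
Qed.

(* In the rescaled variable tau = (t - tj)/eps the slice of the region at s0 + rho eps
   is the step function L rho. *)
Ltac clear_local := clear - rs ae ad d0 s0.

Lemma scaled_kink K tj (L : R -> seq (R * (R * R))) (X : seq R) : 0 <= K ->
  (forall rho, step_ok (L rho)) ->
  (forall rho tau, K < `|tau| -> stepf (L rho) tau = 0) ->
  (forall w, 0 < w -> small (fun eps => forall rho tau, rho \in [:: 1; 0; -1] ->
     `|tau| <= K -> (forall x0, x0 \in X -> w < `|tau - x0|) ->
     ind `[< region Om (Y (s0 + rho * eps) (tj + eps * tau)) >] = stepf (L rho) tau)) ->
  local_kink K tj (u (Y s0 tj) * (stepi (L 1) + stepi (L (-1)) - 2 * stepi (L 0))).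
Proof.
move=> K0 okL supL HL w w0; set P := Y s0 tj.
have [B B0 HB] := rs_bound rs.
pose M := \sum_(i <- L 1) `|i.1| + \sum_(i <- L (-1)) `|i.1| + 2 * \sum_(i <- L 0) `|i.1|.
have M0 : 0 <= M by rewrite !addr_ge0 ?mulr_ge0 ?sumr_ge0.
pose N : R := (size X)%:R.
have N0 : 0 <= N by [].
(* A crude bound for the difference between [sdiff] and its step model, used within w1 of the jumps
   listed in X. *)
pose B' := 4 * B + `|u P| * M.
have B'0 : 0 <= B' by rewrite addr_ge0 ?mulr_ge0.
(* Away from X the error is 4 w1 on an interval of length 2 K eps; each jump costs a window of
   height B' and length 2 w1 eps. *)
pose D := 8 * K + N * (B' * 2) + 1.
have D0 : 0 < D by rewrite ltr_wpDl// addr_ge0 ?mulr_ge0.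
pose w1 := w / D; have w10 : 0 < w1 by rewrite divr_gt0.
have [r r0 Hr] := small_ex (rs_cont rs P w10).
apply: small_imp (smallI (HL _ w10) (small_linear (1 + K * `|d|) r0)).
move=> eps e0 [{}HL Hlin].
pose l0 := L 1 ++ L (-1) ++ [seq (- 2 * i.1, i.2) | i <- L 0].
pose l1 := [seq (u P * i.1, i.2) | i <- l0].
have l0f t : stepf l0 t = stepf (L 1) t + stepf (L (-1)) t - 2 * stepf (L 0) t.
  rewrite /l0 !stepf_cat addrA; congr (_ + _).
  by rewrite /stepf big_map -mulNr mulr_sumr; apply: eq_bigr => i _; rewrite mulrA.
have l0i : stepi l0 = stepi (L 1) + stepi (L (-1)) - 2 * stepi (L 0).
  rewrite /l0 !stepi_cat addrA; congr (_ + _).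
  by rewrite /stepi big_map -mulNr mulr_sumr; apply: eq_bigr => i _; rewrite mulrA.
have l1f t : stepf l1 t = u P * stepf l0 t.
  by rewrite /stepf big_map mulr_sumr; apply: eq_bigr => i _; rewrite mulrA.
have l1i : stepi l1 = u P * stepi l0.
  by rewrite /stepi big_map mulr_sumr; apply: eq_bigr => i _; rewrite mulrA.
have ok1 : step_ok l1.
  rewrite /step_ok all_map; apply: (@step_ok_cat _ (L 1)) => //.
  apply: step_ok_cat => //; rewrite /step_ok all_map; exact: (okL 0).
have [] := scale_steps tj e0 ok1; set l := map _ l1; move=> okl il fl.
pose Xs := [seq tj + eps * x0 | x0 <- X].
pose l' := [:: (4 * w1, (tj - K * eps, tj + K * eps))] ++ windows B' (w1 * eps) Xs.
have Ke : 0 <= K * eps by rewrite mulr_ge0// ltW.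
have okl' : step_ok l'.
  apply: step_ok_cat; first by rewrite /= andbT lerD2l ge0_cp.
  by apply: windows_ok; rewrite mulr_ge0// ltW.
have := @int_approx_step _ _ l l' (bcs_window tj (K * eps) (sdiff_bcs eps)) okl okl'.
have -> : stepi l' = (8 * K * w1 + N * (B' * 2) * w1) * eps.
  by rewrite /l' stepi_cat stepi_windows /stepi !big_cons big_nil/= size_map; ring.
rewrite il l1i l0i => HI.
rewrite [X in _ - X]mulrC; apply: (le_trans (HI _)); last first.
  have -> : w = w1 * D by rewrite /w1 divfK// gt_eqF.
  have := mulr_gt0 w10 e0; rewrite /D; nra.
move=> t; rewrite fl; set tau := (t - tj) / eps.
have tE : t = tj + eps * tau by rewrite /tau mulrC divfK ?gt_eqF// subrKC.
have w'0 : 0 <= stepf (windows B' (w1 * eps) Xs) t by exact: stepf_windows_ge0.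
rewrite /l' stepf_cat {2}/stepf big_cons big_nil addr0/= -ler_distl.
have tt : `|t - tj| = eps * `|tau|.
  by rewrite /tau normrM normfV (gtr0_norm e0) mulrC divfK// gt_eqF.
rewrite /window tt mulrC (mulrC K) ler_pM2l//.
case: (lerP `|tau| K) => tK; last first.
  rewrite l1f l0f !supL// mulr0 !addr0 subr0 mulr0 subr0 mul0r normr0.
  by rewrite mulr0 add0r.
rewrite mulr1 mul1r.
have sb : `|sdiff eps t| <= 4 * B.
  rewrite /sdiff (le_trans (ler_normB _ _))// normrM (ger0_norm (x := 2))//.
  move: (ler_normD (u (Y (s0 + eps) t)) (u (Y (s0 - eps) t))) (HB (Y s0 t))
    (HB (Y (s0 + eps) t)) (HB (Y (s0 - eps) t)).
  by clear_local; lra.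
have lb : `|stepf l1 tau| <= `|u P| * M.
  rewrite l1f normrM ler_wpM2l// l0f (le_trans (ler_normB _ _))// lerD//.
    by rewrite (le_trans (ler_normD _ _))// lerD// stepf_bound.
  by rewrite normrM ger0_norm// ler_wpM2l// stepf_bound.
have [[x0 xX tx]|nX] := pselect (exists2 x0, x0 \in X & `|tau - x0| <= w1).
  have tX : tj + eps * x0 \in Xs by apply/mapP; exists x0.
  have tx' : `|t - (tj + eps * x0)| <= w1 * eps.
    have -> : t - (tj + eps * x0) = eps * (tau - x0) by rewrite {1}tE; ring.
    by rewrite normrM (gtr0_norm e0) mulrC ler_pM2r.
  move: (stepf_windows B'0 tX tx'); rewrite /B'.
  by move: (ler_normB (sdiff eps t) (stepf l1 tau)) sb lb w10; clear_local; lra.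
have {}nX y0 : y0 \in X -> w1 < `|tau - y0|.
  by move=> yX; rewrite ltNge; apply/negP => H; apply: nX; exists y0.
have appr rho : rho \in [:: 1; 0; -1] -> `|u (Y (s0 + rho * eps) t) - u P * stepf (L rho) tau| <= w1.
  move=> hr; rewrite -(HL rho tau hr tK nX) -tE; apply: ltW; apply: Hr.
  rewrite (le_lt_trans (pt_dist d ae _ _ _ _))// addrAC subrr add0r tt.
  have r1 : `|rho| <= 1.
    by move: hr; rewrite !inE => /or3P[] /eqP ->; rewrite ?normrN ?normr1 ?normr0.
  apply: le_lt_trans Hlin; rewrite normrM (gtr0_norm e0) mulrDl mul1r lerD//.
    by rewrite ler_piMl// ltW.
  by move: (ler_wpM2l (ltW e0) (ler_wpM2r (normr_ge0 d) tK)); clear_local; lra.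
have A1 := appr 1 (mem_head _ _).
have A2 : `|u (Y (s0 + -1 * eps) t) - u P * stepf (L (-1)) tau| <= w1.
  by apply: appr; rewrite !inE eqxx !orbT.
have A3 : `|u (Y (s0 + 0 * eps) t) - u P * stepf (L 0) tau| <= w1.
  by apply: appr; rewrite !inE eqxx !orbT.
rewrite l1f l0f /sdiff; rewrite mul1r in A1; rewrite mulN1r in A2; rewrite mul0r addr0 in A3.
have -> : u (Y (s0 + eps) t) + u (Y (s0 - eps) t) - 2 * u (Y s0 t) -
    u P * (stepf (L 1) tau + stepf (L (-1)) tau - 2 * stepf (L 0) tau) =
  ((u (Y (s0 + eps) t) - u P * stepf (L 1) tau) + (u (Y (s0 - eps) t) - u P * stepf (L (-1)) tau)) -
  2 * (u (Y s0 t) - u P * stepf (L 0) tau) by ring.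
rewrite (le_trans (ler_normB _ _))// normrM (ger0_norm (x := 2))//.
move: (ler_normD (u (Y (s0 + eps) t) - u P * stepf (L 1) tau) (u (Y (s0 - eps) t) - u P * stepf (L (-1)) tau)) A1 A2 A3 w'0.
by clear_local; lra.
Qed.

End SecondDifference.

Section ConeKink.
Context {R : realType} (n : nat) (Om : 'I_n -> set (R * R)) (u : R * R -> R).
Context (x e d : R * R).
Hypotheses (rs : rsource Om u) (ae : axis e) (ad : adapted x e d) (d0 : d != 0).
Local Notation Y := (pt e d).

Section Cone.
Variables (s0 tj : R) (a1 a2 : R * R) (cp cm : bool).
Hypotheses (D1 : dotp a1 d != 0) (D2 : dotp a2 d != 0)
  (cone : cone_at Om (Y s0 tj) a1 a2 cp cm).
Let th1 := slope e d a1.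
Let th2 := slope e d a2.
Let b1 := 0 < dotp a1 d.
Let b2 := 0 < dotp a2 d.

(** The second difference at rho = 0, with step 1, of the length of the slice of the cone. If both
    functionals have the same sign along d, the slice is a half-line ending at the maximum or the
    minimum of the two lines, and its length has a concave kink; otherwise the slice lies between
    the lines, on one side of rho = 0 only, and the kink is convex. *)
Definition cone_kappa : R := (cp%:R - cm%:R) * (if b1 == b2 then - `|th1 - th2| else `|th1 - th2|).

(** The ends of the slice of the cone within [- K, K]. An empty slice is coded by lo = hi, thanks to
    the maximum in [hi], and has length 0. *)
Let lo (K rho : R) : R := if b1 then (if b2 then Num.max (rho * th1) (rho * th2) else rho * th1)
  else (if b2 then rho * th2 else - K).
Let hi (K rho : R) : R := if b1 then (if b2 then K else Num.max (rho * th1) (rho * th2))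
  else (if b2 then Num.max (rho * th1) (rho * th2) else Num.min (rho * th1) (rho * th2)).
(** Only rho = 1, 0 and -1 will occur; the empty list for larger rho keeps the intervals well
    ordered for every rho. *)
Let L (K rho : R) : seq (R * (R * R)) := if `|rho| <= 1 then
  [:: (cm%:R, (- K, K)); (cp%:R - cm%:R, (lo K rho, hi K rho))] else [::].

Let rho_bound (K rho th : R) : `|th| <= K -> `|rho| <= 1 -> - K <= rho * th <= K.
Proof.
move=> tK r1; rewrite -ler_norml normrM (le_trans _ tK)// ler_piMl//.
Qed.

Let lohi (K rho : R) : `|th1| <= K -> `|th2| <= K -> `|rho| <= 1 ->
  [/\ - K <= lo K rho, lo K rho <= hi K rho & hi K rho <= K].
Proof.
move=> t1 t2 r1; have /andP[? ?] := rho_bound t1 r1; have /andP[? ?] := rho_bound t2 r1.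
rewrite /lo /hi; case: b1; case: b2; rewrite ?le_max ?ge_max ?le_min ?ge_min;
  split; rewrite ?lexx ?orbT//; try (apply/andP; split => //); try lra;
  by apply/orP; left.
Qed.

Let lenE (K : R) : 0 <= K ->
  (hi K 1 - lo K 1) + (hi K (-1) - lo K (-1)) - 2 * (hi K 0 - lo K 0) =
  if b1 == b2 then - `|th1 - th2| else `|th1 - th2|.
Proof.
move=> K0; rewrite /lo /hi !mul1r !mulN1r !mul0r.
have [t12|t12] := lerP th1 th2.
  case: b1; case: b2 => /=; rewrite ?maxxx ?minxx ?(max_r t12) ?(min_l t12);
    rewrite ?[Num.max (- th1) _]max_l ?[Num.min (- th1) _]min_r ?lerN2//; ring.
have {}t12 := ltW t12.
case: b1; case: b2 => /=; rewrite ?maxxx ?minxx ?(max_l t12) ?(min_r t12);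
  rewrite ?[Num.max (- th1) _]max_r ?[Num.min (- th1) _]min_l ?lerN2//; ring.
Qed.

Lemma cone_kink : exists2 K0 : R, 0 <= K0 & forall K, K0 <= K ->
  local_kink u e d s0 K tj (u (Y s0 tj) * cone_kappa).
Proof.
exists (`|th1| + `|th2|); first by rewrite addr_ge0.
move=> K KK.
have t1 : `|th1| <= K by rewrite (le_trans _ KK)// lerDl.
have t2 : `|th2| <= K by rewrite (le_trans _ KK)// lerDr.
have K0 : 0 <= K by exact: le_trans t1.
have r1 (rho : R) : rho \in [:: 1; 0; -1] -> `|rho| <= 1.
  by rewrite !inE => /or3P[] /eqP ->; rewrite ?normrN ?normr1 ?normr0.
(* All the jumps of the model for rho = 1, 0, -1, including the window ends. Near these values the
   hypothesis on the cone says nothing. *)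
pose X := [:: th1; th2; - th1; - th2; 0; K; - K].
have ok rho : step_ok (L K rho).
  rewrite /L; case: ifP => //= r; have [? ? ?] := lohi t1 t2 r.
  by rewrite ge0_cp// andbT.
have sup rho tau : K < `|tau| -> stepf (L K rho) tau = 0.
  move=> Kt; rewrite /L; case: ifP => r; last by rewrite /stepf big_nil.
  have [l1 l2 l3] := lohi t1 t2 r.
  rewrite /stepf !big_cons big_nil/= addr0 -ler_norml leNgt Kt mulr0 add0r.
  have -> : (lo K rho <= tau <= hi K rho) = false; last by rewrite mulr0.
  apply/negP => /andP[? ?]; move: Kt; rewrite ltNge => /negP; apply.
  by rewrite ler_norml; apply/andP; split; lra.
have := @scaled_kink _ _ _ _ _ _ _ rs ae ad d0 s0 K tj (L K) X K0 ok sup.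
have -> : stepi (L K 1) + stepi (L K (-1)) - 2 * stepi (L K 0) = cone_kappa.
  rewrite /cone_kappa -(lenE K0) /L normrN normr1 normr0 lexx ler01 /stepi.
  by rewrite !big_cons !big_nil/=; ring.
apply=> w w0.
pose M := 1 + K * `|d|; have M0 : 0 < M by rewrite ltr_pwDl// mulr_ge0.
pose m := Num.min `|dotp a1 d| `|dotp a2 d|.
have m0 : 0 < m by rewrite lt_min !normr_gt0 D1.
(* If tau is farther than w from the jumps, each functional exceeds w m eps in absolute value while
   the displacement is at most M eps. The quotient is the opening for which the cone is invoked. *)
have wm : 0 < w * m / M by rewrite divr_gt0// mulr_gt0.
have [r r0 Hr] := small_ex (cone wm).
apply: small_imp (small_linear M r0) => eps e0 Mr rho tau hr tK nX.
have {}r1 := r1 _ hr.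
set y := Y (s0 + rho * eps) (tj + eps * tau).
have yP : y - Y s0 tj = eps *: (rho *: e + tau *: d).
  by apply: injective_projections; rewrite /y /= /GRing.scale/=; ring.
have yn : `|y - Y s0 tj| <= eps * M.
  rewrite yP normrZ (gtr0_norm e0) ler_pM2l// (le_trans (ler_normD _ _))// lerD//.
    by rewrite normrZ mulr_ile1// axis_norm.
  by rewrite normrZ ler_wpM2r.
have dE a : dotp a d != 0 -> dotp a (y - Y s0 tj) = eps * (dotp a d * (tau - rho * slope e d a)).
  move=> Da; rewrite yP /slope /dotp /= /GRing.scale/= -/(dotp _ _).
  by move: Da; rewrite /dotp => Da; field.
have far a : dotp a d != 0 -> m <= `|dotp a d| -> rho * slope e d a \in X ->
    w * m / M * `|y - Y s0 tj| < `|dotp a (y - Y s0 tj)|.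
  move=> Da ma aX; rewrite dE// normrM (gtr0_norm e0) normrM.
  apply: (@le_lt_trans _ _ (w * m * eps)).
    by rewrite mulrAC ler_pdivrMr// -[leRHS]mulrA ler_pM2l ?mulr_gt0.
  rewrite mulrC ltr_pM2l// mulrC (@lt_le_trans _ _ (m * `|tau - rho * slope e d a|))//.
    by rewrite ltr_pM2l//; exact: nX.
  by rewrite ler_wpM2r.
have inX th : th \in [:: th1; th2] -> rho * th \in X.
  move: hr; rewrite !inE => /or3P[] /eqP -> /orP[] /eqP ->;
  by rewrite ?mul1r ?mulN1r ?mul0r eqxx ?orbT.
have X1 : rho * slope e d a1 \in X by apply: inX; rewrite !inE eqxx.
have X2 : rho * slope e d a2 \in X by apply: inX; rewrite !inE eqxx orbT.
have yr : `|y - Y s0 tj| < r.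
  by apply: le_lt_trans Mr; rewrite mulrC.
have m1 : m <= `|dotp a1 d| by rewrite ge_min lexx.
have m2 : m <= `|dotp a2 d| by rewrite ge_min lexx orbT.
rewrite (Hr y yr (far a1 D1 m1 X1) (far a2 D2 m2 X2)) !dE// !(pmulr_rgt0 _ e0).
rewrite /L r1 /stepf !big_cons big_nil/= addr0 -ler_norml tK mulr1.
have nq z : z \in X -> tau != z.
  move=> zX; apply/eqP => E; have := nX z zX; rewrite E subrr normr0; lra.
have n1 := nq _ X1; have n2 := nq _ X2.
have nK : tau != - K by apply: nq; rewrite !inE eqxx !orbT.
have nK' : tau != K by apply: nq; rewrite !inE eqxx !orbT.
rewrite -/th1 -/th2 in n1 n2 *.
have sgn a : dotp a d != 0 -> forall z : R, tau != z ->
    (0 < dotp a d * (tau - z)) = if 0 < dotp a d then z < tau else tau < z.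
  move=> Da z tz; case: ifP => [p|/negbT]; first by rewrite pmulr_rgt0// subr_gt0.
  by rewrite -leNgt le_eqVlt (negbTE Da)/= => neg; rewrite nmulr_rgt0// subr_lt0.
rewrite !sgn// -/b1 -/b2.
have -> : (if b1 then rho * th1 < tau else tau < rho * th1) &&
    (if b2 then rho * th2 < tau else tau < rho * th2) = (lo K rho <= tau <= hi K rho).
  move: tK; rewrite ler_norml => /andP[tK1 tK2].
  rewrite /lo /hi; case: b1; case: b2.
  - by rewrite tK2 andbT ge_max !le_eqVlt ![_ == tau]eq_sym (negbTE n1) (negbTE n2).
  - rewrite le_max !le_eqVlt [_ * th1 == tau]eq_sym (negbTE n1) (negbTE n2)/=.
    by case: (ltgtP tau (rho * th1)).
  - rewrite le_max !le_eqVlt [_ * th2 == tau]eq_sym (negbTE n1) (negbTE n2)/=.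
    by case: (ltgtP tau (rho * th2)); rewrite ?andbF ?orbT ?andbT ?orbF.
  - by rewrite tK1/= le_min !le_eqVlt (negbTE n1) (negbTE n2).
by case: (_ && _); rewrite ?mulr1 ?mulr0 ?addr0//; ring.
Qed.

End Cone.

Lemma cone_kappa_eq0 a (cp cm : bool) : cone_kappa a a cp cm = 0.
Proof. by rewrite /cone_kappa eqxx subrr normr0 oppr0 mulr0. Qed.

Lemma adapted_det : e.1 * d.2 - e.2 * d.1 != 0.
Proof.
apply: contra d0 => /eqP H; have [xe xd] := ad; rewrite /dotp in xe xd.
apply/eqP/injective_projections => /=.
  have -> : d.1 = - (x.2 * (e.1 * d.2 - e.2 * d.1)) + (x.1 * e.1 + x.2 * e.2 - 1) * - d.1
     + e.1 * (x.1 * d.1 + x.2 * d.2) by ring.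
  by rewrite H xe xd subrr !mulr0 mul0r oppr0 !addr0.
have -> : d.2 = x.1 * (e.1 * d.2 - e.2 * d.1) - (x.1 * e.1 + x.2 * e.2 - 1) * d.2
   + e.2 * (x.1 * d.1 + x.2 * d.2) by ring.
by rewrite H xe xd subrr !mulr0 mul0r oppr0 !addr0.
Qed.

(** Since e and d form a basis, functionals of equal slope are proportional. *)
Lemma cone_kappa_neq0 a1 a2 (cp cm : bool) : dotp a1 d != 0 -> dotp a2 d != 0 ->
  ~ collinear a1 a2 -> cp != cm -> cone_kappa a1 a2 cp cm != 0.
Proof.
move=> D1 D2 ncol cpm; rewrite /cone_kappa mulf_neq0//.
  by move: cpm; case: (cp); case: (cm) => //= _; rewrite ?subr0 ?sub0r ?oppr_eq0 oner_eq0.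
have : slope e d a1 - slope e d a2 != 0.
  rewrite subr_eq0; apply/eqP => /eqP; rewrite /slope eqr_div// => /eqP E.
  apply: ncol; apply/eqP; rewrite -subr_eq0.
  have : (a1.1 * a2.2 - a1.2 * a2.1) * (e.1 * d.2 - e.2 * d.1) == 0.
    apply/eqP; rewrite /dotp in E.
    transitivity ((a1.1 * e.1 + a1.2 * e.2) * (a2.1 * d.1 + a2.2 * d.2) -
      (a2.1 * e.1 + a2.2 * e.2) * (a1.1 * d.1 + a1.2 * d.2)); first by ring.
    lra.
  by rewrite mulf_eq0 (negbTE adapted_det) orbF.
by case: ifP; rewrite ?oppr_eq0 normr_eq0.
Qed.

Lemma list_bound (P : R -> R -> Prop) (ts : seq R) :
  (forall t, t \in ts -> exists2 K0, 0 <= K0 & forall K, K0 <= K -> P K t) ->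
  exists2 K0, 0 <= K0 & forall K, K0 <= K -> forall t, t \in ts -> P K t.
Proof.
elim: ts => [|t ts IH] H; first by exists 0.
have [K1 K10 H1] := H t (mem_head _ _).
have [|K2 K20 H2] := IH; first by move=> t' t's; apply: H; rewrite inE t's orbT.
exists (K1 + K2); first by rewrite addr_ge0.
move=> K KK t'; rewrite inE => /orP[/eqP ->|t's].
  by apply: H1; rewrite (le_trans _ KK)// lerDl.
by apply: H2 => //; rewrite (le_trans _ KK)// lerDr.
Qed.

Lemma cross_full_mono s0 ts ts' K K' : K <= K' -> {subset ts <= ts'} ->
  cross_full Om e d s0 ts K -> cross_full Om e d s0 ts' K'.
Proof.
move=> KK sub; apply: small_imp => eps e0 H m z t zs F.
have [t0 t0s tt] := H m z t zs F; exists t0; first exact: sub.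
by rewrite (le_trans tt)// ler_wpM2r// ltW.
Qed.

(** Equal functionals give equal slopes, so the kink at such a point is zero; the condition on a
    says that the frontier, if any, is transversal to the line. *)
Definition smooth_at p := exists a cp cm, dotp a d != 0 /\ cone_at Om p a a cp cm.

Local Notation h := (radon u e d).

Lemma second_difference s0 ts K (kappa : R -> R) : 0 <= K ->
  cross_full Om e d s0 ts K ->
  (forall tj, tj \in ts -> exists2 K0 : R, 0 <= K0 & forall K, K0 <= K ->
     local_kink u e d s0 K tj (kappa tj)) ->
  forall w, 0 < w -> small (fun eps =>
    `|h (s0 + eps) + h (s0 - eps) - 2 * h s0 - (\sum_(tj <- undup ts) kappa tj) * eps| <= w * eps).
Proof.
move=> K0 cr lk; have [K1 K10 H1] := list_bound lk.
have KK0 : 0 <= K + K1 by rewrite addr_ge0.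
apply: (kink_sum rs ae ad d0 (undup_uniq ts) KK0).
  apply: cross_full_mono cr; first by rewrite lerDl.
  by move=> t; rewrite mem_undup.
by move=> t; rewrite mem_undup => tt; apply: H1 => //; rewrite lerDr.
Qed.

Lemma smooth_kink s0 tj : smooth_at (Y s0 tj) ->
  exists2 K0 : R, 0 <= K0 & forall K, K0 <= K -> local_kink u e d s0 K tj 0.
Proof.
move=> [a [cp [cm [Da ca]]]]; have := cone_kink Da Da ca.
by rewrite cone_kappa_eq0 mulr0.
Qed.

Lemma smooth_second_difference s0 ts K : 0 <= K ->
  cross_full Om e d s0 ts K -> (forall tj, tj \in ts -> smooth_at (Y s0 tj)) ->
  forall w, 0 < w -> small (fun eps =>
    `|h (s0 + eps) + h (s0 - eps) - 2 * h s0| <= w * eps).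
Proof.
move=> K0 cr sm w w0.
have := @second_difference s0 ts K (fun=> 0) K0 cr (fun tj tt => smooth_kink (sm tj tt)) w w0.
by apply: small_imp => eps _; rewrite big1// mul0r subr0.
Qed.

Lemma corner_second_difference s0 ts K tP a1 a2 cp cm : 0 <= K ->
  cross_full Om e d s0 ts K ->
  (forall tj, tj \in ts -> tj != tP -> smooth_at (Y s0 tj)) ->
  dotp a1 d != 0 -> dotp a2 d != 0 -> ~ collinear a1 a2 -> cp != cm ->
  cone_at Om (Y s0 tP) a1 a2 cp cm -> u (Y s0 tP) != 0 ->
  exists2 kappa, kappa != 0 & forall w, 0 < w -> small (fun eps =>
    `|h (s0 + eps) + h (s0 - eps) - 2 * h s0 - kappa * eps| <= w * eps).
Proof.
move=> K0 cr sm D1 D2 ncol cpm cP uP.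
pose kap := u (Y s0 tP) * cone_kappa a1 a2 cp cm.
exists kap; first by rewrite mulf_neq0// cone_kappa_neq0.
(* tP may be absent from the list of crossings; it is added, and duplicates disappear in the sum
   over [undup]. *)
have cr' : cross_full Om e d s0 (tP :: ts) K.
  by apply: cross_full_mono cr => // t tt; rewrite inE tt orbT.
pose kappa t := if t == tP then kap else 0.
have E : \sum_(tj <- undup (tP :: ts)) kappa tj = kap.
  rewrite (bigD1_seq tP) ?undup_uniq ?mem_undup ?mem_head//= {1}/kappa eqxx.
  by rewrite big1 ?addr0// => t /negbTE tP'; rewrite /kappa tP'.
move=> w w0; have := @second_difference s0 (tP :: ts) K kappa K0 cr' _ w w0.
rewrite E; apply => tj; rewrite inE /kappa; case: eqP => [-> _|/eqP tne /= tt].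
  exact: cone_kink D1 D2 cP.
by apply: smooth_kink; exact: sm.
Qed.

End ConeKink.

(** * Detecting a circle or a corner in one direction *)

Section CrossPieces.
Context {R : realType} (x e d : R * R).
Hypotheses (ad : adapted x e d) (d0 : d != 0).
Local Notation Y := (pt e d).
Implicit Types (a b y : R * R) (c : (R * R) * R).

Definition circle_eq (c : (R * R) * R) y : R := dotp (y - c.1) (y - c.1) - c.2 ^+ 2.

Definition vertical (ab : (R * R) * (R * R)) (s : R) := dotp x ab.1 = s /\ dotp x ab.2 = s.

(** The square covers both tangent lines orthogonal to x, and the factor [dotp x x] accounts for x
    not being a unit vector once rescaled. *)
Definition tangent (c : (R * R) * R) (s : R) :=
  (s - dotp x c.1) ^+ 2 = dotp x x * c.2 ^+ 2.

Lemma dotpD y a b : dotp y (a + b) = dotp y a + dotp y b.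
Proof. by rewrite /dotp /=; ring. Qed.

Lemma dotpZ y k a : dotp y (k *: a) = k * dotp y a.
Proof. by rewrite /dotp /= /GRing.scale/=; ring. Qed.

Lemma dotpB y a b : dotp y (a - b) = dotp y a - dotp y b.
Proof. by rewrite /dotp /=; ring. Qed.

Lemma dotpC a b : dotp a b = dotp b a.
Proof. by rewrite /dotp; ring. Qed.

Lemma dotpp_gt0 a : a != 0 -> 0 < dotp a a.
Proof.
move=> a0; rewrite lt_neqAle; apply/andP; split; last by rewrite addr_ge0// -expr2 sqr_ge0.
apply: contra a0; rewrite eq_sym /dotp -!expr2 paddr_eq0 ?sqr_ge0// !sqrf_eq0.
by move=> /andP[/eqP a1 /eqP a2]; apply/eqP/injective_projections.
Qed.

Lemma segmentE a b y : segment a b y -> exists2 l : R, 0 <= l <= 1 & y = a + l *: (b - a).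
Proof.
move=> [l /=]; rewrite in_itv/= => l01 <-; exists l => //.
by rewrite scalerBr scalerBl scale1r addrA addrAC.
Qed.

(** [cross_full] and [cross_right] for a single curve Q, abstracted over the range P of offsets, so
    that the frontier can be treated piece by piece. *)
Definition crosses (P : R -> R -> Prop) (Q : R * R -> Prop) := exists ts K, 0 <= K /\
  small (fun eps => forall z t, P eps z -> Q (Y z t) -> near_list ts (K * eps) t).

Lemma crosses_sub (P P' : R -> R -> Prop) Q : (forall eps z, P' eps z -> P eps z) ->
  crosses P Q -> crosses P' Q.
Proof.
move=> PP [ts [K [K0 H]]]; exists ts, K; split => //.
by apply: small_imp H => eps _ H z t /PP; exact: H.
Qed.

Lemma crosses_empty (P : R -> R -> Prop) Q :
  small (fun eps => forall z t, P eps z -> ~ Q (Y z t)) -> crosses P Q.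
Proof.
move=> H; exists [::], 0; split => //; apply: small_imp H => eps _ H z t Pz Qz.
by case: (H z t Pz).
Qed.

Lemma crosses_all (T : eqType) (l : seq T) (P : R -> R -> Prop) (Q : T -> R * R -> Prop) :
  (forall i, i \in l -> crosses P (Q i)) ->
  crosses P (fun y => exists2 i, i \in l & Q i y).
Proof.
elim: l => [|i l IH] H.
  by apply: crosses_empty; apply: smallW => eps _ z t _ [].
have [ts [K [K0 Hi]]] := H i (mem_head _ _).
have [|ts' [K' [K'0 Hl]]] := IH; first by move=> j jl; apply: H; rewrite inE jl orbT.
exists (ts ++ ts'), (K + K'); split; first exact: addr_ge0.
apply: small_imp (smallI Hi Hl) => eps e0 [{}Hi {}Hl] z t Pz [j].
rewrite inE => /orP[/eqP ->|jl] Qj.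
  have [t0 t0s tt] := Hi z t Pz Qj; exists t0; first by rewrite mem_cat t0s.
  by rewrite (le_trans tt)// ler_wpM2r ?(ltW e0)// lerDl.
have [|t0 t0s tt] := Hl z t Pz; first by exists j.
exists t0; first by rewrite mem_cat t0s orbT.
by rewrite (le_trans tt)// ler_wpM2r ?(ltW e0)// lerDr.
Qed.

Lemma crossesU (P : R -> R -> Prop) (Q Q' : R * R -> Prop) :
  crosses P Q -> crosses P Q' -> crosses P (fun y => Q y \/ Q' y).
Proof.
move=> [ts [K [K0 H]]] [ts' [K' [K'0 H']]].
exists (ts ++ ts'), (K + K'); split; first exact: addr_ge0.
apply: small_imp (smallI H H') => eps e0 [{}H {}H'] z t Pz [Qz|Qz].
  have [t0 t0s tt] := H z t Pz Qz; exists t0; first by rewrite mem_cat t0s.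
  by rewrite (le_trans tt)// ler_wpM2r ?(ltW e0)// lerDl.
have [t0 t0s tt] := H' z t Pz Qz; exists t0; first by rewrite mem_cat t0s orbT.
by rewrite (le_trans tt)// ler_wpM2r ?(ltW e0)// lerDr.
Qed.

Variable s0 : R.
Let full (eps z : R) := `|z - s0| <= eps.
Let right (eps z : R) := s0 < z <= s0 + eps.

Lemma right_full eps z : right eps z -> full eps z.
Proof.
move=> /andP[z1 z2]; rewrite /full ger0_norm; lra.
Qed.

Lemma crosses_segment ab : ~ vertical ab s0 -> crosses full (segment ab.1 ab.2).
Proof.
case: ab => a b /= nv; set al := dotp x a; set be := dotp x b.
have zE z t : segment a b (Y z t) -> exists2 l, Y z t = a + l *: (b - a) & z = al + l * (be - al).
  move=> /segmentE[l _ E]; exists l => //.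
  by rewrite -(dotp_pt z t ad) E dotpD dotpZ dotpB.
have [ab|ab] := eqVneq al be.
  have als : al != s0.
    by apply/eqP => als; apply: nv; split; rewrite -?/be -?ab.
  apply: crosses_empty; have as0 : 0 < `|al - s0| by rewrite normr_gt0 subr_eq0.
  apply: small_imp (small_lt as0) => eps e0 ea z t; rewrite /full => zs /zE[l _].
  by rewrite ab subrr mulr0 addr0 => zb; move: ea; rewrite ab -zb ltNge zs.
have bal : be - al != 0 by rewrite subr_eq0 eq_sym.
have dd := dotpp_gt0 d0.
(* On a segment whose offset varies, t is an affine function of the offset z: t0 is its value at s0
   and T1 its rate. *)
pose T1 := (dotp d (b - a) / (be - al) - dotp d e) / dotp d d.
pose t0 := (dotp d a + (s0 - al) / (be - al) * dotp d (b - a) - s0 * dotp d e) / dotp d d.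
exists [:: t0], `|T1|; split => //; apply: smallW => eps e0 z t zs /zE[l E zl].
exists t0; first exact: mem_head.
have tE : t * dotp d d = dotp d a + l * dotp d (b - a) - z * dotp d e.
  have : dotp d (Y z t) = dotp d (a + l *: (b - a)) by rewrite E.
  rewrite dotpD dotpZ => <-; rewrite /pt /dotp /=; ring.
have lE : l = (z - al) / (be - al) by rewrite zl addrAC subrr add0r mulfK.
have -> : t - t0 = T1 * (z - s0).
  have -> : t = (t * dotp d d) / dotp d d by rewrite mulfK// gt_eqF.
  rewrite tE lE /t0 /T1; field; rewrite bal gt_eqF//.
by rewrite normrM ler_wpM2l.
Qed.

(** A segment contained in the line s0 is never met by larger offsets. *)
Lemma crosses_segment_right ab : crosses right (segment ab.1 ab.2).
Proof.
have [[v1 v2]|nv] := pselect (vertical ab s0); last first.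
  exact: crosses_sub right_full (crosses_segment nv).
apply: crosses_empty; apply: smallW => eps e0 z t /andP[z1 _] /segmentE[l _ E].
move: z1; rewrite -(dotp_pt z t ad) E dotpD dotpZ dotpB v1 v2 subrr mulr0 addr0.
by rewrite ltxx.
Qed.

Let X := dotp x x.
Let q := x.1 * d.2 - x.2 * d.1.
Let p := x.1 * e.2 - x.2 * e.1.
Let off a := x.1 * a.2 - x.2 * a.1.

Lemma adapted_x0 : x != 0.
Proof.
apply/eqP => x0; have [+ _] := ad; rewrite x0 /dotp /= !mul0r addr0 => /eqP.
by rewrite eq_sym oner_eq0.
Qed.

Lemma adapted_q0 : q != 0.
Proof.
have [_ xd] := ad; apply: contra d0 => /eqP qq0; rewrite /dotp in xd.
have X0 := dotpp_gt0 adapted_x0.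
apply/eqP/injective_projections => /=; apply: (mulfI (lt0r_neq0 X0)).
  by rewrite mulr0 /dotp -[RHS](mulr0 x.1) -xd -[RHS]subr0 -(mulr0 x.2) -qq0 /q; ring.
by rewrite mulr0 /dotp -[RHS](mulr0 x.2) -xd -[RHS]addr0 -(mulr0 x.1) -qq0 /q; ring.
Qed.

(** Lagrange's identity: X times the squared norm of a vector is the sum of the squares of its
    scalar product and of its determinant with x; the determinant of x with [Y z t] is p z + q t. *)
Lemma circle_coord c z t : X * circle_eq c (Y z t) =
  (z - dotp x c.1) ^+ 2 + (p * z + q * t - off c.1) ^+ 2 - X * c.2 ^+ 2.
Proof.
have := dotp_pt z t ad => zE; rewrite -[X in (X - dotp x c.1) ^+ 2]zE.
by rewrite /circle_eq /X /dotp /p /q /off /pt /=; ring.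
Qed.

(** W z is X times the squared half chord, nonzero at s0 when the line is not tangent. If it is
    positive, zz^2 - w^2 = O(eps), and the factor of the farther root is at least w, so zz is O(eps)
    close to the nearer root. If it is negative, nearby lines miss the circle. *)
Lemma crosses_circle c : ~ tangent c s0 -> crosses full (fun y => circle_eq c y = 0).
Proof.
move=> nt; pose W z := X * c.2 ^+ 2 - (z - dotp x c.1) ^+ 2.
have W0 : W s0 != 0 by rewrite subr_eq0 eq_sym; exact/eqP.
pose C := 2 * `|s0 - dotp x c.1| + 1.
have C0 : 0 <= C by rewrite addr_ge0// mulr_ge0.
have WB eps z : 0 < eps -> eps < 1 -> full eps z -> `|W z - W s0| <= C * eps.
  move=> e0 e1 zs; have -> : W z - W s0 = - (z - s0) * ((z - s0) + 2 * (s0 - dotp x c.1)).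
    by rewrite /W; ring.
  rewrite normrM normrN mulrC ler_pM//.
  rewrite (le_trans (ler_normD _ _))// normrM (ger0_norm (x := 2))// /C addrC lerD2l.
  by rewrite (le_trans zs)// ltW.
have Wz z t : circle_eq c (Y z t) = 0 -> (p * z + q * t - off c.1) ^+ 2 = W z.
  by move=> H; have := circle_coord c z t; rewrite H mulr0 /W; lra.
have [Wn|Wp|] := ltrgt0P (W s0); last by move/eqP: W0.
  pose w := Num.sqrt (W s0); have w0 : 0 < w by rewrite sqrtr_gt0.
  have ww : w ^+ 2 = W s0 by rewrite sqr_sqrtr// ltW.
  pose ts := [:: (off c.1 - p * s0 + w) / q; (off c.1 - p * s0 - w) / q].
  pose K := (C / w + `|p|) / `|q|.
  have q0 : 0 < `|q| by rewrite normr_gt0 adapted_q0.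
  have K0 : 0 <= K by rewrite divr_ge0// addr_ge0// divr_ge0// ltW.
  exists ts, K; split => //; apply: small_imp (small_lt ltr01) => eps e0 e1 z t zs /Wz.
  set zz := _ - off c.1 => zW.
  have zw : `|zz - w| * `|zz + w| <= C * eps.
    by rewrite -normrM -subr_sqr zW ww; exact: WB.
  have main sg : sg \in [:: w; - w] -> `|zz - sg| * w <= C * eps ->
      `|t - (off c.1 - p * s0 + sg) / q| <= K * eps.
    move=> hs H; have -> : t - (off c.1 - p * s0 + sg) / q = (zz - sg - p * (z - s0)) / q.
      by rewrite /zz; field; exact: adapted_q0.
    rewrite normrM normfV ler_pdivrMr// /K mulrAC divfK ?gt_eqF//.
    rewrite (le_trans (ler_normB _ _))// [leRHS]mulrDl lerD//.
      by rewrite mulrAC ler_pdivlMr.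
    by rewrite normrM ler_wpM2l.
  have [z0|z0] := lerP 0 zz.
    exists ((off c.1 - p * s0 + w) / q); first exact: mem_head.
    apply: main; first exact: mem_head.
    by apply: le_trans zw; rewrite ler_wpM2l// ger0_norm; lra.
  exists ((off c.1 - p * s0 - w) / q); first by rewrite !inE eqxx orbT.
  apply: main; first by rewrite !inE eqxx orbT.
  rewrite opprK mulrC; apply: le_trans zw; rewrite mulrC [leRHS]mulrC ler_wpM2l//.
  by rewrite ltr0_norm; lra.
apply: crosses_empty.
apply: small_imp (smallI (small_lt ltr01) (small_linear C (w := - W s0) _)); last by rewrite oppr_gt0.
move=> eps e0 [e1 Ce] z t zs /Wz zW.
have := sqr_ge0 (p * z + q * t - off c.1); rewrite zW.
have := ler_norm (W z - W s0); have := WB eps z e0 e1 zs; lra.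
Qed.

(* Coordinates of the chord of a circle cut by the line s0 + v, where s0 is its
   smallest tangent line. *)
Lemma circle_tangent c : 0 < c.2 -> s0 = dotp x c.1 - Num.sqrt X * c.2 ->
  exists ts0 b V Q : R, [/\ 0 < V, 0 < Q,
    forall v t : R, 0 <= v <= V ->
      (circle_eq c (Y (s0 + v) t) <= 0) = (`|t - (ts0 + b * v)| <= Num.sqrt (v * (2 * V - v)) / Q) /\
      (0 <= circle_eq c (Y (s0 + v) t)) = (Num.sqrt (v * (2 * V - v)) / Q <= `|t - (ts0 + b * v)|) &
    circle_eq c (Y s0 ts0) = 0].
Proof.
move=> c0 s0E; have X0 : 0 < X := dotpp_gt0 adapted_x0.
have sX0 : 0 < Num.sqrt X by rewrite sqrtr_gt0.
have sX2 : Num.sqrt X ^+ 2 = X by rewrite sqr_sqrtr// ltW.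
pose V := Num.sqrt X * c.2; have V0 : 0 < V by rewrite mulr_gt0.
have q0 : 0 < `|q| by rewrite normr_gt0 adapted_q0.
pose ts0 := (off c.1 - p * s0) / q; pose b := - (p / q).
have GE v t : X * circle_eq c (Y (s0 + v) t) =
    (`|q| * `|t - (ts0 + b * v)|) ^+ 2 - v * (2 * V - v).
  rewrite circle_coord -normrM real_normK ?num_real//.
  have -> : q * (t - (ts0 + b * v)) = p * (s0 + v) + q * t - off c.1.
    by rewrite /ts0 /b; field; exact: adapted_q0.
  by rewrite -sX2 {1}s0E /V; ring.
exists ts0, b, V, `|q|; split => //.
  move=> v t /andP[v0 vV]; have W0 : 0 <= v * (2 * V - v) by rewrite mulr_ge0//; lra.
  have A0 : 0 <= `|q| * `|t - (ts0 + b * v)| by rewrite mulr_ge0.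
  split.
    rewrite -(pmulr_rle0 _ X0) GE subr_le0 ler_pdivlMr// [in RHS]mulrC.
    by rewrite -{1}(sqr_sqrtr W0) ler_pXn2r// nnegrE ?sqrtr_ge0.
  rewrite -(pmulr_rge0 _ X0) GE subr_ge0 ler_pdivrMr// [X in _ = (_ <= X)]mulrC.
  by rewrite -{1}(sqr_sqrtr W0) ler_pXn2r// nnegrE ?sqrtr_ge0.
have := GE 0 ts0; rewrite addr0 mulr0 addr0 subrr normr0 mulr0 mul0r subr0 expr0n/=.
by move=> /eqP; rewrite mulf_eq0 gt_eqF//= => /eqP.
Qed.

End CrossPieces.

(** * One direction: the singularities of one source, then their comparison for two *)

Section Detection.
Context {R : realType}.
Implicit Types (a b y p P w : R * R) (c : (R * R) * R).

Definition det2 a b : R := a.1 * b.2 - a.2 * b.1.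

(** In [geo_vertex], b1 and b2 are the neighbours of p, and a1, a2 vanish along the edges at p. A
    line through p that contains no other vertex is thus transversal to both edges. *)
Record geometry n (Om : 'I_n -> set (R * R)) (es : seq ((R * R) * (R * R)))
    (cs : seq ((R * R) * R)) (V : set (R * R)) : Prop := Geometry {
  geo_cover : forall m y, frontier (Om m) y ->
    (exists2 ab, ab \in es & segment ab.1 ab.2 y) \/
    (exists2 c, c \in cs & circle_eq c y = 0) ;
  geo_pos : forall c, c \in cs -> 0 < c.2 ;
  geo_side : forall c, c \in cs -> exists outer : bool, forall P, circle_eq c P = 0 ->
    small (fun r => forall y, `|y - P| < r ->
      (region Om y <-> (if outer then circle_eq c y <= 0 else 0 <= circle_eq c y))) ;
  geo_edge : forall ab, ab \in es -> [/\ V ab.1, V ab.2 & ab.1 != ab.2] ;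
  geo_smooth : forall p d, ~ V p -> d != 0 ->
    (forall ab, ab \in es -> segment ab.1 ab.2 p -> det2 (ab.2 - ab.1) d != 0) ->
    (forall c, c \in cs -> circle_eq c p = 0 -> dotp (p - c.1) d != 0) ->
    smooth_at Om d p ;
  geo_vertex : forall p, V p -> exists a1 a2 (cp cm : bool) b1 b2,
    [/\ ~ collinear a1 a2, cp != cm, cone_at Om p a1 a2 cp cm,
      [/\ V b1, V b2, b1 != p & b2 != p] &
      dotp a1 (b2 - p) = 0 /\ dotp a2 (b1 - p) = 0] }.

Section Direction.
Context (x e d : R * R).
Hypotheses (ae : axis e) (ad : adapted x e d) (d0 : d != 0).
Local Notation Y := (pt e d).

Lemma adapted_perp : exists2 mu : R, mu != 0 & d = mu *: rot90 x.
Proof.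
have X0 := dotpp_gt0 (adapted_x0 ad); have q0 := adapted_q0 ad d0.
exists ((x.1 * d.2 - x.2 * d.1) / dotp x x).
  by rewrite mulf_neq0// invr_eq0 gt_eqF.
have [_ xd] := ad; rewrite /dotp in xd.
have E1 : (x.1 * d.2 - x.2 * d.1) * - x.2 = d.1 * dotp x x.
  transitivity (d.1 * dotp x x - x.1 * (x.1 * d.1 + x.2 * d.2)); first by rewrite /dotp; ring.
  by rewrite xd mulr0 subr0.
have E2 : (x.1 * d.2 - x.2 * d.1) * x.1 = d.2 * dotp x x.
  transitivity (d.2 * dotp x x - x.2 * (x.1 * d.1 + x.2 * d.2)); first by rewrite /dotp; ring.
  by rewrite xd mulr0 subr0.
by apply/injective_projections; rewrite /= /GRing.scale/= mulrAC ?E1 ?E2 mulfK// gt_eqF.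
Qed.

Lemma det2_d w : (det2 w d == 0) = (dotp x w == 0).
Proof.
have [mu mu0 ->] := adapted_perp.
have -> : det2 w (mu *: rot90 x) = mu * dotp x w.
  by rewrite /det2 /dotp /rot90 /= /GRing.scale/=; ring.
by rewrite mulf_eq0 (negbTE mu0).
Qed.

Lemma dotp_d w : (dotp w d == 0) = (det2 x w == 0).
Proof.
have [mu mu0 ->] := adapted_perp.
have -> : dotp w (mu *: rot90 x) = mu * det2 x w.
  by rewrite /det2 /dotp /rot90 /= /GRing.scale/=; ring.
by rewrite mulf_eq0 (negbTE mu0).
Qed.

Lemma det2_parallel w : det2 w d = 0 -> w = (det2 e w / det2 e d) *: d.
Proof.
move=> H; have ed : det2 e d != 0 by exact: (adapted_det ad d0).
rewrite /det2 in H ed *; apply/injective_projections; rewrite /= /GRing.scale/=;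
  apply: (mulIf ed); rewrite mulrAC divfK//.
  transitivity ((e.1 * w.2 - e.2 * w.1) * d.1 + e.1 * (w.1 * d.2 - w.2 * d.1)); first by ring.
  by rewrite H mulr0 addr0.
transitivity ((e.1 * w.2 - e.2 * w.1) * d.2 + e.2 * (w.1 * d.2 - w.2 * d.1)); first by ring.
by rewrite H mulr0 addr0.
Qed.

Lemma pt_surj y : exists t, y = Y (dotp x y) t.
Proof.
have [xe xd] := ad; set w := y - dotp x y *: e.
have H : det2 w d = 0.
  by apply/eqP; rewrite det2_d dotpB dotpZ xe mulr1 subrr.
exists (det2 e w / det2 e d).
transitivity (dotp x y *: e + (det2 e w / det2 e d) *: d); last by [].
by rewrite -(det2_parallel H) /w addrC subrK.
Qed.

Section OneSource.
Context n (Om : 'I_n -> set (R * R)) (u : R * R -> R)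
  (es : seq ((R * R) * (R * R))) (cs : seq ((R * R) * R)) (V : set (R * R)).
Hypotheses (rs : rsource Om u) (geo : geometry Om es cs V).
Local Notation h := (radon u e d).

Definition regular_line (s : R) := (forall ab, ab \in es -> ~ vertical x ab s) /\
  (forall c, c \in cs -> ~ tangent x c s).

Lemma regular_cross s : regular_line s ->
  exists ts K, 0 <= K /\ cross_full Om e d s ts K.
Proof.
move=> [H1 H2].
have X1 := crosses_all (fun ab abes => crosses_segment ad d0 (H1 ab abes)).
have X2 := crosses_all (fun c ccs => crosses_circle ad d0 (H2 c ccs)).
have [ts [K [K0 H]]] := crossesU X1 X2.
exists ts, K; split => //; apply: small_imp H => eps e0 H m z t zs F.
by apply: (H z t zs); exact: geo_cover geo m _ F.
Qed.

Lemma regular_continuous s : regular_line s -> {for s, continuous h}.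
Proof.
move=> /regular_cross[ts [K [K0 H]]].
exact: (cross_full_continuous rs ae ad d0 K0 H).
Qed.

Lemma small_neq (s0 s1 : R) (b : bool) : small (fun eps => s0 + (-1) ^+ b * eps != s1).
Proof.
have [->|ss] := eqVneq s0 s1.
  by apply: smallW => eps e0; rewrite -subr_eq0 addrAC subrr add0r mulf_neq0 ?signr_eq0// gt_eqF.
have s10 : 0 < `|s1 - s0| by rewrite normr_gt0 subr_eq0 eq_sym.
apply: small_imp (small_lt s10) => eps e0 lt; apply/eqP => E; move: lt.
by rewrite -E addrAC subrr add0r normrM normrX normrN1 expr1n mul1r gtr0_norm// ltxx.
Qed.

(** The exceptional offsets form a finite set, so all offsets close to s0 and different from it are
    regular; b selects the side. *)
Lemma small_regular (s0 : R) (b : bool) : small (fun eps => regular_line (s0 + (-1) ^+ b * eps)).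
Proof.
have H1 : small (fun eps => forall ab, ab \in es -> ~ vertical x ab (s0 + (-1) ^+ b * eps)).
  apply: small_all => ab _.
  by apply: small_imp (small_neq s0 (dotp x ab.1) b) => eps _ /eqP ne [/esym].
have H2 : small (fun eps => forall c, c \in cs -> ~ tangent x c (s0 + (-1) ^+ b * eps)).
  apply: small_all => c ccs; have X0 := dotpp_gt0 (adapted_x0 ad).
  pose v := Num.sqrt (dotp x x) * c.2.
  apply: small_imp (smallI (small_neq s0 (dotp x c.1 + v) b) (small_neq s0 (dotp x c.1 - v) b)).
  move=> eps _ [/eqP n1 /eqP n2]; rewrite /tangent.
  have -> : dotp x x * c.2 ^+ 2 = v ^+ 2 by rewrite /v exprMn sqr_sqrtr// ltW.
  by move=> /eqP; rewrite eqf_sqr => /orP[] /eqP E; [apply: n1|apply: n2]; rewrite -E; ring.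
by apply: small_imp (smallI H1 H2) => eps _ [].
Qed.

Lemma small_continuous (s0 : R) (b : bool) :
  small (fun eps => {for s0 + (-1) ^+ b * eps, continuous h}).
Proof. by apply: small_imp (small_regular s0 b) => eps _; exact: regular_continuous. Qed.

Lemma right_lip (s0 : R) : (forall c, c \in cs -> ~ tangent x c s0) -> exists C : R,
  small (fun eps => forall s s', s0 < s -> s <= s' -> s' <= s0 + eps ->
    `|h s' - h s| <= C * eps).
Proof.
move=> H2.
have X1 := crosses_all (fun ab (_ : ab \in es) => crosses_segment_right ad d0 s0 ab).
have X2 := crosses_all (fun c ccs => crosses_sub (@right_full _ s0) (crosses_circle ad d0 (H2 c ccs))).
have [ts [K [K0 H]]] := crossesU X1 X2.
apply: (@cross_right_lip _ _ _ _ _ _ _ rs ae ad d0 s0 ts K K0).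
apply: small_imp H => eps e0 H m z t zs F.
by apply: (H z t zs); exact: geo_cover geo m _ F.
Qed.

(** Edges contained in the tangent line do no harm, since only larger offsets are used, and the
    other circles cross the line transversally or miss it. *)
Lemma circle_singular c (s0 : R) : c \in cs ->
  s0 = dotp x c.1 - Num.sqrt (dotp x x) * c.2 ->
  (forall c', c' \in cs -> c' != c -> ~ tangent x c' s0) ->
  (forall P, circle_eq c P = 0 -> dotp x P = s0 -> u P != 0) ->
  forall C, small (fun eps => C * eps < `|h (s0 + eps) - h (s0 + eps / 4)|).
Proof.
move=> ccs s0E nt uP C.
have [ts0 [b [W [Q [W0 Q0 HG GP]]]]] := circle_tangent ad d0 (geo_pos geo ccs) s0E.
have [outer Hside] := geo_side geo ccs.
have X1 := crosses_all (fun ab (_ : ab \in es) => crosses_segment_right ad d0 s0 ab).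
have X2 : crosses e d (fun eps z => s0 < z <= s0 + eps)
    (fun y => exists2 c', c' \in [seq c' <- cs | c' != c] & circle_eq c' y = 0).
  apply: crosses_all => c'; rewrite mem_filter => /andP[cc cs'].
  exact: crosses_sub (@right_full _ s0) (crosses_circle ad d0 (nt c' cs' cc)).
have [ts [K [K0 H]]] := crossesU X1 X2.
apply: (@tangency_singular _ _ _ _ _ _ _ rs ae ad d0 s0 ts0 b W Q K ts (circle_eq c) outer) => //.
- by apply: uP => //; rewrite dotp_pt.
- exact: Hside.
apply: small_imp H => eps e0 H m z t zs F.
have [Hab|[c' c's E]] := geo_cover geo F.
  by right; apply: (H z t zs); left.
have [cc|cc] := eqVneq c' c; first by left; rewrite -cc.
by right; apply: (H z t zs); right; exists c' => //; rewrite mem_filter cc.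
Qed.

Lemma regular_smooth s0 t : regular_line s0 -> ~ V (Y s0 t) -> smooth_at Om d (Y s0 t).
Proof.
move=> [H1 H2] nV; apply: (geo_smooth geo) => //.
  move=> ab abes /segmentE[l _ E]; rewrite det2_d; apply/eqP => xw.
  apply: (H1 ab abes); have := dotp_pt s0 t ad; rewrite E dotpD dotpZ xw mulr0 addr0 => xa.
  by split => //; move: xw; rewrite dotpB xa => /eqP; rewrite subr_eq0 => /eqP.
move=> c ccs Ec; rewrite dotp_d; apply/eqP => D; apply: (H2 c ccs); rewrite /tangent.
set w := Y s0 t - c.1 in D.
have -> : s0 - dotp x c.1 = dotp x w by rewrite /w dotpB dotp_pt.
have -> : c.2 ^+ 2 = dotp w w by apply/esym/eqP; rewrite -subr_eq0; apply/eqP.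
transitivity (dotp x w ^+ 2 + det2 x w ^+ 2); first by rewrite D expr0n/= addr0.
by rewrite /det2 /dotp; ring.
Qed.

Lemma no_vertex_second_difference s0 : regular_line s0 -> (forall P, V P -> dotp x P != s0) ->
  forall w : R, 0 < w -> small (fun eps => `|h (s0 + eps) + h (s0 - eps) - 2 * h s0| <= w * eps).
Proof.
move=> reg nV; have [ts [K [K0 cr]]] := regular_cross reg.
apply: (smooth_second_difference rs ae ad d0 K0 cr) => tj _.
by apply: regular_smooth => // /nV; rewrite dotp_pt// eqxx.
Qed.

Lemma vertex_second_difference P : V P -> (forall Q, V Q -> dotp x Q = dotp x P -> Q = P) ->
  (forall c, c \in cs -> ~ tangent x c (dotp x P)) -> u P != 0 ->
  let s0 := dotp x P in
  exists2 kappa, kappa != 0 & forall w : R, 0 < w -> small (fun eps =>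
    `|h (s0 + eps) + h (s0 - eps) - 2 * h s0 - kappa * eps| <= w * eps).
Proof.
move=> VP VQ nt uP s0.
have [tP EP] := pt_surj P; rewrite -/s0 in EP.
have reg : regular_line s0.
  split => // ab /(geo_edge geo)[V1 V2 /eqP ne] [v1 v2].
  by apply: ne; rewrite (VQ _ V1 v1) (VQ _ V2 v2).
have [a1 [a2 [cp [cm [b1 [b2 [ncol cpm cP [Vb1 Vb2 b1P b2P] [a1b a2b]]]]]]]] := geo_vertex geo VP.
(* If a vanished on d as well as on the edge b - P, the edge would be parallel to d, and the vertex
   b would lie on the line through P. *)
have nz a b : a != 0 -> V b -> b != P -> dotp a (b - P) = 0 -> dotp a d != 0.
  move=> a0 Vb /eqP bP ab; rewrite dotp_d; apply/eqP => D.
  apply: bP; apply: VQ => //; apply/eqP; rewrite -subr_eq0 -dotpB.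
  have : dotp a a * dotp x (b - P) == 0.
    have key w : dotp a a * dotp x w = dotp a w * dotp x a - det2 x a * det2 a w.
      by rewrite /dotp /det2; ring.
    by rewrite key ab D !mul0r subr0.
  by rewrite mulf_eq0 gt_eqF ?dotpp_gt0.
have a10 : a1 != 0.
  by apply/eqP => E; apply: ncol; rewrite E /collinear /= !mul0r.
have a20 : a2 != 0.
  by apply/eqP => E; apply: ncol; rewrite E /collinear /= !mulr0.
have D1 := nz a1 b2 a10 Vb2 b2P a1b; have D2 := nz a2 b1 a20 Vb1 b1P a2b.
have [ts [K [K0 cr]]] := regular_cross reg.
rewrite EP in cP uP.
apply: (corner_second_difference rs ae ad d0 K0 cr _ D1 D2 ncol cpm cP uP) => tj _ tjP.
apply: regular_smooth => // VY; move/eqP: tjP; apply.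
have E := VQ _ VY (dotp_pt s0 tj ad); rewrite EP in E.
have : (tj - tP) *: d = 0.
  by rewrite -(subrr (Y s0 tP)) -{1}E pt_sub subrr scale0r add0r.
by move=> /eqP; rewrite scaler_eq0 (negbTE d0) orbF subr_eq0 => /eqP.
Qed.

End OneSource.

Section TwoSources.
Context n1 n2 (Om1 : 'I_n1 -> set (R * R)) (Om2 : 'I_n2 -> set (R * R)).
Context (u1 u2 : R * R -> R)
  (es1 : seq ((R * R) * (R * R))) (cs1 : seq ((R * R) * R)) (V1 : set (R * R))
  (es2 : seq ((R * R) * (R * R))) (cs2 : seq ((R * R) * R)) (V2 : set (R * R)).
Hypotheses (rs1 : rsource Om1 u1) (rs2 : rsource Om2 u2).
Hypotheses (geo1 : geometry Om1 es1 cs1 V1) (geo2 : geometry Om2 es2 cs2 V2).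
Let u y := u1 y - u2 y.
Hypothesis null : forall s, {for s, continuous (radon u e d)} -> radon u e d s = 0.

Lemma radon_diff s : radon u e d s = radon u1 e d s - radon u2 e d s.
Proof. by rewrite /radon intB//; [exact: (slice_bcs rs1 ad d0)|exact: (slice_bcs rs2 ad d0)]. Qed.

Lemma radon_eq s : {for s, continuous (radon u1 e d)} -> {for s, continuous (radon u2 e d)} ->
  radon u1 e d s = radon u2 e d s.
Proof.
move=> c1 c2; apply/eqP; rewrite -subr_eq0 -radon_diff null//.
rewrite (_ : radon u e d = (fun s => radon u1 e d s - radon u2 e d s)).
  exact: continuousB.
by apply/funext => z; exact: radon_diff.
Qed.

Lemma circle_detected c s0 : c \in cs1 -> s0 = dotp x c.1 - Num.sqrt (dotp x x) * c.2 ->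
  (forall c', c' \in cs1 -> c' != c -> ~ tangent x c' s0) ->
  (forall c', c' \in cs2 -> ~ tangent x c' s0) ->
  (forall P, circle_eq c P = 0 -> dotp x P = s0 -> u1 P != 0) -> False.
Proof.
move=> ccs s0E nt1 nt2 uP.
have [C HC] := right_lip rs2 geo2 nt2.
(* The constant C of the second source comes first: the singularity of the first source beats every
   constant, hence this one. *)
have sing := circle_singular rs1 geo1 ccs s0E nt1 uP C.
have ct : small (fun eps => radon u1 e d (s0 + eps) = radon u2 e d (s0 + eps)).
  apply: small_imp (smallI (small_continuous rs1 geo1 s0 false) (small_continuous rs2 geo2 s0 false)).
  by move=> eps _; rewrite expr0 mul1r => -[]; exact: radon_eq.
have ct4 : small (fun eps => radon u1 e d (s0 + eps / 4) = radon u2 e d (s0 + eps / 4)).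
  have q : 0 < 4^-1 :> R by rewrite invr_gt0.
  by apply: small_imp (small_scale q ct) => eps _; rewrite mulrC.
have [eps e0 [[H1 H2] [E1 E2]]] := small_ex (smallI (smallI HC sing) (smallI ct ct4)).
rewrite E1 E2 in H2.
move: H2; rewrite ltNge => /negP; apply; apply: H1; last by rewrite lerD2l.
  by rewrite ltrDl divr_gt0.
by rewrite lerD2l; lra.
Qed.

Lemma corner_detected P : V1 P -> (forall Q, V1 Q -> dotp x Q = dotp x P -> Q = P) ->
  (forall Q, V2 Q -> dotp x Q != dotp x P) ->
  (forall c, c \in cs1 -> ~ tangent x c (dotp x P)) ->
  (forall c, c \in cs2 -> ~ tangent x c (dotp x P)) -> u1 P != 0 -> False.
Proof.
move=> VP VQ nV2 nt1 nt2 uP; set s0 := dotp x P.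
have [kappa kappa0 Hk] := vertex_second_difference rs1 geo1 VP VQ nt1 uP.
have reg1 : regular_line es1 cs1 s0.
  split => // ab /(geo_edge geo1)[W1 W2 /eqP ne] [v1 v2].
  by apply: ne; rewrite (VQ _ W1 v1) (VQ _ W2 v2).
have reg2 : regular_line es2 cs2 s0.
  split => // ab /(geo_edge geo2)[W1 _ _] [v1 _].
  by have := nV2 _ W1; rewrite v1 eqxx.
(* Two errors of [|kappa| / 4] leave half of the kink. *)
have w0 : 0 < `|kappa| / 4 by rewrite divr_gt0 ?normr_gt0.
have H2 := no_vertex_second_difference rs2 geo2 reg2 nV2 w0.
have cc (b : bool) : small (fun eps => radon u1 e d (s0 + (-1) ^+ b * eps) = radon u2 e d (s0 + (-1) ^+ b * eps)).
  apply: small_imp (smallI (small_continuous rs1 geo1 s0 b) (small_continuous rs2 geo2 s0 b)).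
  by move=> eps _ []; exact: radon_eq.
have E0 := radon_eq (regular_continuous rs1 geo1 reg1) (regular_continuous rs2 geo2 reg2).
have [eps e0 [[K1 K2] [Ep Em]]] := small_ex (smallI (smallI (Hk _ w0) H2) (smallI (cc false) (cc true))).
rewrite expr0 mul1r in Ep; rewrite expr1 mulN1r in Em.
rewrite -/s0 Ep Em E0 in K1.
have : `|kappa * eps| <= `|kappa| / 4 * eps + `|kappa| / 4 * eps.
  set D := radon u2 e d (s0 + eps) + _ - _ in K1 K2.
  have -> : kappa * eps = D - (D - kappa * eps) by ring.
  by rewrite (le_trans (ler_normB _ _))// lerD.
rewrite normrM (gtr0_norm e0); have : 0 < `|kappa| * eps by rewrite mulr_gt0 ?normr_gt0.
lra.
Qed.

End TwoSources.
End Direction.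
End Detection.

(** * Local geometry of polygons and annuli *)

Section TwoSides.
Context {R : realType}.
Implicit Types (a e p q v y : R * R) (A : set (R * R)).

Lemma dotpN p q : dotp p (- q) = - dotp p q.
Proof. by rewrite /dotp /=; ring. Qed.

Lemma segment_side A p q : closed A ->
  (forall l : R, 0 <= l <= 1 -> ~ frontier A (p + l *: (q - p))) -> A p -> A q.
Proof.
move=> cA F Ap; apply: interior_subset.
have -> : q = p + 1 *: (q - p) by rewrite scale1r addrC subrK.
apply: (@path_side _ (fun s => p + s *: (q - p)) 0 1 A _ cA F 0) => //.
- exact: line_continuous.
- by rewrite lexx ler01.
- by rewrite ler01 lexx.
- by rewrite scale0r addr0.
Qed.

Lemma convex_gt0 (l b c : R) : 0 <= l <= 1 -> 0 < b -> 0 < c -> 0 < (1 - l) * b + l * c.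
Proof. by move=> /andP[l0 l1] b0 c0; nra. Qed.

Definition in_cone a1 a2 v := (0 < dotp a1 v) && (0 < dotp a2 v).

Section Cone.
Variables (a1 a2 e p : R * R) (r : R).
Hypotheses (a1e : dotp a1 e = 1) (a2e : dotp a2 e = 1) (r0 : 0 < r).

Let off_cone v := dotp a1 v < 0 \/ dotp a2 v < 0.
Let s : R := r / (2 * (`|e| + 1)).

Let s0 : 0 < s.
Proof. by rewrite divr_gt0// mulr_gt0// ltr_wpDl. Qed.

Let se_lt : `|s *: e| < r.
Proof.
rewrite normrZ gtr0_norm// /s mulrAC ltr_pdivrMr ?mulr_gt0// ?ltr_wpDl//.
have E0 := normr_ge0 e; have : 0 < r * (`|e| + 2) by rewrite mulr_gt0// ltr_wpDl.
lra.
Qed.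

Let ball_convex v w (l : R) : `|v| < r -> `|w| < r -> 0 <= l <= 1 -> `|(1 - l) *: v + l *: w| < r.
Proof.
move=> vr wr /andP[l0 l1]; rewrite (le_lt_trans (ler_normD _ _))// !normrZ.
rewrite (ger0_norm l0) ger0_norm ?subr_ge0//.
have := @convex_gt0 l (r - `|v|) (r - `|w|).
by rewrite l0 l1 !subr_gt0 => /(_ isT vr wr); lra.
Qed.

(** The cone cut by the ball is convex: the segment from v to the reference point on the axis e
    avoids the frontier. *)
Lemma star_cone A : closed A ->
  (forall v, `|v| < r -> frontier A (p + v) -> ~ in_cone a1 a2 v) ->
  forall v, `|v| < r -> in_cone a1 a2 v -> (A (p + v) <-> A (p + s *: e)).
Proof.
move=> cA F.
have key v w : `|v| < r -> `|w| < r -> in_cone a1 a2 v -> in_cone a1 a2 w -> A (p + v) -> A (p + w).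
  move=> vr wr /andP[v1 v2] /andP[w1 w2]; apply: segment_side => // l l01.
  have -> : p + v + l *: (p + w - (p + v)) = p + ((1 - l) *: v + l *: w).
    by apply/injective_projections; rewrite /= /GRing.scale/=; ring.
  move=> /F; apply; first exact: ball_convex.
  by rewrite /in_cone !dotpD !dotpZ !convex_gt0.
have ce : in_cone a1 a2 (s *: e) by rewrite /in_cone !dotpZ a1e a2e !mulr1 s0.
by move=> v vr cv; split; apply: key.
Qed.

(** The outside of the cone is not convex, but it is star-shaped around the opposite reference
    point: a functional that is negative at v stays negative up to there. *)
Lemma star_off_cone A : closed A ->
  (forall v, `|v| < r -> frontier A (p + v) -> ~ off_cone v) ->
  forall v, `|v| < r -> off_cone v -> (A (p + v) <-> A (p - s *: e)).
Proof.
move=> cA F.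
have ser : `|- (s *: e)| < r by rewrite normrN.
have conv a v (l : R) : dotp a e = 1 -> dotp a v < 0 -> 0 <= l <= 1 ->
    dotp a ((1 - l) *: v + l *: - (s *: e)) < 0.
  move=> ae av l01; have := @convex_gt0 l (- dotp a v) s l01.
  rewrite oppr_gt0 => /(_ av s0); rewrite dotpD !dotpZ dotpN dotpZ ae; lra.
have off v (l : R) : off_cone v -> 0 <= l <= 1 -> off_cone ((1 - l) *: v + l *: - (s *: e)).
  by move=> [H|H] l01; [left|right]; exact: conv.
move=> v vr ov; split; apply: segment_side => // l l01.
  have -> : p + v + l *: (p - s *: e - (p + v)) = p + ((1 - l) *: v + l *: - (s *: e)).
    by apply/injective_projections; rewrite /= /GRing.scale/=; ring.
  by move=> /F; apply; [exact: ball_convex|exact: off].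
have -> : p - s *: e + l *: (p + v - (p - s *: e)) = p + ((1 - (1 - l)) *: v + (1 - l) *: - (s *: e)).
  by apply/injective_projections; rewrite /= /GRing.scale/=; ring.
have l01' : 0 <= 1 - l <= 1 by lra.
by move=> /F; apply; [exact: ball_convex|exact: off].
Qed.

(* A region that is the closure of its interior cannot lie on both sides, nor
   on no side, of its boundary at p. *)
Lemma one_side A : closed A -> A = closure A° -> frontier A p ->
  (forall v, `|v| < r -> frontier A (p + v) -> ~ in_cone a1 a2 v /\ ~ off_cone v) ->
  exists b : bool, forall v, `|v| < r -> dotp a1 v != 0 -> dotp a2 v != 0 ->
    `[< A (p + v) >] = if in_cone a1 a2 v then b else ~~ b.
Proof.
move=> cA regA Fp F.
have Hc := star_cone cA (fun v vr f => (F v vr f).1).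
have Ho := star_off_cone cA (fun v vr f => (F v vr f).2).
have dich v : dotp a1 v != 0 -> dotp a2 v != 0 -> in_cone a1 a2 v \/ ~~ in_cone a1 a2 v /\ off_cone v.
  rewrite /in_cone /off_cone.
  by case: (ltrgt0P (dotp a1 v)); case: (ltrgt0P (dotp a2 v)) => //=; auto.
(* A generic small translation along e leaves the two lines a1 = 0, a2 = 0. *)
have dense v (t : R) : `|v| < r -> 0 < t -> exists w,
    [/\ `|w| < r, `|w - v| < t, dotp a1 w != 0 & dotp a2 w != 0].
  move=> vr t0; have m0 : 0 < Num.min t (r - `|v|) by rewrite lt_min t0 subr_gt0.
  have se : small (fun eps => eps * `|e| < Num.min t (r - `|v|)).
    have := small_linear `|e| m0; by apply: small_imp => eps _; rewrite mulrC.
  have [eps e0 [lt [n1 n2]]] := small_ex (smallI se (smallI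
    (small_neq (dotp a1 v) 0 false) (small_neq (dotp a2 v) 0 false))).
  have en : `|eps *: e| < Num.min t (r - `|v|) by rewrite normrZ gtr0_norm.
  move: en; rewrite lt_min => /andP[en1 en2].
  exists (v + eps *: e); split.
  - by rewrite (le_lt_trans (ler_normD _ _))//; lra.
  - by rewrite addrC addKr.
  - by move: n1; rewrite dotpD dotpZ a1e mulr1 expr0 mul1r.
  - by move: n2; rewrite dotpD dotpZ a2e mulr1 expr0 mul1r.
have [Ic|Ic] := pselect (A (p + s *: e)); have [Io|Io] := pselect (A (p - s *: e)).
(* Both sides belong to A: by density and closedness A contains a whole ball, and p is interior. *)
- case: Fp => _ []; apply/interior_ball; exists r => // y yr.
  move/closure_id : (cA) => ->; apply/closure_ball => t t0.
  have [w [wr wt n1 n2]] := dense (y - p) t yr t0.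
  exists (p + w); last by rewrite (_ : p + w - y = w - (y - p))// opprB addrCA addrA.
  by have [c|[_ o]] := dich w n1 n2; [apply/(Hc _ wr c)|apply/(Ho _ wr o)].
- exists true => v vr n1 n2; have [c|[/negbTE nc o]] := dich v n1 n2.
    by rewrite c; apply/asboolP; apply/(Hc _ vr c).
  by rewrite nc; apply/asboolP => /(Ho _ vr o).
- exists false => v vr n1 n2; have [c|[/negbTE nc o]] := dich v n1 n2.
    by rewrite c; apply/asboolP => /(Hc _ vr c).
  by rewrite nc; apply/asboolP/(Ho _ vr o).
(* Neither side belongs to A: near p the set A lies in two lines and has no interior point, although
   p is in the closure of the interior. *)
exfalso; have : closure A° p by rewrite -regA; exact: closed_frontier_sub.
move=> /closure_ball/(_ r r0)[y /interior_ball[t t0 tA] yr].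
have [w [wr wt n1 n2]] := dense (y - p) t yr t0.
have : A (p + w) by apply: tA; rewrite (_ : p + w - y = w - (y - p))// opprB addrCA addrA.
by have [c|[_ o]] := dich w n1 n2; [move/(Hc _ wr c)|move/(Ho _ wr o)].
Qed.

End Cone.
End TwoSides.

Section Pieces.
Context {R : realType}.
Implicit Types (a b e p q v y P : R * R) (c : (R * R) * R) (A : set (R * R)).

Definition half_plane A p a (s : bool) := small (fun r => forall v, `|v| < r ->
  (frontier A (p + v) -> dotp a v = 0) /\
  (dotp a v != 0 -> `[< A (p + v) >] = if 0 < dotp a v then s else ~~ s)).

(** The data of a single piece. The frontier segments from p to b1 and b2 serve later to exclude a
    normal at a vertex. *)
Record piece_geometry A (es : seq ((R * R) * (R * R))) (cs : seq ((R * R) * R))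
    (vs : seq (R * R)) : Prop := PieceGeometry {
  pg_closed : closed A ;
  pg_cover : forall y, frontier A y ->
    (exists2 ab, ab \in es & segment ab.1 ab.2 y) \/
    (exists2 c, c \in cs & circle_eq c y = 0) ;
  pg_pos : forall c, c \in cs -> 0 < c.2 ;
  pg_side : forall c, c \in cs -> exists outer : bool, forall P, circle_eq c P = 0 ->
    small (fun r => forall y, `|y - P| < r ->
      (A y <-> (if outer then circle_eq c y <= 0 else 0 <= circle_eq c y))) ;
  pg_edge : forall ab, ab \in es -> [/\ ab.1 \in vs, ab.2 \in vs & ab.1 != ab.2] ;
  pg_half_plane : forall ab p, ab \in es -> segment ab.1 ab.2 p -> p \notin vs ->
    exists a s, [/\ a != 0, dotp a (ab.2 - ab.1) = 0 & half_plane A p a s] ;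
  pg_vertex : forall p, p \in vs -> exists a1 a2 (s : bool) b1 b2,
    [/\ ~ collinear a1 a2,
      small (fun r => forall v, `|v| < r -> dotp a1 v != 0 -> dotp a2 v != 0 ->
        `[< A (p + v) >] = if in_cone a1 a2 v then s else ~~ s),
      segment p b1 `<=` frontier A /\ segment p b2 `<=` frontier A,
      [/\ b1 \in vs, b2 \in vs, b1 != p & b2 != p] &
      dotp a1 (b2 - p) = 0 /\ dotp a2 (b1 - p) = 0] }.

Lemma dual_basis p q : det2 p q != 0 -> exists a1 a2, ~ collinear a1 a2 /\
  [/\ dotp a1 p = 1, dotp a1 q = 0, dotp a2 p = 0 & dotp a2 q = 1].
Proof.
case: p => p1 p2; case: q => q1 q2; rewrite /det2 /= => D0.
exists ((p1 * q2 - p2 * q1)^-1 *: (q2, - q1)), ((p1 * q2 - p2 * q1)^-1 *: (- p2, p1)).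
split; last by split; rewrite /dotp /= /GRing.scale/=; field.
rewrite /collinear /= /GRing.scale/= => E.
have /eqP : (p1 * q2 - p2 * q1)^-1 = 0.
  by transitivity ((p1 * q2 - p2 * q1)^-1 ^+ 2 * (p1 * q2 - p2 * q1)); [field|lra].
by rewrite invr_eq0 (negbTE D0).
Qed.

Lemma closed_segment_compact a b : compact (segment a b).
Proof.
have -> : segment a b = (fun t : R => (1 - t) *: a + t *: b) @` `[0, 1] by [].
apply: continuous_compact; last exact: segment_compact.
apply: continuous_subspaceT => t; apply: cvgD.
  apply: (@continuous_comp _ _ _ (fun t : R => 1 - t) (fun l => l *: a)).
    by apply: cvgB => //; exact: cvg_cst.
  exact: (@scalel_continuous R (R * R)%type a).
exact: (@scalel_continuous R (R * R)%type b).
Qed.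

Lemma plane_compact_closed A : compact A -> closed A.
Proof. by apply: compact_closed; exact: norm_hausdorff. Qed.

Lemma closed_avoid A p : closed A -> ~ A p -> small (fun r => forall y, `|y - p| < r -> ~ A y).
Proof.
move=> cA nA; have /near_ball[r r0 H] : nbhs p (~` A).
  by apply: open_nbhs_nbhs; split => //; exact: closed_openC.
by exists r => // t /andP[t0 tr] y yt; apply: H; exact: lt_trans tr.
Qed.

Section Polygon.
Variables (A : set (R * R)) (n : nat) (V : 'I_n -> R * R).
Hypotheses (cA : closed A) (regA : A = closure A°) (chain : simple_closed_chain V)
  (FA : frontier A = \bigcup_(i in setT) edge V i).

Lemma edges_near p : small (fun r => forall v, `|v| < r -> frontier A (p + v) ->
  exists i, edge V i p /\ edge V i (p + v)).
Proof.
have H i : small (fun r => ~ edge V i p -> forall y, `|y - p| < r -> ~ edge V i y).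
  have [Ep|Ep] := pselect (edge V i p); first exact: smallW.
  have := closed_avoid (plane_compact_closed (@closed_segment_compact _ _)) Ep.
  by apply: small_imp.
apply: small_imp (small_fin H) => r r0 {}H v vr; rewrite FA => -[i _ Ei].
exists i; split => //; apply: contrapT => Ep; apply: (H i Ep _ _ Ei).
by rewrite addrC addKr.
Qed.

Lemma edgeP i y : edge V i y -> exists2 l : R, 0 <= l <= 1 & y = V i + l *: (V (ordS i) - V i).
Proof. exact: segmentE. Qed.

Lemma chain_neq i : V i != V (ordS i).
Proof.
have [_ _ _ col] := chain; apply/eqP => E; apply: (col i).
by rewrite E subrr /collinear /= !mul0r.
Qed.

Lemma edge_frontier i : edge V i `<=` frontier A.
Proof. by move=> y Ey; rewrite FA; exists i. Qed.

(** Two edges meet only at vertices, so near p the frontier lies on the line of one edge; [one_side]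
    then applies with two equal functionals. *)
Lemma edge_half_plane i p : edge V i p -> (forall j, V j != p) ->
  exists a s, [/\ a != 0, dotp a (V (ordS i) - V i) = 0 & half_plane A p a s].
Proof.
move=> Ei nV; have [_ _ simple _] := chain.
set D := V (ordS i) - V i.
have D0 : D != 0 by rewrite subr_eq0 eq_sym chain_neq.
have DD := dotpp_gt0 D0.
have perp : dotp (rot90 D) D = 0 by rewrite /dotp /rot90 /=; ring.
pose a := (dotp D D)^-1 *: rot90 D.
have aD : dotp a D = 0 by rewrite dotpC dotpZ dotpC perp mulr0.
have ae : dotp a (rot90 D) = 1.
  rewrite dotpC dotpZ (_ : dotp (rot90 D) (rot90 D) = dotp D D).
    by rewrite mulVf// gt_eqF.
  by rewrite /dotp /rot90 /=; ring.
have [r r0 Hr] := small_ex (edges_near p).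
have line v : `|v| < r -> frontier A (p + v) -> dotp a v = 0.
  move=> vr /(Hr v vr)[j [Ejp Ejv]].
  have ji : j = i.
    apply/eqP; apply/negPn/negP => ji; have [[E|E] _] := simple j i ji p (conj Ejp Ei).
      by move/eqP: (nV j); rewrite E.
    by move/eqP: (nV (ordS j)); rewrite E.
  move: Ejp Ejv; rewrite ji => /edgeP[l _ pE] /edgeP[k _ vE].
  have -> : v = (k - l) *: D.
    rewrite scalerBl -(addKr p v) vE {1}pE /D opprD.
    by rewrite addrACA addNr add0r addrC.
  by rewrite dotpZ aD mulr0.
have Fp : frontier A p by exact: edge_frontier Ei.
have [s Hs] := one_side ae ae r0 cA regA Fp (fun v vr f => ltac:(
  rewrite /in_cone (line v vr f) ltxx; by split=> // -[])).
exists a, s; split => //.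
  by apply/eqP => a0; move: ae; rewrite a0 /dotp /= !mul0r addr0 => /eqP; rewrite eq_sym oner_eq0.
exists r => // t /andP[t0 tr] v vt; have vr := lt_trans vt tr; split; first exact: line.
by move=> n0; rewrite Hs// /in_cone andbb.
Qed.

(** With a1, a2 dual to the directions f1, f2 of the two edges, the frontier near the vertex lies on
    the two rays that bound the cone. A reflex angle is the case s = false, where the region is the
    outside of the cone. *)
Lemma vertex_cone i : exists a1 a2 (s : bool) b1 b2,
    [/\ ~ collinear a1 a2,
      small (fun r => forall v, `|v| < r -> dotp a1 v != 0 -> dotp a2 v != 0 ->
        `[< A (V i + v) >] = if in_cone a1 a2 v then s else ~~ s),
      segment (V i) b1 `<=` frontier A /\ segment (V i) b2 `<=` frontier A,
      [/\ exists j, b1 = V j, exists j, b2 = V j, b1 != V i & b2 != V i] &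
      dotp a1 (b2 - V i) = 0 /\ dotp a2 (b1 - V i) = 0].
Proof.
have [_ injV simple col] := chain.
pose j := ord_pred i; have ji : ordS j = i by rewrite /j ord_predK.
set b1 := V (ordS i); set b2 := V j; set P := V i.
set f1 := b1 - P; set f2 := b2 - P.
pose D := det2 f1 f2.
have D0 : D != 0.
  apply/eqP => DE; apply: (col j); rewrite ji /collinear.
  by move: DE; rewrite /D /f1 /f2 /b1 /b2 /P /det2 /= => DE; lra.
have [a1 [a2 [ncol [a1f1 a1f2 a2f1 a2f2]]]] := dual_basis D0.
have EiP : edge V i P.
  by exists 0; rewrite ?subr0 ?scale1r ?scale0r ?addr0//= in_itv/= lexx ler01.
have [r r0 Hr] := small_ex (edges_near P).
have cone v : `|v| < r -> frontier A (P + v) ->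
    ~ in_cone a1 a2 v /\ ~ (dotp a1 v < 0 \/ dotp a2 v < 0).
  move=> vr /(Hr v vr)[k [EkP Ekv]].
  have [l l0 [E|E]] : exists2 l : R, 0 <= l & v = l *: f1 \/ v = l *: f2.
    have [ki|ki] := eqVneq k i.
      move: Ekv; rewrite ki => /edgeP[l /andP[l0 _] E]; exists l => //; left.
      by rewrite -(addKr P v) E addKr.
    have [[E|E] _] := simple k i ki P (conj EkP EiP).
      by case/eqP: ki; apply: injV; rewrite -E.
    have kj : k = j by apply: (can_inj (@ordSK n)); rewrite ji; apply: injV; rewrite -E.
    move: Ekv; rewrite kj => /edgeP[l /andP[l0 l1] E2]; exists (1 - l); first by rewrite subr_ge0.
    right; rewrite -(addKr P v) E2 ji -/P -/b2 /f2.
    by apply/injective_projections; rewrite /= /GRing.scale/=; ring.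
  - by rewrite /in_cone E !dotpZ a1f1 a2f1 mulr0 mulr1 ltxx andbF ltNge l0; split => // -[].
  - by rewrite /in_cone E !dotpZ a1f2 a2f2 mulr0 mulr1 ltxx [l < 0]ltNge l0; split => // -[].
have FP : frontier A P by exact: edge_frontier EiP.
have e1 : dotp a1 (f1 + f2) = 1 by rewrite dotpD a1f1 a1f2 addr0.
have e2 : dotp a2 (f1 + f2) = 1 by rewrite dotpD a2f1 a2f2 add0r.
have [s Hs] := one_side e1 e2 r0 cA regA FP cone.
exists a1, a2, s, b1, b2; split => //.
- by exists r => // t /andP[t0 tr] v vt; apply: Hs; exact: lt_trans tr.
- split; first exact: edge_frontier.
  move=> y [t /= t01 <-]; apply: (@edge_frontier j); exists (1 - t).
    by move: t01; rewrite /= !in_itv/=; lra.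
  by rewrite ji -/P -/b2 subKr addrC.
- split; [by exists (ordS i)|by exists j|by rewrite eq_sym chain_neq|].
  by rewrite -/b2 -/P /b2 /P -ji chain_neq.
Qed.

Lemma polygon_geometry :
  piece_geometry A [seq (V i, V (ordS i)) | i : 'I_n] [::] (codom V).
Proof.
split => //.
- move=> y; rewrite FA => -[i _ Ei]; left; exists (V i, V (ordS i)) => //.
  by apply/mapP; exists i; rewrite ?mem_enum.
- move=> ab /mapP[i _ ->] /=; split; [exact: codom_f|exact: codom_f|exact: chain_neq].
- move=> ab p /mapP[i _ ->] /= Ei np; apply: edge_half_plane => // j.
  by apply: contra np => /eqP <-; exact: codom_f.
move=> p /mapP[i _ ->].
have [a1 [a2 [s [b1 [b2 [H1 H2 H3 [[j1 E1] [j2 E2] H5 H6] H7]]]]]] := vertex_cone i.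
by exists a1, a2, s, b1, b2; split => //; split => //; rewrite ?E1 ?E2; exact: codom_f.
Qed.

End Polygon.
End Pieces.

Section Annulus.
Context {R : realType}.
Implicit Types (a b e p q v y P : R * R) (c : (R * R) * R) (A : set (R * R)).

Definition annulus (y0 : R * R) (r r' : R) : set (R * R) := [set y | r <= enorm (y - y0) <= r'].

(** A disc has no inner circle: for r = 0 the circle of radius 0 would be its centre, an interior
    point. *)
Definition annulus_circles (y0 : R * R) (r r' : R) : seq ((R * R) * R) :=
  (y0, r') :: if r == 0 then [::] else [:: (y0, r)].

Lemma dotpp_ge0 v : 0 <= dotp v v.
Proof. by rewrite addr_ge0// -expr2 sqr_ge0. Qed.

Lemma enorm_sqr v : enorm v ^+ 2 = dotp v v.
Proof. by rewrite sqr_sqrtr// dotpp_ge0. Qed.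

Lemma enorm_ge0 v : 0 <= enorm v.
Proof. exact: sqrtr_ge0. Qed.

Lemma circle_eq_le0 y0 (r : R) y : 0 <= r -> (circle_eq (y0, r) y <= 0) = (enorm (y - y0) <= r).
Proof. by move=> r0; rewrite /circle_eq subr_le0 -enorm_sqr ler_pXn2r// nnegrE enorm_ge0. Qed.

Lemma circle_eq_ge0 y0 (r : R) y : 0 <= r -> (0 <= circle_eq (y0, r) y) = (r <= enorm (y - y0)).
Proof. by move=> r0; rewrite /circle_eq subr_ge0 -enorm_sqr ler_pXn2r// nnegrE enorm_ge0. Qed.

Lemma circle_eqD c P v : circle_eq c (P + v) = circle_eq c P + 2 * dotp (P - c.1) v + dotp v v.
Proof. by rewrite /circle_eq /dotp /=; ring. Qed.

Lemma circle_near c P (w : R) : 0 < w ->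
  small (fun r => forall y, `|y - P| < r -> `|circle_eq c y - circle_eq c P| < w).
Proof.
move=> w0; apply: small_imp (smallI (small_lt ltr01) (small_linear (2 + 4 * `|P - c.1|) w0)).
move=> r r0 [r1 rw] y yr; set v := y - P in yr.
have -> : y = P + v by rewrite addrC subrK.
have -> : circle_eq c (P + v) - circle_eq c P = 2 * dotp (P - c.1) v + dotp v v.
  by rewrite circle_eqD; ring.
have H1 := dotp_bound (P - c.1) v; have H2 := dotp_bound v v.
rewrite (le_lt_trans (ler_normD _ _))// normrM ger0_norm//.
have N := normr_ge0 v; have M := normr_ge0 (P - c.1); have PM := mulr_ge0 M (ltW r0).
have : `|P - c.1| * `|v| <= `|P - c.1| * r by rewrite ler_wpM2l// ltW.
have : `|v| * `|v| <= r * 1 by rewrite ler_pM// ltW// (lt_trans yr).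
lra.
Qed.

Lemma circle_near_lt c P : circle_eq c P < 0 -> small (fun r => forall y, `|y - P| < r -> circle_eq c y < 0).
Proof.
move=> c0; have w0 : 0 < - circle_eq c P by rewrite oppr_gt0.
apply: small_imp (circle_near c P w0) => r _ H y /H.
by rewrite ltr_norml => /andP[_]; lra.
Qed.

Lemma circle_near_gt c P : 0 < circle_eq c P -> small (fun r => forall y, `|y - P| < r -> 0 < circle_eq c y).
Proof.
move=> c0; apply: small_imp (circle_near c P c0) => r _ H y /H.
by rewrite ltr_norml => /andP[+ _]; lra.
Qed.

Lemma avoid_closed A : (forall p, ~ A p -> small (fun r => forall y, `|y - p| < r -> ~ A y)) -> closed A.
Proof.
move=> H p /closure_ball cp; apply: contrapT => /H/small_ex[r r0 rA].
by have [y Ay yr] := cp r r0; exact: rA Ay.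
Qed.

Section OneAnnulus.
Variables (y0 : R * R) (r r' : R).
Hypotheses (r0 : 0 <= r) (rr : r < r').
Let A := annulus y0 r r'.

Let r'0 : 0 < r'. Proof. exact: le_lt_trans rr. Qed.

Lemma annulusE y : A y <-> circle_eq (y0, r') y <= 0 /\ 0 <= circle_eq (y0, r) y.
Proof.
rewrite circle_eq_le0 ?(ltW r'0)// circle_eq_ge0// /A /annulus /=.
by split=> [/andP[]//|[-> ->]].
Qed.

Lemma annulus_closed : closed A.
Proof.
apply: avoid_closed => p nA.
have [H|H] := leP (circle_eq (y0, r') p) 0; last first.
  apply: small_imp (circle_near_gt H) => t _ K y /K C /annulusE[]; lra.
have [H2|H2] := leP 0 (circle_eq (y0, r) p); first by case: nA; apply/annulusE.
by apply: small_imp (circle_near_lt H2) => t _ K y /K C /annulusE[]; lra.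
Qed.

Lemma annulus_geometry : piece_geometry A [::] (annulus_circles y0 r r') [::].
Proof.
have incs c : c \in annulus_circles y0 r r' -> c = (y0, r') \/ r != 0 /\ c = (y0, r).
  rewrite inE => /orP[/eqP ->|]; first by left.
  by case: eqVneq => // rn0; rewrite inE => /eqP ->; right.
split => //.
- exact: annulus_closed.
- move=> y Fy; right; have Ay := closed_frontier_sub annulus_closed Fy.
  have [H1 H2] := (annulusE y).1 Ay.
  move: H1; rewrite le_eqVlt => /orP[/eqP H1|H1].
    by exists (y0, r') => //; rewrite inE eqxx.
  have [E|H3] : circle_eq (y0, r) y = 0 /\ r != 0 \/ small (fun t => forall z, `|z - y| < t -> 0 <= circle_eq (y0, r) z).
    have [->|rn0] := eqVneq r 0.
      by right; apply: smallW => t t0 z _; rewrite circle_eq_ge0// enorm_ge0.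
    move: H2; rewrite le_eqVlt => /orP[/eqP H2|H2]; first by left.
    by right; apply: small_imp (circle_near_gt H2) => t _ K z /K/ltW.
    by exists (y0, r); [rewrite /annulus_circles (negbTE E.2) !inE eqxx orbT|exact: E.1].
  case: Fy => _ []; apply/interior_ball.
  have [t t0 [K1 K2]] := small_ex (smallI (circle_near_lt H1) H3).
  by exists t => // z zt; apply/annulusE; split; [rewrite ltW// K1|exact: K2].
- by move=> c /incs[->//|[rn0 ->]] /=; rewrite lt_neqAle eq_sym rn0.
move=> c /incs[->|[rn0 ->]].
  exists true => P EP; have H : 0 < circle_eq (y0, r) P.
    have : 0 < r' ^+ 2 - r ^+ 2 by rewrite subr_gt0 ltr_pXn2r// nnegrE ltW.
    by move: EP; rewrite /circle_eq /=; lra.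
  apply: small_imp (circle_near_gt H) => t _ K y /K C.
  by split=> [/annulusE[]//|H1]; apply/annulusE; split => //; exact: ltW.
exists false => P EP; have H : circle_eq (y0, r') P < 0.
  have : 0 < r' ^+ 2 - r ^+ 2 by rewrite subr_gt0 ltr_pXn2r// nnegrE ltW.
  by move: EP; rewrite /circle_eq /=; lra.
apply: small_imp (circle_near_lt H) => t _ K y /K C.
by split=> [/annulusE[]//|H1]; apply/annulusE; split => //; exact: ltW.
Qed.

End OneAnnulus.

(* Near P the quadratic part of circle_eq c is dominated by its linear part, off
   a thin cone around the tangent line. *)
Lemma circle_cone c P (w : R) : circle_eq c P = 0 -> 0 < w ->
  small (fun r => forall v, `|v| < r -> w * `|v| < `|dotp (P - c.1) v| ->
    (circle_eq c (P + v) <= 0) = ~~ (0 < dotp (P - c.1) v) /\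
    (0 <= circle_eq c (P + v)) = (0 < dotp (P - c.1) v)).
Proof.
move=> EP w0; apply: small_imp (small_lt w0) => r r0 rw v vr.
rewrite circle_eqD EP add0r; set D := dotp _ v => wD.
have H1 := dotpp_ge0 v; have := dotp_bound v v; rewrite ger0_norm// => H2.
have N := normr_ge0 v; have H3 : `|v| * `|v| <= w * `|v| by rewrite ler_wpM2r// ltW// (lt_trans vr).
have [D0|D0|D0] := ltrgt0P D.
- by split; [apply/negbTE|]; rewrite -?ltNge; lra.
- by rewrite ltr0_norm// in wD; split; [|apply/negbTE; rewrite -ltNge]; lra.
by move: wD; rewrite D0 normr0 ltNge mulr_ge0// ltW.
Qed.

End Annulus.

(** * From the pieces to the whole region *)

Section Assembly.
Context {R : realType} (n : nat) (Om : 'I_n -> set (R * R)) (u : R * R -> R).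
Implicit Types (a b e p q v y P : R * R) (c : (R * R) * R).
Variables (es : 'I_n -> seq ((R * R) * (R * R))) (cs : 'I_n -> seq ((R * R) * R))
  (vs : 'I_n -> seq (R * R)).
Hypotheses (rs : rsource Om u)
  (pg : forall m, piece_geometry (Om m) (es m) (cs m) (vs m)).

Lemma region_local m p : Om m p -> small (fun r => forall v, `|v| < r ->
  (region Om (p + v) <-> Om m (p + v))).
Proof.
move=> mp; apply: small_imp (rs_near rs p) => r _ H v vr; split; last by exists m.
move=> [m' m'v]; have m'p := H m' (p + v).
by rewrite (rs_disj rs mp (m'p _ m'v))// addrC addKr.
Qed.

Lemma off_region p : ~ region Om p -> small (fun r => forall v, `|v| < r -> ~ region Om (p + v)).
Proof.
move=> np; apply: small_imp (rs_near rs p) => r _ H v vr [m mv].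
by apply: np; exists m; apply: (H m (p + v)); rewrite // addrC addKr.
Qed.

Lemma circle_sub m c P : c \in cs m -> circle_eq c P = 0 -> Om m P.
Proof.
move=> ccs EP; have [outer H] := pg_side (pg m) ccs.
have [r r0 K] := small_ex (H P EP); apply/K; first by rewrite subrr normr0.
by rewrite EP; case: outer {H K}.
Qed.

Lemma vertex_frontier m p : p \in vs m -> frontier (Om m) p.
Proof.
move=> /(pg_vertex (pg m))[a1 [a2 [s [b1 [b2 [_ _ [H _] _ _]]]]]].
apply: H; exists 0; first by rewrite /= in_itv/= lexx ler01.
by rewrite subr0 scale1r scale0r addr0.
Qed.

Lemma assembled_geometry : geometry Om (flatten [seq es m | m : 'I_n])
  (flatten [seq cs m | m : 'I_n]) [set p | p \in flatten [seq vs m | m : 'I_n]].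
Proof.
have mem (T : eqType) (F : 'I_n -> seq T) z : z \in flatten [seq F m | m : 'I_n] <-> exists m, z \in F m.
  split=> [/flattenP[s /mapP[m _ ->] zm]|[m zm]]; first by exists m.
  by apply/flattenP; exists (F m) => //; apply/mapP; exists m; rewrite ?mem_enum.
have sub (p : R * R) y : p + (y - p) = y by rewrite addrC subrK.
split.
- move=> m y /(pg_cover (pg m))[[ab abm s]|[c cm s]]; [left; exists ab|right; exists c] => //;
    by apply/mem; exists m.
- by move=> c /mem[m cm]; exact: pg_pos (pg m) _ cm.
- move=> c /mem[m cm]; have [outer H] := pg_side (pg m) cm; exists outer => P EP.
  apply: small_imp (smallI (H P EP) (region_local (circle_sub cm EP))) => r _ [K1 K2] y yr.
  by have := K2 (y - P) yr; rewrite sub => ->; exact: K1.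
- move=> ab /mem[m abm]; have [H1 H2 H3] := pg_edge (pg m) abm.
  by split => //; apply/mem; exists m.
- move=> p d nV d0 He Hc.
  have DD := dotpp_gt0 d0.
  (* With cp = cm the functional is arbitrary up to transversality, and d itself is transversal to
     d. *)
  have interior_smooth (b : bool) : small (fun r => forall v, `|v| < r -> `[< region Om (p + v) >] = b) -> smooth_at Om d p.
    move=> H; exists d, b, b; split; first by rewrite gt_eqF.
    move=> w _; apply: small_imp H => r _ H y yr _ _; rewrite if_same.
    by rewrite -{1}(sub p y) H.
  have [[m mp]|np] := pselect (region Om p); last first.
    apply: (interior_smooth false); apply: small_imp (off_region np) => r _ H v vr.
    by apply/asboolP; exact: H.
  have loc := region_local mp.
  have [Fp|Fp] := pselect (frontier (Om m) p); last first.
    have /interior_ball[r r0 rI] := closed_frontier (rs_closed rs (m := m)) mp Fp.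
    apply: (interior_smooth true); exists r => // t /andP[t0 tr] v vt.
    by apply/asboolP; exists m; apply: rI; rewrite addrC addKr (lt_trans vt).
  have half a (s : bool) : dotp a d != 0 -> (forall w, 0 < w -> small (fun r => forall v,
        `|v| < r -> w * `|v| < `|dotp a v| -> `[< Om m (p + v) >] = if 0 < dotp a v then s else ~~ s)) ->
      smooth_at Om d p.
    move=> ad H; exists a, s, (~~ s); split => // w w0.
    apply: small_imp (smallI (H w w0) loc) => r _ [K1 K2] y yr wy _.
    rewrite andbb -{1}(sub p y) -K1//; apply: asbool_equiv_eq; exact: K2.
  have [[ab abm sp]|[c cm cp]] := pg_cover (pg m) Fp.
    have np : p \notin vs m by apply/negP => pm; apply: nV; apply/mem; exists m.
    have [a [s [a0 aD H]]] := pg_half_plane (pg m) abm sp np.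
    apply: (half a s).
      apply/negP => /eqP ad; have := He ab _ sp; set D := ab.2 - ab.1 in aD *.
      move=> /(_ ltac:(by apply/mem; exists m))/negP; apply.
      have : dotp a a * det2 D d = 0.
        transitivity (dotp a D * det2 a d - dotp a d * det2 a D); first by rewrite /dotp /det2; ring.
        by rewrite aD ad !mul0r subr0.
      by move=> /eqP; rewrite mulf_eq0 gt_eqF ?dotpp_gt0.
    move=> w w0; apply: small_imp H => r _ K v vr wv; apply: (K v vr).2.
    by rewrite -normr_gt0 (le_lt_trans _ wv)// mulr_ge0// ltW.
  have [outer H] := pg_side (pg m) cm.
  apply: (half (p - c.1) (~~ outer)); first by apply: Hc => //; apply/mem; exists m.
  move=> w w0; apply: small_imp (smallI (H p cp) (circle_cone cp w0)) => r _ [K1 K2] v vr wv.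
  have [E1 E2] := K2 v vr wv.
  have K := K1 (p + v); rewrite [p + v - p]addrC addKr in K.
  rewrite (asbool_equiv_eq (K vr)); case: outer {H K K1}; rewrite asboolb ?E1 ?E2; case: (0 < _) => //.
move=> p /mem[m pm].
have [a1 [a2 [s [b1 [b2 [H1 H2 _ [H3 H4 H5 H6] H7]]]]]] := pg_vertex (pg m) pm.
exists a1, a2, s, (~~ s), b1, b2; split => //; first by case: s {H2}.
  move=> w w0; have mp := closed_frontier_sub (rs_closed rs (m := m)) (vertex_frontier pm).
  apply: small_imp (smallI H2 (region_local mp)) => r _ [K1 K2] y yr wy1 wy2.
  have nz a : w * `|y - p| < `|dotp a (y - p)| -> dotp a (y - p) != 0.
    by move=> wy; rewrite -normr_gt0 (le_lt_trans _ wy)// mulr_ge0// ltW.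
  rewrite -{1}(sub p y) (asbool_equiv_eq (K2 _ yr)) K1//; exact: nz.
by split => //; apply/mem; exists m.
Qed.

End Assembly.

(** * Corners of the support *)

Section Corners.
Context {R : realType}.
Implicit Types (a b e p q v w y z P nu : R * R) (c : (R * R) * R) (A B : set (R * R)).

Lemma near_right_small (P : R -> Prop) : (\forall t \near 0^'+, P t) <-> small P.
Proof.
rewrite near_withinE; split=> [/nbhs_ballP[r /= r0 H]|[r r0 H]].
  exists r => // t /andP[t0 tr]; apply: H => //.
  by rewrite -ball_normE/= sub0r normrN gtr0_norm.
apply/nbhs_ballP; exists r => //= t; rewrite -ball_normE/= sub0r normrN => tr t0.
by apply: H; rewrite t0 -(gtr0_norm t0).
Qed.

Lemma near_small p (P : R * R -> Prop) : (\forall y \near p, P y) <->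
  small (fun r => forall y, `|y - p| < r -> P y).
Proof.
rewrite near_ball; split=> [[r r0 H]|/small_ex[r r0 H]]; last by exists r.
by exists r => // t /andP[_ tr] y yt; apply: H; exact: lt_trans tr.
Qed.

Lemma small_direction p v (P : R * R -> Prop) : (\forall y \near p, P y) -> small (fun t => P (p + t *: v)).
Proof.
move=> /near_ball[r r0 H]; apply: small_imp (small_linear `|v| r0) => t t0 tr.
by apply: H; rewrite addrC addKr normrZ gtr0_norm// mulrC.
Qed.

Lemma agree_frontier A B y : (\forall z \near y, A z <-> B z) -> frontier A y -> frontier B y.
Proof.
move=> AB [cA iA]; split.
  move=> U Uy; have [z [Az [ABz Uz]]] := cA _ (filterI AB Uy).
  by exists z; split => //; apply/ABz.
move=> iB; apply: iA; apply: filterS2 AB iB => z ABz Bz; exact/ABz.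
Qed.

Lemma agree_outer_normal A B z nu : (\forall y \near z, A y <-> B y) ->
  outer_normal A z nu -> outer_normal B z nu.
Proof.
move=> AB [H1 H2 /near_right_small H3]; split => //.
  move=> eps e0; apply: filterS2 (near_join AB) (H2 eps e0) => w ABw H FB.
  by apply: H; apply: agree_frontier FB; apply: filterS ABw => y; tauto.
apply/near_right_small.
have ABn := small_direction nu AB; have ABm := small_direction (- nu) AB.
apply: small_imp (smallI H3 (smallI ABn ABm)) => t _ [[nA Am] [E1 E2]].
by move: E2; rewrite scalerN => E2; split; [move/E1|apply/E2].
Qed.

Lemma agree_normal_continuous A B p : (\forall y \near p, A y <-> B y) ->
  normal_continuous_at A p -> normal_continuous_at B p.
Proof.
move=> AB [nu [H1 H2]]; exists nu; split.
  apply: filterS2 (near_join AB) H1 => z ABz H FB.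
  apply: agree_outer_normal (ABz) (H _); apply: agree_frontier FB.
  by apply: filterS ABz => y; tauto.
apply: cvg_trans H2; apply: cvg_app => P; rewrite /= /within /= => HP.
apply: filterS2 (near_join AB) HP => z ABz H FB; apply: H; apply: agree_frontier FB.
by apply: filterS ABz => y; tauto.
Qed.

Lemma enorm1 v : dotp v v = 1 -> enorm v = 1.
Proof. by rewrite /enorm => ->; rewrite sqrtr1. Qed.

Lemma enorm_le v : enorm v <= 2 * `|v|.
Proof.
rewrite -ler_sqr ?nnegrE ?enorm_ge0 ?mulr_ge0// enorm_sqr exprMn.
have := dotp_bound v v; rewrite ger0_norm ?dotpp_ge0// => H; apply: le_trans H _.
by rewrite expr2 -!mulrA ler_pM2l// expr2; have := mulr_ge0 (normr_ge0 v) (normr_ge0 v); lra.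
Qed.

Lemma half_plane_normal A p a s : a != 0 -> half_plane A p a s -> normal_continuous_at A p.
Proof.
move=> a0 H; have aa := dotpp_gt0 a0.
(* The sign makes the unit vector [k *: a] point away from A, which lies on the side a > 0 exactly
   when s holds. *)
pose k : R := (if s then -1 else 1) / enorm a.
have ea : 0 < enorm a by rewrite sqrtr_gt0.
exists (fun=> k *: a); split; last exact: cvg_cst.
have [r r0 Hr] := small_ex H.
apply/near_ball; exists r => // z zr Fz.
have rz : 0 < r - `|z - p| by rewrite subr_gt0.
have az : dotp a (z - p) = 0 by apply: (Hr _ zr).1; rewrite addrC subrK.
have near_z y : `|y - z| < r - `|z - p| -> `|y - p| < r.
  move=> yz; rewrite -(subrK z y) -addrA (le_lt_trans (ler_normD _ _))//; lra.
split.
- apply: enorm1; rewrite dotpZ dotpC dotpZ /k -enorm_sqr.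
  by case: s {H Hr k}; field; rewrite gt_eqF.
- move=> eps e0; apply/near_ball; exists (r - `|z - p|) => // w /near_z wr Fw.
  have aw : dotp a (w - p) = 0 by apply: (Hr _ wr).1; rewrite addrC subrK.
  rewrite dotpZ dotpC (_ : w - z = (w - p) - (z - p)); last by rewrite opprB addrA subrK.
  by rewrite dotpB az aw subrr mulr0 normr0 mulr_ge0 ?enorm_ge0// ltW.
apply/near_right_small.
have near1 v : small (fun t => `|z + t *: v - p| < r).
  have : \forall y \near z, `|y - p| < r by apply/near_ball; exists (r - `|z - p|).
  exact: small_direction.
apply: small_imp (smallI (near1 (k *: a)) (near1 (- (k *: a)))) => t t0 [Hp Hm].
have ka : 0 < dotp a a / enorm a by rewrite divr_gt0.
have E1 : dotp a (z + t *: (k *: a) - p) = t * (k * dotp a a).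
  by rewrite addrAC dotpD az add0r !dotpZ.
have E2 : dotp a (z + t *: - (k *: a) - p) = - (t * (k * dotp a a)).
  by rewrite addrAC dotpD az add0r dotpZ dotpN dotpZ mulrN.
have tk : t * (k * dotp a a) = (if s then -1 else 1) * (t * (dotp a a / enorm a)).
  by rewrite /k; case: (s); field; rewrite gt_eqF.
have tka := mulr_gt0 t0 ka.
rewrite -scalerN; have := (Hr _ Hp).2; have := (Hr _ Hm).2.
rewrite E1 E2 tk oppr_eq0 ![p + _]addrC !subrK.
move: k tk E1 E2 Hp Hm near1 => k _ _ _ _ _ _; case: s {H Hr} => /=.
  rewrite mulN1r opprK oppr_eq0 tka (gt_eqF tka) oppr_gt0 ltNge (ltW tka)/=.
  by move=> /(_ isT) Em /(_ isT) Ep; split; apply/asboolP; rewrite ?Em// asbool_neg Ep.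
rewrite mul1r tka (gt_eqF tka) oppr_gt0 ltNge (ltW tka)/=.
by move=> /(_ isT) Em /(_ isT) Ep; split; apply/asboolP; rewrite ?Em// asbool_neg Ep.
Qed.

Lemma circle_normal A p c (outer : bool) : closed A -> 0 < c.2 -> circle_eq c p = 0 ->
  (forall P, circle_eq c P = 0 -> \forall y \near P,
    (A y <-> (if outer then circle_eq c y <= 0 else 0 <= circle_eq c y))) ->
  normal_continuous_at A p.
Proof.
move=> cA c0 cp side.
pose k : R := (if outer then 1 else -1) / c.2.
exists (fun z => k *: (z - c.1)); split; last first.
  apply: cvg_within_filter.
  apply: (@continuous_comp _ _ _ (fun z : R * R => z - c.1) (fun z => k *: z)).
    by apply: cvgB; [exact: cvg_id|exact: cvg_cst].
  exact: scaler_continuous.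
(* Near p the set A is given by the sign of [circle_eq c]; a point of A where this sign is strict is
   interior. *)
have on_circle : \forall z \near p, frontier A z -> circle_eq c z = 0.
  apply: filterS (near_join (side p cp)) => z Az Fz.
  have zA := (nbhs_singleton Az).1 (closed_frontier_sub cA Fz).
  apply: contrapT => /eqP nz; case: Fz => _ []; case: outer {side k} Az zA => Az zA.
    have z0 : circle_eq c z < 0 by rewrite lt_neqAle nz.
    apply: filterS2 Az ((near_small _ _).2 (circle_near_lt z0)) => y Ay y0.
    by apply/Ay/ltW.
  have z0 : 0 < circle_eq c z by rewrite lt_neqAle eq_sym nz.
  apply: filterS2 Az ((near_small _ _).2 (circle_near_gt z0)) => y Ay y0.
  by apply/Ay/ltW.
apply: filterS (near_join on_circle) => z Fz_near Fz.
have z0 : circle_eq c z = 0 by exact: nbhs_singleton Fz_near _.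
have zz : dotp (z - c.1) (z - c.1) = c.2 ^+ 2 by apply/eqP; rewrite -subr_eq0; apply/eqP.
have k2 : k ^+ 2 * c.2 ^+ 2 = 1.
  by rewrite /k; case: outer {side k}; field; rewrite gt_eqF.
split.
- by apply: enorm1; rewrite dotpZ dotpC dotpZ zz mulrA -expr2.
- move=> eps e0; have m0 : 0 < c.2 * eps by rewrite mulr_gt0.
  have near_z : \forall w \near z, `|w - z| < c.2 * eps by apply/near_ball; exists (c.2 * eps).
  apply: filterS2 Fz_near near_z => w Fw wz FAw; have := Fw FAw; set v := w - z in wz *.
  have -> : w = z + v by rewrite addrC subrK.
  rewrite circle_eqD z0 add0r => E.
  (* For two points z and z + v of the circle, 2 (z - c.1) . v = - |v|^2, so the distance to the
     tangent line is quadratic in |v|. *)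
  have -> : dotp v (k *: (z - c.1)) = - (k / 2 * enorm v ^+ 2).
    have -> : enorm v ^+ 2 = - (2 * dotp v (z - c.1)) by rewrite enorm_sqr (dotpC v (z - c.1)); lra.
    by rewrite dotpZ; field.
  rewrite normrN normrM (ger0_norm (x := enorm v ^+ 2)) ?exprn_ge0 ?enorm_ge0// expr2 mulrA.
  apply: ler_wpM2r; first exact: enorm_ge0.
  have -> : `|k / 2| = (2 * c.2)^-1.
    rewrite /k normrM normrM (_ : `|_ : R| = 1) ?mul1r; last by case: (outer); rewrite ?normrN1 ?normr1.
    by rewrite !gtr0_norm ?invr_gt0// -invfM mulrC.
  rewrite mulrC ler_pdivrMr ?mulr_gt0//; have := enorm_le v; lra.
apply/near_right_small.
have Az v := small_direction v (side z z0).
have t2 : small (fun t => t < 2 * c.2) by apply: small_lt; rewrite mulr_gt0.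
apply: small_imp (smallI t2 (smallI (Az (k *: (z - c.1))) (Az (- (k *: (z - c.1)))))).
move=> t t0 [tc [Ep Em]]; rewrite -scalerN Ep Em !circle_eqD z0 !add0r.
set w := z - c.1 in zz *.
have -> : dotp w (t *: (k *: w)) = t * (k * c.2 ^+ 2) by rewrite !dotpZ zz.
have -> : dotp (t *: (k *: w)) (t *: (k *: w)) = t ^+ 2.
  by rewrite dotpZ dotpC dotpZ !(dotpZ, dotpC (k *: w) w) zz -[RHS]mulr1 -k2; ring.
have -> : dotp w (t *: - (k *: w)) = - (t * (k * c.2 ^+ 2)) by rewrite dotpZ dotpN dotpZ zz mulrN.
have -> : dotp (t *: - (k *: w)) (t *: - (k *: w)) = t ^+ 2.
  rewrite scalerN dotpN dotpC dotpN opprK.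
  by rewrite dotpZ dotpC dotpZ !(dotpZ, dotpC (k *: w) w) zz -[RHS]mulr1 -k2; ring.
have tc0 : 0 < t * c.2 by rewrite mulr_gt0.
have t2' : 0 < t ^+ 2 by rewrite exprn_gt0.
have t22 : t ^+ 2 < 2 * (t * c.2).
  have : 0 < t * (2 * c.2 - t) by rewrite mulr_gt0// subr_gt0.
  by rewrite expr2; lra.
have -> : k * c.2 ^+ 2 = (if outer then 1 else -1) * c.2.
  by rewrite /k expr2 mulrA divfK// gt_eqF.
by case: (outer); split; [move=> H|..]; lra.
Qed.
End Corners.

Section CornersOfRegion.
Context {R : realType} (n : nat) (Om : 'I_n -> set (R * R)) (u : R * R -> R).
Implicit Types (a b e p q v y P nu : R * R) (c : (R * R) * R).
Variables (es : 'I_n -> seq ((R * R) * (R * R))) (cs : 'I_n -> seq ((R * R) * R))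
  (vs : 'I_n -> seq (R * R)).
Hypotheses (rs : rsource Om u)
  (pg : forall m, piece_geometry (Om m) (es m) (cs m) (vs m)).

Lemma region_near m p : Om m p -> \forall y \near p, Om m y <-> region Om y.
Proof.
move=> mp; apply/near_small; apply: small_imp (region_local rs mp) => r _ H y yr.
by have := H (y - p) yr; rewrite addrC subrK; tauto.
Qed.

Lemma frontier_region m p : frontier (Om m) p -> frontier (region Om) p.
Proof.
move=> Fp; have mp := closed_frontier_sub (rs_closed rs (m := m)) Fp.
exact: agree_frontier (region_near mp) Fp.
Qed.

Lemma region_frontier p : frontier (region Om) p -> exists m, frontier (Om m) p.
Proof.
move=> Fp; have cl : closed (region Om).
  apply: avoid_closed => q /(off_region rs); apply: small_imp => r _ H y yr.
  by have := H (y - q) yr; rewrite addrC subrK.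
have [m mp] := closed_frontier_sub cl Fp; exists m; apply: agree_frontier Fp.
by apply: filterS (region_near mp) => y; tauto.
Qed.

Lemma perp_det2_eq0 nu a b : nu != 0 -> dotp nu a = 0 -> dotp nu b = 0 -> det2 a b = 0.
Proof.
move=> nu0 na nb; have : dotp nu nu * det2 a b = 0.
  transitivity (dotp nu a * det2 nu b - dotp nu b * det2 nu a); first by rewrite /dotp /det2; ring.
  by rewrite na nb !mul0r subr0.
by move=> /eqP; rewrite mulf_eq0 gt_eqF ?dotpp_gt0//= => /eqP.
Qed.

(** The tangency condition at the points p + t (b - p) of the frontier bounds the scalar product by
    eps |b - p|, for every eps. *)
Lemma outer_normal_segment A p b nu : outer_normal A p nu -> segment p b `<=` frontier A ->
  dotp (b - p) nu = 0.
Proof.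
move=> [_ H _] sF; have E0 := enorm_ge0 (b - p).
apply/eqP; rewrite -normr_le0; apply/ler_addgt0Pr => w w0; rewrite add0r.
pose eps := w / (enorm (b - p) + 1).
have e0 : 0 < eps by rewrite divr_gt0// ltr_wpDl.
have [t t0 [Ht t1]] := small_ex (smallI (small_direction (b - p) (H eps e0)) (small_lt ltr01)).
have ts : segment p b (p + t *: (b - p)).
  exists t; first by rewrite /= in_itv/= (ltW t0) ltW.
  by apply/injective_projections; rewrite /= /GRing.scale/=; ring.
have := Ht (sF _ ts); rewrite addrC addKr dotpC dotpZ normrM gtr0_norm// dotpC.
have -> : enorm (t *: (b - p)) = t * enorm (b - p).
  rewrite /enorm dotpZ dotpC dotpZ mulrA -expr2 sqrtrM ?sqr_ge0// sqrtr_sqr gtr0_norm//.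
rewrite mulrCA ler_pM2l// => K; apply: le_trans K _.
by rewrite /eps mulrAC ler_pdivrMr ?ltr_wpDl// ler_pM2l// lerDl.
Qed.

(** At a vertex a normal fails even to exist: it would be orthogonal to both edges, hence parallel
    to a1 and to a2, which are not collinear. *)
Lemma corners_region : corners (region Om) = [set p | p \in flatten [seq vs m | m : 'I_n]].
Proof.
apply/seteqP; split=> p.
  move=> [Fp nn]; have [m Fm] := region_frontier Fp.
  have mp := closed_frontier_sub (rs_closed rs (m := m)) Fm.
  apply: contrapT => np; apply: nn; apply: (agree_normal_continuous (region_near mp)).
  have npm : p \notin vs m.
    apply/negP => pm; apply: np; apply/flattenP; exists (vs m) => //.
    by apply/mapP; exists m; rewrite ?mem_enum.
  have [[ab abm sp]|[c cm cp]] := pg_cover (pg m) Fm.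
    have [a [s [a0 _ H]]] := pg_half_plane (pg m) abm sp npm.
    exact: half_plane_normal H.
  have [outer H] := pg_side (pg m) cm.
  apply: (circle_normal (outer := outer) (pg_closed (pg m)) (pg_pos (pg m) cm) cp) => P cP.
  by apply/near_small; exact: H.
move=> /flattenP[s /mapP[m _ ->] pm]; split.
  exact: frontier_region (vertex_frontier pg pm).
move=> [nu [/nbhs_singleton/(_ (frontier_region (vertex_frontier pg pm))) N _]].
have [a1 [a2 [s' [b1 [b2 [ncol _ [F1 F2] [_ _ b1p b2p] [a1b a2b]]]]]]] := pg_vertex (pg m) pm.
have n1 := outer_normal_segment N (subset_trans F1 (@frontier_region m)).
have n2 := outer_normal_segment N (subset_trans F2 (@frontier_region m)).
rewrite -subr_eq0 in b1p; rewrite -subr_eq0 in b2p.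
set w := nu p in N n1 n2.
have nu0 : w != 0.
  apply/eqP => E; have [+ _ _] := N; rewrite E /enorm /dotp /= !mul0r addr0 sqrtr0 => /eqP.
  by rewrite eq_sym oner_eq0.
have D1 : det2 w a1 = 0 by apply: perp_det2_eq0 b2p n2 _; rewrite dotpC.
have D2 : det2 w a2 = 0 by apply: perp_det2_eq0 b1p n1 _; rewrite dotpC.
apply: ncol; apply/eqP; rewrite -subr_eq0; apply/eqP.
have nn := dotpp_gt0 nu0; apply: (mulfI (lt0r_neq0 nn)); rewrite mulr0.
transitivity (dotp w a1 * det2 w a2 - dotp w a2 * det2 w a1); first by rewrite /dotp /det2; ring.
by rewrite D1 D2 !mulr0 subr0.
Qed.

End CornersOfRegion.

(** * Counting exceptional directions *)

Section Counting.
Context {R : realType}.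
Implicit Types (p q v w y P : R * R) (c : (R * R) * R).

(** Double counting: if each i satisfied some r, the cardinals would add up to at least that of
    I. *)
Lemma exists_all_avoid (I : finType) (rs : seq (pred I)) :
  (\sum_(r <- rs) #|r| < #|I|)%N -> exists i, all (fun r : pred I => ~~ r i) rs.
Proof.
move=> H; apply: contrapT => nex; move: H; rewrite ltnNge => /negP; apply.
have H i : (1 <= \sum_(r <- rs) r i)%N.
  rewrite lt0n; apply/negP => /eqP S0; apply: nex; exists i.
  elim: rs S0 => //= r rs IH; rewrite big_cons => /eqP.
  by rewrite addn_eq0 eqb0 => /andP[-> /eqP/IH].
have : (\sum_(i : I) 1 <= \sum_(i : I) \sum_(r <- rs) r i)%N by apply: leq_sum => i _; exact: H.
rewrite sum1_card => /leq_trans; apply.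
elim: rs {nex H} => [|r rs IH]; first by rewrite big1// => i _; rewrite big_nil.
under eq_bigr do rewrite big_cons.
rewrite big_split big_cons /= leq_add//; apply: eq_leq.
by rewrite -sum1_card [RHS]big_mkcond; apply: eq_bigr => i _; rewrite -[i \in _]/(r i); case: (r i).
Qed.

Lemma card_two_values (I : finType) (A : pred I) (g : I -> R) (D : R) :
  {in A &, injective g} -> (forall i, A i -> g i ^+ 2 = D) -> (#|A| <= 2)%N.
Proof.
move=> injg gD; case: (pickP A) => [i0 Ai0|A0]; last by rewrite eq_card0.
have one (b : R) : (#|[pred i | A i && (g i == b)]| <= 1)%N.
  apply/card_le1P => i; rewrite inE => /andP[Ai /eqP gi] j; rewrite !inE.
  apply/idP/idP => [/andP[Aj /eqP gj]|/eqP ->]; last by rewrite Ai gi eqxx.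
  by apply/eqP; apply: injg => //; rewrite gi gj.
apply: leq_trans (leq_add (one (g i0)) (one (- g i0))).
rewrite -cardUI; apply: leq_trans (leq_addr _ _).
apply/subset_leq_card/fintype.subsetP => i; rewrite -[i \in A]/(A i) => Ai; rewrite !inE Ai/=.
by rewrite -eqf_sqr (gD i Ai) (gD i0 Ai0).
Qed.

Lemma dot_det_inj w v v' : w != 0 -> dotp w v = dotp w v' -> det2 w v = det2 w v' -> v = v'.
Proof.
move=> w0 E1 E2; have ww := dotpp_gt0 w0.
apply/injective_projections; apply: (mulfI (lt0r_neq0 ww)).
  transitivity (w.1 * dotp w v - w.2 * det2 w v); first by rewrite /dotp /det2; ring.
  by rewrite E1 E2 /dotp /det2; ring.
transitivity (w.2 * dotp w v + w.1 * det2 w v); first by rewrite /dotp /det2; ring.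
by rewrite E1 E2 /dotp /det2; ring.
Qed.

Lemma dot_det_sqr w v : det2 w v ^+ 2 = dotp w w * dotp v v - dotp w v ^+ 2.
Proof. by rewrite /dotp /det2; ring. Qed.

Section Directions.
Variables (I : finType) (eta : I -> R * R).
Hypothesis eta1 : forall i, dotp (eta i) (eta i) = 1.

(** A line meets the unit circle in at most two points: the scalar product with w being t, the
    determinant has a prescribed square and determines the vector. *)
Lemma card_directions w (t : R) : injective eta -> w != 0 ->
  (#|[pred i | dotp w (eta i) == t]| <= 2)%N.
Proof.
move=> inj w0; apply: (@card_two_values _ _ (fun i => det2 w (eta i)) (dotp w w - t ^+ 2)).
  move=> i j; rewrite !inE => /eqP Ei /eqP Ej E; apply: inj.
  by apply: dot_det_inj w0 _ E; rewrite Ei Ej.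
by move=> i /eqP E; rewrite dot_det_sqr eta1 mulr1 E.
Qed.

Lemma concentric_not_tangent i c c' : 0 < c.2 -> 0 < c'.2 -> c'.1 = c.1 -> c' != c ->
  ~ tangent (eta i) c' (dotp (eta i) c.1 - c.2).
Proof.
move=> c0 c'0 E /eqP ne; rewrite /tangent E eta1 mul1r addrAC subrr add0r sqrrN => /eqP.
rewrite eqf_sqr => /orP[] /eqP E2; last by lra.
by apply: ne; apply/injective_projections.
Qed.

(** Tangency means that the scalar product of the unit vector with c.1 - c'.1 is c.2 + c'.2 or c.2 -
    c'.2, each value being taken at most twice. *)
Lemma card_tangent c c' : injective eta -> 0 < c.2 -> 0 < c'.2 -> c' != c ->
  (#|[pred i | `[< tangent (eta i) c' (dotp (eta i) c.1 - c.2) >]]| <= 4)%N.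
Proof.
move=> inj c0 c'0 ne; have [E|nE] := eqVneq c'.1 c.1.
  rewrite eq_card0// => i; rewrite inE; apply/asboolP; exact: concentric_not_tangent.
have w0 : c.1 - c'.1 != 0 by rewrite subr_eq0 eq_sym.
have two t := card_directions t inj w0.
apply: leq_trans (leq_add (two (c.2 + c'.2)) (two (c.2 - c'.2))).
rewrite -cardUI; apply: leq_trans (leq_addr _ _).
apply/subset_leq_card/fintype.subsetP => i; rewrite !inE.
rewrite /tangent eta1 mul1r dotpC => /eqP; rewrite eqf_sqr (dotpC (eta i) c'.1) => /orP[] /eqP E.
  by apply/orP; left; rewrite dotpC dotpB ![dotp (eta i) _]dotpC; apply/eqP; lra.
by apply/orP; right; rewrite dotpC dotpB ![dotp (eta i) _]dotpC; apply/eqP; lra.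
Qed.

Hypothesis noncol : forall i j, i != j -> ~ collinear (eta i) (eta j).

Lemma card_orthogonal w : w != 0 -> (#|[pred i | dotp (eta i) w == 0%R]| <= 1)%N.
Proof.
move=> w0; apply/card_le1P => i; rewrite inE => /eqP Ei j; rewrite !inE.
apply/eqP/eqP => [Ej|->//]; apply/eqP/negPn/negP; rewrite eq_sym => /noncol; apply.
have := @perp_det2_eq0 R w (eta i) (eta j) w0; rewrite !(dotpC w) => /(_ Ei Ej).
by rewrite /det2 /collinear; lra.
Qed.

(** The two tangents from P. The product of scalar product and determinant with w is unchanged by
    eta -> - eta, so it can separate directions up to sign; on tangent directions its square is
    constant. *)
Lemma card_tangent_through c P : 0 < c.2 ->
  (#|[pred i | `[< tangent (eta i) c (dotp (eta i) P) >]]| <= 2)%N.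
Proof.
move=> c0; set w := P - c.1.
have T i : `[< tangent (eta i) c (dotp (eta i) P) >] -> dotp w (eta i) ^+ 2 = c.2 ^+ 2.
  by move=> H; have := elimT (asboolP _) H; rewrite /tangent eta1 mul1r -dotpB dotpC.
apply: (@card_two_values _ _ (fun i => dotp w (eta i) * det2 w (eta i))
  (c.2 ^+ 2 * (dotp w w - c.2 ^+ 2))); last first.
  by move=> i Ai; rewrite exprMn dot_det_sqr (T i Ai) eta1 mulr1.
move=> i j Ai Aj E; apply/eqP/negPn/negP => /noncol; apply.
have Ti := T i Ai; have Tj := T j Aj.
have c20 : 0 < c.2 ^+ 2 by rewrite exprn_gt0.
have w0 : w != 0.
  by apply/eqP => w0; move: Ti; rewrite w0 /dotp /= !mul0r addr0 expr0n/= => /esym/eqP; rewrite gt_eqF.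
have n0 k : dotp w (eta k) ^+ 2 = c.2 ^+ 2 -> dotp w (eta k) != 0.
  by move=> Ek; apply/eqP => K; move: Ek; rewrite K expr0n/= => /esym/eqP; rewrite gt_eqF.
have : dotp w (eta i) ^+ 2 == dotp w (eta j) ^+ 2 by rewrite Ti Tj.
rewrite eqf_sqr => /orP[] /eqP D.
  have -> : eta i = eta j; last by rewrite /collinear mulrC.
  apply: (dot_det_inj w0 D); apply: (mulfI (n0 _ Ti)).
  by rewrite E D.
have -> : eta i = - eta j; last by rewrite /collinear /= !mulNr mulrC.
apply: (dot_det_inj w0); first by rewrite dotpN.
apply: (mulfI (n0 _ Ti)); rewrite E D.
by rewrite /det2 /=; ring.
Qed.

End Directions.
End Counting.

(** * From circles to annuli *)

Section SameAnnuli.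
Context {R : realType}.
Implicit Types (y : R * R) (r s : R) (c : (R * R) * R).

Definition annular_data n (Om : 'I_n -> set (R * R)) (cs : 'I_n -> seq ((R * R) * R)) :=
  forall m, (exists y0 r r', [/\ 0 <= r, r < r', Om m = annulus y0 r r' &
      cs m = annulus_circles y0 r r']) \/
    (~ is_annulus (Om m) /\ cs m = [::]).

Definition pairwise_disjoint n (Om : 'I_n -> set (R * R)) :=
  forall m m' y, Om m y -> Om m' y -> m = m'.

Definition on_circles n (cs : 'I_n -> seq ((R * R) * R)) c := exists m, c \in cs m.

Lemma annulus_point y0 r r' s : 0 <= s -> annulus y0 r r' (y0 + (s, 0)) <-> r <= s <= r'.
Proof.
move=> s0; rewrite /annulus /= addrC addKr /enorm /dotp /= mulr0 addr0 -expr2.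
by rewrite sqrtr_sqr ger0_norm.
Qed.

Lemma mem_annulus_circles y0 r r' c : c \in annulus_circles y0 r r' ->
  c.1 = y0 /\ (c.2 = r' \/ c.2 = r /\ r != 0).
Proof.
rewrite inE => /orP[/eqP ->|]; first by split => //; left.
by case: eqVneq => // rn0; rewrite inE => /eqP ->; split => //; right.
Qed.

Lemma annular_data_mem n (Om : 'I_n -> set (R * R)) cs m c : annular_data Om cs -> c \in cs m ->
  exists r r', [/\ 0 <= r, r < r', Om m = annulus c.1 r r',
    cs m = annulus_circles c.1 r r' & c.2 = r' \/ c.2 = r /\ r != 0].
Proof.
move=> /(_ m)[[y0 [r [r' [r0 rr E Ec]]]]|[_ ->]//].
by rewrite Ec => /mem_annulus_circles[E1 H]; exists r, r'; rewrite E1.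
Qed.

Section Step.
Context n1 n2 (Om1 : 'I_n1 -> set (R * R)) (Om2 : 'I_n2 -> set (R * R))
  (cs1 : 'I_n1 -> seq ((R * R) * R)) (cs2 : 'I_n2 -> seq ((R * R) * R)).
Hypotheses (d1 : annular_data Om1 cs1) (d2 : annular_data Om2 cs2)
  (p1 : pairwise_disjoint Om1) (p2 : pairwise_disjoint Om2)
  (same : forall c, on_circles cs1 c <-> on_circles cs2 c).

(** A circle of the source through the point y0 + (s, 0) of piece m belongs to m by disjointness,
    but m has only the radii r and r'. *)
Lemma no_inner_circle n (Om : 'I_n -> set (R * R)) cs m y0 r r' s : annular_data Om cs ->
  pairwise_disjoint Om -> Om m = annulus y0 r r' -> cs m = annulus_circles y0 r r' ->
  r < s -> s < r' -> 0 <= s -> ~ on_circles cs (y0, s).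
Proof.
move=> d p Em Ec rs sr s0 [m' m'c].
have [q [q' [q0 qq E _ sE]]] := annular_data_mem d m'c; rewrite /= in E sE.
have E1 : Om m (y0 + (s, 0)) by rewrite Em; apply/annulus_point; lra.
have E2 : Om m' (y0 + (s, 0)).
  by rewrite E; apply/annulus_point => //; case: sE => [|[]]; lra.
move: m'c; rewrite -(p m m' _ E1 E2) Ec => /mem_annulus_circles[_ /= []] => [sE'|[sE' _]].
  by rewrite sE' ltxx in sr.
by rewrite sE' ltxx in rs.
Qed.

(** The outer circle of m occurs in the second source. If it is outer there, unequal inner radii
    would put a circle inside an annulus. If it is the inner circle of a larger annulus, the
    induction hypothesis puts that annulus in the first source, where it meets m along the circle
    without being equal to it. *)
Lemma annulus_step m y0 r r' : 0 <= r -> r < r' -> Om1 m = annulus y0 r r' ->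
  cs1 m = annulus_circles y0 r r' ->
  (forall m2 z s s', 0 <= s -> s < s' -> Om2 m2 = annulus z s s' -> cs2 m2 = annulus_circles z s s' ->
     r' < s' -> exists m1, Om1 m1 = Om2 m2) ->
  exists m2, Om2 m2 = Om1 m.
Proof.
move=> r0 rr Em Ec IH; have r'0 := le_lt_trans r0 rr.
have [m2 m2c] : on_circles cs2 (y0, r') by apply/same; exists m; rewrite Ec inE eqxx.
have [s [s' [s0 ss E2 Ec2 rE]]] := annular_data_mem d2 m2c; rewrite /= in E2 Ec2 rE.
case: rE => [E|[E sn0]].
  rewrite -E in E2 Ec2 ss; exists m2; rewrite E2 Em.
  have [sr|rs|-> //] := ltgtP s r.
    have rn0 : r != 0 by rewrite gt_eqF// (le_lt_trans s0).
    have := no_inner_circle d2 p2 E2 Ec2 sr rr r0; case; apply/same; exists m.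
    by rewrite Ec /annulus_circles (negbTE rn0) !inE eqxx orbT.
  have sn0 : s != 0 by rewrite gt_eqF// (le_lt_trans r0).
  have := no_inner_circle d1 p1 Em Ec rs ss s0; case; apply/same; exists m2.
  by rewrite Ec2 /annulus_circles (negbTE sn0) !inE eqxx orbT.
rewrite -E in E2 Ec2 ss.
have [m1 E1] := IH m2 y0 r' s' (ltW r'0) ss E2 Ec2 ss.
have A1 : Om1 m (y0 + (r', 0)) by rewrite Em; apply/annulus_point; lra.
have A2 : Om1 m1 (y0 + (r', 0)) by rewrite E1 E2; apply/annulus_point; lra.
have : Om1 m (y0 + (s', 0)).
  rewrite (p1 A1 A2) E1 E2; apply/annulus_point; lra.
by rewrite Em => /annulus_point => H; have := H (ltW (lt_trans r'0 ss)); lra.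
Qed.

End Step.

Lemma same_annuli n1 n2 (Om1 : 'I_n1 -> set (R * R)) (Om2 : 'I_n2 -> set (R * R)) cs1 cs2 :
  annular_data Om1 cs1 -> annular_data Om2 cs2 ->
  pairwise_disjoint Om1 -> pairwise_disjoint Om2 ->
  (forall c, on_circles cs1 c <-> on_circles cs2 c) -> annuli Om1 = annuli Om2.
Proof.
move=> d1 d2 p1 p2 same.
pose C := flatten [seq cs1 m | m : 'I_n1].
(* The number of circles of radius above s. It drops when the outer radius grows to that of another
   annulus, and drives one induction for both inclusions at once, since [annulus_step] switches the
   sources. *)
pose k (s : R) := count (fun c => s < c.2) C.
have cnt (D : seq ((R * R) * R)) (s : R) c0 : s < c0.2 -> c0 \in D ->
    (count (fun c => c0.2 < c.2)%R D < count (fun c => s < c.2)%R D)%N.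
  move=> ss; elim: D => //= c D IH; rewrite inE => /orP[/eqP <-|/IH {}IH].
    by rewrite ltxx ss add0n add1n ltnS; apply: sub_count => c' /=; exact: lt_trans.
  rewrite -addnS leq_add//.
  by have [H|//] := boolP (c0.2 < c.2); rewrite (lt_trans ss H).
have kmon s s' z : s < s' -> on_circles cs1 (z, s') -> (k s' < k s)%N.
  move=> ss [m mc]; apply: (cnt C s (z, s')) => //.
  by apply/flattenP; exists (cs1 m) => //; apply/mapP; exists m; rewrite ?mem_enum.
have main N : (forall m y0 r r', (k r' < N)%N -> 0 <= r -> r < r' -> Om1 m = annulus y0 r r' ->
      cs1 m = annulus_circles y0 r r' -> exists m2, Om2 m2 = Om1 m) /\
    (forall m y0 r r', (k r' < N)%N -> 0 <= r -> r < r' -> Om2 m = annulus y0 r r' ->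
      cs2 m = annulus_circles y0 r r' -> exists m1, Om1 m1 = Om2 m).
  elim: N => // N [IH1 IH2]; split=> m y0 r r'; rewrite ltnS => kN r0 rr Em Ec.
    apply: (annulus_step d1 d2 p1 p2 same r0 rr Em Ec) => m2 z s s' s0 ss E2 Ec2 rs.
    apply: (IH2 m2 z s s') => //; apply: leq_trans _ kN; apply: (kmon _ _ z rs).
    by apply/same; exists m2; rewrite Ec2 inE eqxx.
  apply: (annulus_step d2 d1 p2 p1 _ r0 rr Em Ec) => [c|m2 z s s' s0 ss E2 Ec2 rs].
    by split=> /same.
  apply: (IH1 m2 z s s') => //; apply: leq_trans _ kN; apply: (kmon _ _ z rs).
  by exists m2; rewrite Ec2 inE eqxx.
apply/seteqP; split=> A [aA [m Am]]; split => //; rewrite Am in aA *.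
  have [[y0 [r [r' [r0 rr Em Ec]]]]|[]//] := d1 m.
  by have [m2 E] := (main (k r').+1).1 m y0 r r' (leqnn _) r0 rr Em Ec; exists m2.
have [[y0 [r [r' [r0 rr Em Ec]]]]|[]//] := d2 m.
by have [m2 E] := (main (k r').+1).2 m y0 r r' (leqnn _) r0 rr Em Ec; exists m2.
Qed.

End SameAnnuli.

(** * From far field patterns to the Radon transform *)

Section FarField.
Context {R : realType}.
Local Notation mu2 := (@lebesgue_measure R \x @lebesgue_measure R)%E.
Local Notation R2 := (measurableTypeR R * measurableTypeR R)%type.
Implicit Types (x y : R * R) (f : R * R -> R[i]) (u v : R * R -> R).

Definition part (b : bool) f y : R := if b then complex.Re (f y) else complex.Im (f y).

Definition cos_int u x k := \int[mu2]_(y in setT) (u y * cos (k * dotp x y)).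
Definition sin_int u x k := \int[mu2]_(y in setT) (u y * sin (k * dotp x y)).

Lemma measurable_dotp x : measurable_fun setT (fun y : R2 => dotp x y).
Proof.
apply: measurable_funD; apply: measurable_funM; try exact: measurable_cst.
- exact: measurable_fst.
- exact: measurable_snd.
Qed.

Lemma bcs2_cos u x k : bcs2 u -> bcs2 (fun y => u y * cos (k * dotp x y)).
Proof.
move=> bu; apply: bcs2M => // [|y]; last exact: norm_cos1.
by apply: (measurableT_comp (measurable_cosM k)); exact: measurable_dotp.
Qed.

Lemma bcs2_sin u x k : bcs2 u -> bcs2 (fun y => u y * sin (k * dotp x y)).
Proof.
move=> bu; apply: bcs2M => // [|y]; last exact: norm_sin1.
by apply: (measurableT_comp (measurable_sinM k)); exact: measurable_dotp.
Qed.

Lemma int2D u v : bcs2 u -> bcs2 v -> \int[mu2]_(y in setT) (u y + v y) =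
  \int[mu2]_(y in setT) u y + \int[mu2]_(y in setT) v y.
Proof. by move=> bu bv; rewrite RintegralD//; exact: bcs2_integrable. Qed.

Lemma int2B u v : bcs2 u -> bcs2 v -> \int[mu2]_(y in setT) (u y - v y) =
  \int[mu2]_(y in setT) u y - \int[mu2]_(y in setT) v y.
Proof. by move=> bu bv; rewrite RintegralB//; exact: bcs2_integrable. Qed.

Lemma far_fieldE f x k : (forall b, bcs2 (part b f)) -> far_field f x k =
  Complex (cos_int (part true f) x k + sin_int (part false f) x k)
          (cos_int (part false f) x k - sin_int (part true f) x k).
Proof.
move=> bf; rewrite /far_field /Cintegral; congr Complex.
  rewrite /cos_int /sin_int -int2D; [|exact: bcs2_cos|exact: bcs2_sin].
  apply: eq_Rintegral => y _; rewrite /part /expi; case: (f y) => a b /=.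
  by rewrite cosN sinN; ring.
rewrite /cos_int /sin_int -int2B; [|exact: bcs2_cos|exact: bcs2_sin].
apply: eq_Rintegral => y _; rewrite /part /expi; case: (f y) => a b /=.
by rewrite cosN sinN; ring.
Qed.

Lemma cos_intN u x k : cos_int u (- x) k = cos_int u x k.
Proof. by apply: eq_Rintegral => y _; rewrite dotpC dotpN mulrN cosN dotpC. Qed.

Lemma sin_intN u x k : bcs2 u -> sin_int u (- x) k = - sin_int u x k.
Proof.
move=> bu; rewrite -[RHS]mulN1r /sin_int.
rewrite -(@RintegralZl _ _ _ mu2 setT (fun y : R2 => u y * sin (k * dotp x y)))//;
  last exact: (bcs2_integrable (bcs2_sin x k bu)).
apply: eq_Rintegral => y _; rewrite (dotpC (- x)) dotpN mulrN sinN dotpC.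
by rewrite mulN1r mulrN.
Qed.

(** Changing x to - x keeps the cosine integrals and negates the sine integrals, so half sums and
    half differences separate the real and imaginary parts of f. *)
Lemma same_far_field_int f1 f2 x k :
  (forall b, bcs2 (part b f1)) -> (forall b, bcs2 (part b f2)) ->
  far_field f1 x k = far_field f2 x k -> far_field f1 (- x) k = far_field f2 (- x) k ->
  forall b, cos_int (part b f1) x k = cos_int (part b f2) x k /\
            sin_int (part b f1) x k = sin_int (part b f2) x k.
Proof.
move=> b1 b2; rewrite !far_fieldE// !cos_intN !sin_intN// => -[E1 E2] [E3 E4].
by case; split; lra.
Qed.

Definition detecting f1 f2 x := forall b, exists e d r, [/\ 0 < r, axis e, adapted (r *: x) e d, d != 0 &
  forall s, {for s, continuous (radon (fun y => part b f1 y - part b f2 y) e d)} ->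
    radon (fun y => part b f1 y - part b f2 y) e d s = 0].

Lemma bcs2B u v : bcs2 u -> bcs2 v -> bcs2 (fun y => u y - v y).
Proof.
move=> [mu [B [T [B0 T0 uB]]]] [mv [C [S [C0 S0 vC]]]]; split.
  exact: measurable_funB.
exists (B + C), (Num.max T S); split; rewrite ?addr_ge0 ?le_max ?T0//.
move=> y; rewrite (le_trans (ler_normB _ _))// mulrDl lerD//.
- by rewrite (le_trans (uB y))// ler_wpM2l// ler_nat le_max; case: (`|y| <= T).
- by rewrite (le_trans (vC y))// ler_wpM2l// ler_nat le_max; case: (`|y| <= S); rewrite ?orbT.
Qed.

Lemma far_field_detecting f1 f2 x (k1 k2 : R) :
  (forall b, bcs2 (part b f1)) -> (forall b, bcs2 (part b f2)) -> x != 0 -> k1 < k2 ->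
  (forall k, k1 < k < k2 -> far_field f1 x k = far_field f2 x k /\
     far_field f1 (- x) k = far_field f2 (- x) k) -> detecting f1 f2 x.
Proof.
move=> b1 b2 x0 k12 H b; apply: (radon_null _ x0 k12); first exact: bcs2B.
move=> k kk; have [E1 E2] := H k kk; have [C S] := same_far_field_int b1 b2 E1 E2 b.
split.
  transitivity (cos_int (part b f1) x k - cos_int (part b f2) x k); last by rewrite C subrr.
  rewrite -int2B; [|exact: bcs2_cos|exact: bcs2_cos].
  by apply: eq_Rintegral => y _; rewrite mulrBl.
transitivity (sin_int (part b f1) x k - sin_int (part b f2) x k); last by rewrite S subrr.
rewrite -int2B; [|exact: bcs2_sin|exact: bcs2_sin].
by apply: eq_Rintegral => y _; rewrite mulrBl.
Qed.

End FarField.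

Lemma uniq_image_card (I : eqType) (T : Type) (s : seq I) (g : I -> T) (A : set T) N :
  uniq s -> {in s &, injective g} -> A = [set g i | i in [set` s]] -> (A #= `I_N)%card -> size s = N.
Proof.
move=> us gs -> card; apply/card_eq_II; rewrite card_eq_sym.
apply: card_eq_trans (_ : (_ #= [set g i | i in [set` s]])%card) _; first by rewrite card_eq_sym.
clear card; case: s us gs => [_ _|x0 s us gs].
  rewrite (_ : [set _ | _ in _] = set0); first by rewrite II0.
  by apply/seteqP; split => // y [].
set t := x0 :: s in us gs *.
have -> : [set g i | i in [set` t]] = (g \o nth x0 t) @` `I_(size t).
  apply/seteqP; split=> y /= [i jt <-].
    by exists (index i t); [rewrite index_mem|rewrite /= nth_index].
  by exists (nth x0 t i) => //; exact: mem_nth.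
apply: inj_card_eq => i j; rewrite !inE /= => it jt E.
have := gs _ _ (mem_nth x0 (s := t) it) (mem_nth x0 (s := t) jt) E.
by move=> /eqP; rewrite nth_uniq// => /eqP.
Qed.

(** * The geometric data of an admissible source *)

Section SourceData.
Context {R : realType}.
Implicit Types (y p P : R * R) (c : (R * R) * R).

Record source_data (f : R * R -> R[i]) n (Om : 'I_n -> set (R * R))
    (es : 'I_n -> seq ((R * R) * (R * R))) (cs : 'I_n -> seq ((R * R) * R))
    (vs : 'I_n -> seq (R * R)) : Prop := SourceData {
  sd_pieces : forall m, piece_geometry (Om m) (es m) (cs m) (vs m) ;
  sd_annular : annular_data Om cs ;
  sd_rsource : forall b, rsource Om (part b f) ;
  sd_supp : supp f = region Om ;
  sd_neq0 : forall P, frontier (region Om) P -> exists b, part b f P != 0 }.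

Lemma piece_geometryP A : compact A -> is_annulus A \/ is_simply_connected_polygon A ->
  exists es cs vs, piece_geometry A es cs vs /\
    ((exists y0 r r', [/\ 0 <= r, r < r', A = annulus y0 r r' & cs = annulus_circles y0 r r']) \/
     ~ is_annulus A /\ cs = [::]).
Proof.
move=> cA H; have [[y0 [r [r' [r0 rr E]]]]|na] := pselect (is_annulus A).
  exists [::], (annulus_circles y0 r r'), [::]; split.
    by rewrite E; exact: annulus_geometry.
  by left; exists y0, r, r'.
case: H => // -[_ reg [n [v [chain Fr]]]].
exists [seq (v i, v (ordS i)) | i : 'I_n], [::], (codom v); split; last by right.
exact: polygon_geometry (plane_compact_closed cA) reg chain Fr.
Qed.

Lemma admissible_source_data L f n (Om : 'I_n -> set (R * R)) M N :
  admissible_source L f Om M N -> exists es cs vs, source_data f Om es cs vs.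
Proof.
move=> [[_ un cpt disj _ _ _ C1 nz] shape _ _ _].
have /choice[es H] m := piece_geometryP (cpt m) (shape m).
have {H} /choice[cs H] := H; have {H} /choice[vs H] := H.
have supE : supp f = region Om.
  rewrite un; apply/seteqP; split=> y; first by move=> [m _ ym]; exists m.
  by move=> [m ym]; exists m.
exists es, cs, vs; split => //.
- by move=> m; exact: (H m).1.
- by move=> m; exact: (H m).2.
- move=> b; split => //.
  + move=> m m' y ym ym'; apply/eqP/negPn/negP => /disj E.
    by have : (Om m `&` Om m') y by []; rewrite E.
  + move=> y ny; have : f y = 0.
      apply/eqP/negPn/negP => fy; have : supp f y by exact: subset_closure.
      by rewrite supE => -[m]; exact: ny.
    by rewrite /part => ->; case: b.
  + by move=> m; have [c1 c2] := C1 m; case: b.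
move=> P; rewrite -supE => /nz fP; apply: contrapT => nb.
have E b : part b f P = 0 by apply/eqP/negPn/negP => K; apply: nb; exists b.
by move/eqP: fP; apply; move: (E true) (E false); rewrite /part; case: (f P) => a b /= -> ->.
Qed.

Section Bounds.
Variables (f : R * R -> R[i]) (n : nat) (Om : 'I_n -> set (R * R))
  (es : 'I_n -> seq ((R * R) * (R * R))) (cs : 'I_n -> seq ((R * R) * R)) (vs : 'I_n -> seq (R * R)).
Hypothesis sd : source_data f Om es cs vs.

Lemma sd_disjoint : pairwise_disjoint Om.
Proof. exact: rs_disj (sd_rsource sd true). Qed.

(** A radial displacement changes the sign of [circle_eq], outwards or inwards. This places the
    contact points on the frontier of the support, where f is nonzero. *)
Lemma circle_frontier m c P : c \in cs m -> circle_eq c P = 0 -> frontier (region Om) P.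
Proof.
move=> cm cP; have mP := circle_sub (sd_pieces sd) cm cP.
apply: (frontier_region (sd_rsource sd true) (m := m)); split; first exact: subset_closure.
have [outer H] := pg_side (sd_pieces sd m) cm; have c0 := pg_pos (sd_pieces sd m) cm.
move=> iP; have Hside := H P cP.
pose w : R * R := P - c.1; have ww : dotp w w = c.2 ^+ 2 by apply/eqP; rewrite -subr_eq0; apply/eqP.
have side v := small_direction v (filterI iP ((near_small _ _).2 Hside)).
have [t t0 [t1 [Hp Hm]]] := small_ex (smallI (small_lt ltr01) (smallI (side _ w) (side _ (- w)))).
have c20 : 0 < c.2 ^+ 2 by rewrite exprn_gt0.
have E (s : R) : circle_eq c (P + s *: w) = (2 * s + s ^+ 2) * c.2 ^+ 2.
  by rewrite circle_eqD cP add0r -/w !dotpZ (dotpC (s *: w)) dotpZ ww; ring.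
case: outer {H Hside side} Hp Hm => -[Ap Sp] [Am Sm].
  have := Sp.1 Ap; rewrite E pmulr_lle0//; have := exprn_gt0 2 t0; lra.
have := Sm.1 Am; rewrite scalerN -scaleNr E pmulr_lge0// expr2; nra.
Qed.

Definition annulus_index := [pred m | `[< is_annulus (Om m) >]].

Lemma card_annuli M : (annuli Om #= `I_M)%card -> #|annulus_index| = M.
Proof.
move=> card; rewrite cardE; apply: (uniq_image_card (g := Om)) card => [||].
- exact: enum_uniq.
- move=> i j; rewrite !mem_enum => /asboolP[y0 [r [r' [r0 rr E]]]] _ Eij.
  have y : Om i (y0 + (r, 0)) by rewrite E -/(annulus y0 r r'); apply/annulus_point => //; rewrite lexx ltW.
  by apply: sd_disjoint (y) _; rewrite -Eij.
apply/seteqP; split=> A /=.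
  by move=> [aA [m Am]]; exists m => //; rewrite mem_enum; apply/asboolP; rewrite -Am.
by move=> [m]; rewrite mem_enum => /asboolP am <-; split => //; exists m.
Qed.

Lemma circles_size m : (size (cs m) <= 2 * annulus_index m)%N.
Proof.
have [[y0 [r [r' [r0 rr E ->]]]]|[_ ->]//] := sd_annular sd m.
rewrite /annulus_index /= (_ : `[< _ >] = true); first by rewrite /annulus_circles; case: ifP.
by apply/asboolP; rewrite E; exists y0, r, r'.
Qed.

Lemma circles_total (Q : pred 'I_n) : (size (flatten [seq cs m | m <- enum Q]) <= 2 * #|predI annulus_index Q|)%N.
Proof.
rewrite size_flatten sumnE !big_map big_enum/=.
apply: leq_trans (_ : (\sum_(m in Q) 2 * annulus_index m <= _)%N).
  by apply: leq_sum => m _; exact: circles_size.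
rewrite -big_distrr/= leq_mul2l/= -sum1_card [leqLHS]big_mkcond [leqRHS]big_mkcond.
apply: leq_sum => m _; rewrite -[m \in Q]/(Q m) -[m \in predI _ _]/(annulus_index m && Q m).
by rewrite /annulus_index /=; case: (Q m); case: `[< _ >].
Qed.
End Bounds.
End SourceData.

(** * Choice of a good direction *)

Section Determination.
Context {R : realType}.
Implicit Types (p w x y P Q : R * R) (c : (R * R) * R).

Lemma tangentZ x (r : R) c (s : R) : r != 0 -> tangent (r *: x) c (r * s) <-> tangent x c s.
Proof.
move=> r0; rewrite /tangent; have r20 : r ^+ 2 != 0 by rewrite expf_neq0.
have Z v : dotp (r *: x) v = r * dotp x v by rewrite dotpC dotpZ dotpC.
rewrite !Z dotpZ (_ : (r * s - r * dotp x c.1) ^+ 2 = r ^+ 2 * (s - dotp x c.1) ^+ 2); last by ring.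
rewrite (_ : r * (_ * _) * _ = r ^+ 2 * (dotp x x * c.2 ^+ 2)); last by ring.
by split=> [/(mulfI r20)|->].
Qed.

Context n1 n2 (Om1 : 'I_n1 -> set (R * R)) (Om2 : 'I_n2 -> set (R * R)) (f1 f2 : R * R -> R[i])
  (es1 : 'I_n1 -> seq ((R * R) * (R * R))) (cs1 : 'I_n1 -> seq ((R * R) * R)) (vs1 : 'I_n1 -> seq (R * R))
  (es2 : 'I_n2 -> seq ((R * R) * (R * R))) (cs2 : 'I_n2 -> seq ((R * R) * R)) (vs2 : 'I_n2 -> seq (R * R)).
Hypotheses (sd1 : source_data f1 Om1 es1 cs1 vs1) (sd2 : source_data f2 Om2 es2 cs2 vs2).
Variables (I : finType) (eta : I -> R * R).
Hypotheses (eta1 : forall i, dotp (eta i) (eta i) = 1) (det : forall i, detecting f1 f2 (eta i)).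

Let geo b1 b2 := (assembled_geometry (sd_rsource sd1 b1) (sd_pieces sd1),
                  assembled_geometry (sd_rsource sd2 b2) (sd_pieces sd2)).

Lemma mem_flatten_ord (T : eqType) n (F : 'I_n -> seq T) z :
  reflect (exists m, z \in F m) (z \in flatten [seq F m | m : 'I_n]).
Proof.
apply: (iffP flattenP) => [[s /mapP[m _ ->] zm]|[m zm]]; first by exists m.
by exists (F m) => //; apply/mapP; exists m; rewrite ?mem_enum.
Qed.

(** I will index the 2L vectors. Only circles of pieces other than m are counted, hence
    #|annulus_index Om1| - 1 annuli of the first source; the 8 on the right of the inequality pays
    for the annulus m. *)
Lemma circle_determined m c : injective eta -> c \in cs1 m -> ~ on_circles cs2 c ->
  (8 * (#|annulus_index Om1| + #|annulus_index Om2|) < #|I| + 8)%N -> False.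
Proof.
move=> inj cm nc count; have c0 := pg_pos (sd_pieces sd1 m) cm.
have am : annulus_index Om1 m.
  have [r [r' [r0 rr E _ _]]] := annular_data_mem (sd_annular sd1) cm.
  by apply/asboolP; rewrite E; exists c.1, r, r'.
have {}count : (4 * (2 * #|annulus_index Om1|.-1 + 2 * #|annulus_index Om2|) < #|I|)%N.
  have : (0 < #|annulus_index Om1|)%N by apply/card_gt0P; exists m.
  by lia.
pose L1 := flatten [seq cs1 m' | m' <- enum (predC1 m)].
pose L2 := flatten [seq cs2 m' | m' <- enum 'I_n2].
have s1 : (size L1 <= 2 * #|annulus_index Om1|.-1)%N.
  apply: leq_trans (circles_total sd1 _) _; rewrite leq_mul2l/= (cardD1 m (annulus_index Om1)).
  rewrite [m \in _]am add1n/=; apply/eq_leq/eq_card => i; rewrite !inE /=.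
  by rewrite andbC.
have s2 : (size L2 <= 2 * #|annulus_index Om2|)%N.
  apply: leq_trans (circles_total sd2 _) _; rewrite leq_mul2l/=.
  by apply/eq_leq/eq_card => i; rewrite !inE andbT.
have posL c' : c' \in L1 ++ L2 -> 0 < c'.2 /\ c' != c.
  rewrite mem_cat => /orP[] /flattenP[s /mapP[m']]; rewrite mem_enum.
    rewrite inE => mm -> c'm; split; first exact: pg_pos (sd_pieces sd1 m') _ c'm.
    apply: contra mm => /eqP E; apply/eqP; rewrite E in c'm.
    pose P := c.1 + (c.2, 0).
    have cP : circle_eq c P = 0.
      by rewrite circle_eqD /circle_eq subrr /dotp /=; ring.
    apply: (sd_disjoint sd1 (y := P)); [exact: (circle_sub (sd_pieces sd1) c'm cP)|].
    exact: (circle_sub (sd_pieces sd1) cm cP).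
  move=> _ -> c'm; split; first exact: pg_pos (sd_pieces sd2 m') _ c'm.
  by apply/eqP => E; apply: nc; exists m'; rewrite -E.
pose bad c' : pred I := [pred i | `[< tangent (eta i) c' (dotp (eta i) c.1 - c.2) >]].
have [i good] : exists i, all (fun r : pred I => ~~ r i) [seq bad c' | c' <- L1 ++ L2].
  apply: exists_all_avoid; apply: leq_ltn_trans count.
  rewrite big_map big_seq; apply: leq_trans (_ : (\sum_(c' <- L1 ++ L2 | c' \in L1 ++ L2) 4 <= _)%N).
    apply: leq_sum => c' /posL[c'0 ne]; exact: card_tangent.
  rewrite -big_seq big_const_seq count_predT iter_addn_0 leq_mul2l/= size_cat.
  exact: leq_add.
move: good; rewrite all_map => /allP/= avoid.
(* The contact point of c with its smallest tangent line. The part b of f is chosen for P, and the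
   coordinates e, d then come from the direction and b. *)
set P := c.1 - c.2 *: eta i.
have cP : circle_eq c P = 0.
  transitivity (c.2 ^+ 2 * dotp (eta i) (eta i) - c.2 ^+ 2); last by rewrite eta1 mulr1 subrr.
  by rewrite /circle_eq /P /dotp /= /GRing.scale/=; ring.
have [b fP] := sd_neq0 sd1 (circle_frontier sd1 cm cP).
have [e [d [r [r0 ae ad d0 null]]]] := det i b.
have rn0 : r != 0 by rewrite gt_eqF.
have Z v : dotp (r *: eta i) v = r * dotp (eta i) v by rewrite dotpC dotpZ dotpC.
have s0E : r * (dotp (eta i) c.1 - c.2) =
    dotp (r *: eta i) c.1 - Num.sqrt (dotp (r *: eta i) (r *: eta i)) * c.2.
  by rewrite !Z dotpZ eta1 mulr1 -expr2 sqrtr_sqr gtr0_norm// mulrBr.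
have not_tan c' : c' \in L1 ++ L2 -> ~ tangent (r *: eta i) c' (r * (dotp (eta i) c.1 - c.2)).
  by move=> /avoid/asboolPn nt /(tangentZ _ _ _ rn0).
apply: (circle_detected ae ad d0 (sd_rsource sd1 b) (sd_rsource sd2 b)
  (geo b b).1 (geo b b).2 null _ s0E).
- by apply/mem_flatten_ord; exists m.
- move=> c' /mem_flatten_ord[m' c'm] cc; have [mm|mm] := eqVneq m' m.
    move=> /(tangentZ _ _ _ rn0); apply: concentric_not_tangent => //.
      exact: pg_pos (sd_pieces sd1 m') _ c'm.
    have [q [q' [_ _ _ E _]]] := annular_data_mem (sd_annular sd1) cm.
    by rewrite mm E in c'm; have [] := mem_annulus_circles c'm.
  apply: not_tan; rewrite mem_cat; apply/orP; left; apply/flattenP; exists (cs1 m') => //.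
  by apply/mapP; exists m'; rewrite ?mem_enum.
- move=> c' /mem_flatten_ord[m' c'm]; apply: not_tan; rewrite mem_cat; apply/orP; right.
  by apply/flattenP; exists (cs2 m') => //; apply/mapP; exists m'; rewrite ?mem_enum.
(* The contact point is unique: w + c.2 eta has norm zero. *)
move=> P' cP'; rewrite Z => /(mulfI rn0) E; suff -> : P' = P by [].
pose w : R * R := P' - c.1.
have ww : dotp w w = c.2 ^+ 2 by apply/eqP; rewrite -subr_eq0; apply/eqP.
have xw : dotp (eta i) w = - c.2 by rewrite /w dotpB E; ring.
have wE : w + c.2 *: eta i = 0.
  apply/eqP/negPn/negP => /dotpp_gt0; suff -> : dotp (w + c.2 *: eta i) (w + c.2 *: eta i) = 0.
    by rewrite ltxx.
  transitivity (dotp w w + 2 * c.2 * dotp (eta i) w + c.2 ^+ 2 * dotp (eta i) (eta i)).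
    by rewrite /dotp /= /GRing.scale/=; ring.
  by rewrite ww xw eta1; ring.
by rewrite /P -(subrK c.1 P') -/w -[w](addrK (c.2 *: eta i)) wE sub0r addrC.
Qed.

Hypothesis noncol : forall i j, i != j -> ~ collinear (eta i) (eta j).
Local Notation W1 := (undup (flatten [seq vs1 m | m : 'I_n1])).
Local Notation W2 := (undup (flatten [seq vs2 m | m : 'I_n2])).

(** Here I will index the L directions themselves. Every circle of the second source is one of the
    first, so the circles are counted once. *)
Lemma vertex_determined P : P \in W1 -> P \notin W2 ->
  (forall c, on_circles cs2 c -> on_circles cs1 c) ->
  (size W1 + size W2 + 4 * #|annulus_index Om1| <= #|I|)%N -> False.
Proof.
move=> P1 P2 sub count.
have {}count : ((size W1).-1 + size W2 + 2 * (2 * #|annulus_index Om1|) < #|I|)%N.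
  have : (0 < size W1)%N by case: W1 P1.
  by lia.
pose L := flatten [seq cs1 m' | m' <- enum 'I_n1].
have sL : (size L <= 2 * #|annulus_index Om1|)%N.
  apply: leq_trans (circles_total sd1 _) _; rewrite leq_mul2l/=.
  by apply/eq_leq/eq_card => i; rewrite !inE andbT.
have memL c : on_circles cs1 c -> c \in L.
  move=> [m cm]; apply/flattenP; exists (cs1 m) => //.
  by apply/mapP; exists m; rewrite ?mem_enum.
pose V := rem P W1 ++ W2.
have VP Q : Q \in V -> Q != P.
  rewrite mem_cat mem_rem_uniq ?undup_uniq// inE => /orP[/andP[]//|Q2].
  by apply: contraNneq P2 => <-.
pose badv Q : pred I := [pred i | dotp (eta i) (Q - P) == 0].
pose badc c : pred I := [pred i | `[< tangent (eta i) c (dotp (eta i) P) >]].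
have [i good] : exists i, all (fun r : pred I => ~~ r i)
    ([seq badv Q | Q <- V] ++ [seq badc c | c <- L]).
  apply: exists_all_avoid; apply: leq_ltn_trans count; rewrite big_cat !big_map/=.
  apply: leq_add.
    rewrite big_seq; apply: leq_trans (_ : (\sum_(Q <- V | Q \in V) 1 <= _)%N).
      by apply: leq_sum => Q /VP QP; apply: card_orthogonal => //; rewrite subr_eq0.
    by rewrite -big_seq sum1_size size_cat size_rem.
  rewrite big_seq; apply: leq_trans (_ : (\sum_(c <- L | c \in L) 2 <= _)%N).
    apply: leq_sum => c /flattenP[s /mapP[m _ ->] cm]; apply: card_tangent_through => //.
    exact: pg_pos (sd_pieces sd1 m) _ cm.
  by rewrite -big_seq big_const_seq count_predT iter_addn_0 leq_mul2l/=.
move: good; rewrite all_cat !all_map => /andP[/allP/= avoidv /allP/= avoidc].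
have /mem_flatten_ord[m Pm] : P \in flatten [seq vs1 m | m : 'I_n1] by rewrite -mem_undup.
have FP := frontier_region (sd_rsource sd1 true) (vertex_frontier (sd_pieces sd1) Pm).
have [b fP] := sd_neq0 sd1 FP.
have [e [d [r [r0 ae ad d0 null]]]] := det i b.
have rn0 : r != 0 by rewrite gt_eqF.
have Z v : dotp (r *: eta i) v = r * dotp (eta i) v by rewrite dotpC dotpZ dotpC.
have not_tan c : on_circles cs1 c -> ~ tangent (r *: eta i) c (dotp (r *: eta i) P).
  by move=> /memL/avoidc/asboolPn nt; rewrite Z => /(tangentZ _ _ _ rn0).
have not_v Q : Q \in V -> dotp (r *: eta i) Q != dotp (r *: eta i) P.
  by move=> /avoidv nv; rewrite -subr_eq0 -dotpB Z mulf_neq0.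
apply: (corner_detected ae ad d0 (sd_rsource sd1 b) (sd_rsource sd2 b)
  (geo b b).1 (geo b b).2 null (P := P)) => //.
- by rewrite /= -mem_undup.
- move=> Q Q1 E; apply/eqP/negPn/negP => QP.
  have QV : Q \in V by rewrite mem_cat mem_rem_uniq ?undup_uniq// inE QP mem_undup Q1.
  by have := not_v Q QV; rewrite E eqxx.
- by move=> Q Q2; apply: not_v; rewrite mem_cat mem_undup Q2 orbT.
- by move=> c /mem_flatten_ord; exact: not_tan.
by move=> c /mem_flatten_ord/sub; exact: not_tan.
Qed.

End Determination.

Theorem theorem3p6 (R : realType)
  (L : nat) (theta : 'I_L -> R * R)
  (theta_unit : forall i, unit_circle (theta i))
  (theta_noncollinear : forall i j : 'I_L, i != j -> ~ collinear (theta i) (theta j))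
  (kmin kmax : R) (kmin_gt0 : 0 < kmin) (kmin_lt_kmax : kmin < kmax)
  (f1 f2 : R * R -> R[i])
  (n1 n2 : nat) (Om1 : 'I_n1 -> set (R * R)) (Om2 : 'I_n2 -> set (R * R))
  (M1 N1 M2 N2 : nat)
  (adm1 : admissible_source L f1 Om1 M1 N1)
  (adm2 : admissible_source L f2 Om2 M2 N2)
  (same_far_field : forall (i : 'I_L) (k : R), kmin < k < kmax ->
     far_field f1 (theta i) k = far_field f2 (theta i) k /\
     far_field f1 (- theta i) k = far_field f2 (- theta i) k) :
  annuli Om1 = annuli Om2 /\ corners (supp f1) = corners (supp f2).
Proof.
have [es1 [cs1 [vs1 sd1]]] := admissible_source_data adm1.
have [es2 [cs2 [vs2 sd2]]] := admissible_source_data adm2.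
have bnd1 b := rs_bcs2 (sd_rsource sd1 b); have bnd2 b := rs_bcs2 (sd_rsource sd2 b).
have th1 i : dotp (theta i) (theta i) = 1 by rewrite -enorm_sqr (theta_unit i) expr1n.
have nz v : dotp v v = 1 -> v != 0 :> R * R.
  by move=> v1; apply/eqP => v0; move: v1; rewrite v0 /dotp /= !mul0r addr0 => /eqP; rewrite eq_sym oner_eq0.
(* A circle is probed at its smallest tangent line; with the opposite vector the same test reaches
   its other tangent line, which doubles the available tests. *)
pose eta (p : 'I_L * bool) : R * R := if p.2 then - theta p.1 else theta p.1.
have eta1 p : dotp (eta p) (eta p) = 1.
  by rewrite /eta; case: ifP => _; rewrite ?dotpN ?(dotpC (- _)) ?dotpN ?opprK.
have det12 p : detecting f1 f2 (eta p).
  apply: (far_field_detecting bnd1 bnd2 (nz _ (eta1 p)) kmin_lt_kmax) => k kk.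
  have [E1 E2] := same_far_field p.1 k kk.
  by rewrite /eta; case: ifP => _; rewrite ?opprK.
have det21 p : detecting f2 f1 (eta p).
  apply: (far_field_detecting bnd2 bnd1 (nz _ (eta1 p)) kmin_lt_kmax) => k kk.
  have [E1 E2] := same_far_field p.1 k kk.
  by rewrite /eta; case: ifP => _; rewrite ?opprK.
have eta_inj : injective eta.
  move=> [i b] [j b'] E; have ij : i = j.
    apply/eqP/negPn/negP => /theta_noncollinear; apply; rewrite /collinear.
    move: E; rewrite /eta /=; case: b; case: b' => E.
    - by move/oppr_inj: E => ->; rewrite mulrC.
    - by rewrite -E /= !mulrN mulrC.
    - by rewrite E /= !mulNr mulrC.
    - by rewrite E mulrC.
  rewrite -ij in E *; congr pair; have opp : - theta i != theta i.
    apply/eqP => K; have := th1 i; rewrite -{1}K dotpC dotpN th1; lra.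
  move: E; rewrite /eta /=; case: b; case: b' => // E.
    by rewrite E eqxx in opp.
  by rewrite -E eqxx in opp.
have cI : #|{: 'I_L * bool}| = (L * 2)%N by rewrite card_prod card_ord card_bool.
have M1E := card_annuli sd1 (admissible_annuli adm1).
have M2E := card_annuli sd2 (admissible_annuli adm2).
have C1E := corners_region (sd_rsource sd1 true) (sd_pieces sd1).
have C2E := corners_region (sd_rsource sd2 true) (sd_pieces sd2).
have vertices n (vs : 'I_n -> seq (R * R)) (A : set (R * R)) N :
    A = [set p | p \in flatten [seq vs m | m : 'I_n]] -> (A #= `I_N)%card ->
    size (undup (flatten [seq vs m | m : 'I_n])) = N.
  move=> AE; apply: (uniq_image_card (g := id)) => //; first exact: undup_uniq.
  rewrite AE; apply/seteqP; split=> p /=; first by move=> pv; exists p; rewrite ?mem_undup.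
  by move=> [q]; rewrite mem_undup => qv <-.
have := admissible_corners adm1; rewrite (sd_supp sd1) => /(vertices _ _ _ _ C1E) N1E.
have := admissible_corners adm2; rewrite (sd_supp sd2) => /(vertices _ _ _ _ C2E) N2E.
have [D1 D1'] : (8 * M1 < L + 4 /\ 4 * M1 + 2 * N1 <= L)%N.
  by have := admissible_directions adm1; rewrite /enough_directions gt_max => /andP[]; lia.
have [D2 D2'] : (8 * M2 < L + 4 /\ 4 * M2 + 2 * N2 <= L)%N.
  by have := admissible_directions adm2; rewrite /enough_directions gt_max => /andP[]; lia.
(* Adding 8 M1 < L + 4 and 8 M2 < L + 4 gives 8 (M1 + M2) < 2 L + 8, the count required for 2 L
   vectors. *)
have same c : on_circles cs1 c <-> on_circles cs2 c.
  split=> -[m cm]; apply: contrapT => nc.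
    apply: (circle_determined sd1 sd2 eta1 det12 eta_inj cm nc).
    by rewrite cI M1E M2E; lia.
  apply: (circle_determined sd2 sd1 eta1 det21 eta_inj cm nc).
  by rewrite cI M1E M2E; lia.
have annE : annuli Om1 = annuli Om2.
  exact: same_annuli (sd_annular sd1) (sd_annular sd2) (sd_disjoint sd1) (sd_disjoint sd2) same.
split => //; have MM : M1 = M2.
  by rewrite -M2E; apply/esym/(card_annuli sd2); rewrite -annE; exact: admissible_annuli adm1.
(* For corners only [theta] is used, because opposite vectors are collinear. As M1 = M2, the average
   of the bounds 4 M + 2 N <= L for the two sources is N1 + N2 + 4 M1 <= L. *)
rewrite C1E C2E; apply/seteqP; split=> P /=; rewrite -mem_undup => PV.
  rewrite -mem_undup; apply/negPn/negP => nP.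
  apply: (vertex_determined sd1 sd2 th1 (fun i => det12 (i, false)) theta_noncollinear PV nP).
    by move=> c /same.
  by rewrite N1E N2E M1E card_ord; lia.
rewrite -mem_undup; apply/negPn/negP => nP.
apply: (vertex_determined sd2 sd1 th1 (fun i => det21 (i, false)) theta_noncollinear PV nP).
  by move=> c /same.
by rewrite N1E N2E M2E card_ord; lia.
Qed.
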